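(* Let $M$ be a $\mathrm{II}_1$ factor and $Q$ a hyperfinite von Neumann algebra with a fixed faithful normal normalised trace $\phi$. Then $$\mathcal G(M*Q)\leq\mathcal G(M)+\tfrac12\,\delta_0(Q).$$
   Context: For a $\mathrm{II}_1$ factor $M$ with its faithful normal trace $\tau$, $\tau(1)=1$, let $\mathcal P(M)$ be the collection of all finite sets of mutually orthogonal projections in $M$ which sum to $1$. For $x\in M$ and $P\in\mathcal P(M)$ put $\mathcal I(x;P)=\sum_{p,q\in P,\ pxq\neq 0}\tau(p)\tau(q)$. For a finite subset $X\subset M$ put $\mathcal I(X;P)=\sum_{x\in X}\mathcal I(x;P)$ and $\mathcal I(X)=\inf_{P\in\mathcal P(M)}\mathcal I(X;P)$. $W^*(X)$ denotes the von Neumann algebra generated by $X$ (not automatically assumed to contain the identity of $M$). The generator invariant is $\mathcal G(M)=\inf\{\mathcal I(X): X\subset M\text{ finite},\ W^*(X)=M\}$, with $\mathcal G(M)=\infty$ if $M$ is not finitely generated. $M*Q$ is the von Neumann algebra free product with respect to the normalised trace of $M$ and $\phi$. The number $\delta_0(Q)$ (depending on $\phi$) is the common value of Voiculescu's modified free entropy dimension $\delta_0(X)$ over all finite generating sets $X$ of $Q$ (Jung); it is given explicitly as follows. Decompose $Q\cong Q_0\oplus\bigoplus_{i=1}^s\mathbb M_{k_i}(\mathbb C)$, where $Q_0$ is diffuse or $\{0\}$, the sum on the right is empty, finite or countably infinite, and $k_i\in\mathbb N$; write $\phi=\alpha_0\phi_0\oplus\bigoplus_{i=1}^s\alpha_i\,\mathrm{tr}_{k_i}$,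 where $\mathrm{tr}_{k_i}$ is the tracial state on $\mathbb M_{k_i}(\mathbb C)$, each $\alpha_i>0$ for $i\geq1$, and $\phi_0$ is a faithful normal (normalised) trace on $Q_0$ with $\alpha_0>0$ if $Q_0\neq\{0\}$, while $\alpha_0=0$, $\phi_0=0$ if $Q_0=\{0\}$. Then $$\delta_0(Q)=1-\sum_{i=1}^s\frac{\alpha_i^2}{k_i^2}.$$ Hyperfinite means generated by an increasing sequence of finite-dimensional $*$-subalgebras. *)

(* Defs.v *)
From HB Require Import structures.
From mathcomp Require Export all_boot all_order all_algebra.
From mathcomp Require Export finmap complex.
From mathcomp Require Export all_classical all_reals all_analysis.

Set Implicit Arguments.
Unset Strict Implicit.
Unset Printing Implicit Defensive.

Export Order.TTheory GRing.Theory Num.Theory.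
Export numFieldNormedType.Exports.
Global Open Scope classical_set_scope.
Global Open Scope ring_scope.
Global Open Scope complex_scope.

(* Complex Hilbert spaces; the inner product is linear in its first argument. *)
Record hilbertType (R : realType) := HilbertType {
  hilbert_sort :> completeNormedModType R[i];
  inner : {dot hilbert_sort for Num.conj};
  inner_norm : forall x : hilbert_sort, inner x x = `|x| ^+ 2
}.

(* Operators are plain functions, with the pointwise linear structure, and
   composition as product; algebras of operators are subsets of [bounded_ops]. *)
Notation op H := (hilbert_sort H -> hilbert_sort H).

Section operators.
Context {R : realType} {H : hilbertType R}.
Local Notation C := R[i].
Implicit Types (x y p z : op H) (S A M : set (op H)).

Definition bounded_ops : set (op H) := [set x | linear x /\ continuous x].

(* By Riesz, every bounded operator has exactly one adjoint. *)
Definition is_adjoint x y :=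
  bounded_ops y /\ forall u v : H, inner H (x u) v = inner H u (y v).

Definition adj x : op H := xget 0 [set y | is_adjoint x y].

(* Loewner order (complex numbers: 0 <= c means that c is real and >= 0). *)
Definition op_le x y := forall u : H, 0 <= inner H ((y - x) u) u.

Definition is_proj p := [/\ bounded_ops p, adj p = p & p \o p = p].

Record star_subalgebra S : Prop := StarSubalgebra {
  ssa_bounded : S `<=` bounded_ops;
  ssa_zero : S 0;
  ssa_linear : forall (a : C) x y, S x -> S y -> S (a *: x + y);
  ssa_mul : forall x y, S x -> S y -> S (x \o y);
  ssa_adj : forall x, S x -> S (adj x)
}.

(* The topology of pointwise convergence on [H -> H] induces the strong
   operator topology on bounded operators. *)
Definition sot_closed S :=
  forall x, bounded_ops x -> closure (S : set {ptws H -> H}) x -> S x.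

(* Not necessarily containing the identity of [H]. *)
Definition vn_subalgebra S := star_subalgebra S /\ sot_closed S.

Definition von_neumann_algebra M := vn_subalgebra M /\ M idfun.

(* W^*(X), not necessarily containing the identity of [H]. *)
Definition Wstar : set (op H) -> set (op H) := smallest vn_subalgebra.

Definition center M : set (op H) :=
  [set x | M x /\ forall y, M y -> x \o y = y \o x].

Definition factor M :=
  von_neumann_algebra M /\ center M = [set a *: (idfun : op H) | a in [set: C]].

(* No minimal projections; {0} is diffuse. *)
Definition diffuse A :=
  forall p, A p -> is_proj p -> p <> 0 ->
    exists q, [/\ A q, is_proj q, q <> 0, q <> p & p \o q = q].

(* The functional is defined on all operators, but only its values on M matter.
   [tr_normal]: the trace of the supremum of a directed set of positive
   elements of M is the supremum of their traces. *)
Record faithful_normal_trace M (tau : op H -> C) : Prop := FaithfulNormalTrace {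
  tr_linear : forall (a : C) x y, M x -> M y ->
    tau (a *: x + y) = a * tau x + tau y;
  tr_positive : forall x, M x -> 0 <= tau (adj x \o x);
  tr_one : tau idfun = 1;
  tr_commute : forall x y, M x -> M y -> tau (x \o y) = tau (y \o x);
  tr_faithful : forall x, M x -> tau (adj x \o x) = 0 -> x = 0;
  tr_normal : forall (D : set (op H)) x,
    D `<=` M -> D !=set0 -> (forall y, D y -> op_le 0 y) ->
    (forall y z, D y -> D z -> exists w, [/\ D w, op_le y w & op_le z w]) ->
    M x -> (forall y, D y -> op_le y x) ->
    (forall z, M z -> (forall y, D y -> op_le y z) -> op_le x z) ->
    forall c : C, (forall y, D y -> tau y <= c) -> tau x <= c
}.

Definition tracial_vN M (tau : op H -> C) :=
  von_neumann_algebra M /\ faithful_normal_trace M tau.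

(* Type II (no minimal projections) and finite (by the trace). *)
Definition II1_factor M (tau : op H -> C) :=
  [/\ factor M, diffuse M & faithful_normal_trace M tau].

Definition finite_dim A :=
  exists (n : nat) (e : 'I_n -> op H),
    forall x, A x -> exists c : 'I_n -> C, x = \sum_(i < n) c i *: e i.

Definition hyperfinite M :=
  exists A : nat -> set (op H),
    [/\ forall n, star_subalgebra (A n) /\ finite_dim (A n),
        forall n, A n `<=` A n.+1
      & Wstar (\bigcup_n A n) = M].

Definition proj_partition M (P : {fset (op H)}) : Prop :=
  [/\ forall p, p \in P -> M p /\ is_proj p,
      forall p q, p \in P -> q \in P -> p != q -> p \o q = 0
    & \sum_(p <- P) p = idfun].

Definition cut_weight (tau : op H -> C) x (P : {fset (op H)}) : R :=
  \sum_(p <- P) \sum_(q <- P | p \o x \o q != 0)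
     complex.Re (tau p) * complex.Re (tau q).

Definition cut_weight_set M (tau : op H -> C) (X : {fset (op H)}) : \bar R :=
  ereal_inf [set (\sum_(x <- X) cut_weight tau x P)%:E
            | P in [set P | proj_partition M P]].

(* The infimum of the empty set is +oo. *)
Definition generator_invariant M (tau : op H -> C) : \bar R :=
  ereal_inf [set cut_weight_set M tau X
            | X in [set X : {fset (op H)} |
                    [set` X] `<=` M /\ Wstar [set` X] = M]].

(* Q = Q_0 (+) (+)_(i in I) M_(k i)(C), with Q_0 = z0 Q, the i-th matrix
   summand being the range of rho i, and phi restricted to it being
   alpha i times the tracial state.  The summands are cut out by pairwise
   orthogonal central projections with (strong) sum 1. *)
Record atomic_decomposition (Q : set (op H)) (phi : op H -> C) (I : set nat)
    (k : nat -> nat) (alpha : nat -> R) (z0 : op H)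
    (rho : forall i, 'M[C]_(k i) -> op H) : Prop := AtomicDecomposition {
  ad_z0_proj : is_proj z0;
  ad_z0_central : center Q z0;
  ad_diffuse : diffuse [set z0 \o x | x in Q];
  ad_size : forall i, I i -> (0 < k i)%N;
  ad_weight : forall i, I i -> 0 < alpha i;
  ad_rho_linear : forall i, I i -> linear (@rho i);
  ad_rho_mul : forall i, I i -> forall a b, rho i (a *m b) = rho i a \o rho i b;
  ad_rho_adj : forall i, I i -> forall a,
    rho i (map_mx Num.conj a^T) = adj (rho i a);
  ad_rho_inj : forall i, I i -> injective (@rho i);
  ad_rho_central : forall i, I i -> center Q (rho i 1%:M);
  ad_rho_range : forall i, I i ->
    range (@rho i) = [set rho i 1%:M \o x | x in Q];
  ad_trace : forall i, I i -> forall a,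
    phi (rho i a) = (alpha i)%:C * (\tr a / (k i)%:R);
  ad_orth0 : forall i, I i -> z0 \o rho i 1%:M = 0;
  ad_orth : forall i j, I i -> I j -> i <> j -> rho i 1%:M \o rho j 1%:M = 0;
  ad_sum : forall u : H,
    z0 u + \sum_(i < n | (i : nat) \in I) rho i 1%:M u @[n --> \oo] --> u
}.

(* The value of the free entropy dimension of a hyperfinite algebra, computed
   from any decomposition as above (it does not depend on the choice). *)
Definition is_delta0 (Q : set (op H)) (phi : op H -> C) (d : \bar R) :=
  exists I k alpha z0 rho,
    @atomic_decomposition Q phi I k alpha z0 rho /\
    d = (1 - \esum_(i in I) (alpha i ^+ 2 / (k i)%:R ^+ 2)%:E)%E.

(* Freeness of two subalgebras: alternating products of centred elements are
   centred.  [A b], [b : bool], are the two subalgebras. *)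
Definition free_pair (tau : op H -> C) (A : bool -> set (op H)) :=
  forall (n : nat) (b : nat -> bool) (x : nat -> op H),
    (forall i, (i <= n)%N -> A (b i) (x i) /\ tau (x i) = 0) ->
    (forall i, (i < n)%N -> b i != b i.+1) ->
    tau (\big[comp/idfun]_(i < n.+1) x i) = 0.

End operators.

Record trace_embedding (R : realType) (H K : hilbertType R)
    (M : set (op H)) (tau : op H -> R[i]) (N : set (op K)) (tauN : op K -> R[i])
    (f : op H -> op K) : Prop := TraceEmbedding {
  te_into : forall x, M x -> N (f x);
  te_linear : forall (a : R[i]) x y, M x -> M y ->
    f (a *: x + y) = a *: f x + f y;
  te_mul : forall x y, M x -> M y -> f (x \o y) = f x \o f y;
  te_adj : forall x, M x -> f (adj x) = adj (f x);
  te_one : f idfun = idfun;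
  te_trace : forall x, M x -> tauN (f x) = tau x
}.

(* (N, tauN) is the free product of (M, tau) and (Q, phi), which is determined up
   to trace-preserving isomorphism: N is generated by free copies of M and Q.
   Trace-preserving embeddings are automatically injective and normal. *)
Definition is_free_product (R : realType) (H1 H2 K : hilbertType R)
    (M : set (op H1)) (tau : op H1 -> R[i])
    (Q : set (op H2)) (phi : op H2 -> R[i])
    (N : set (op K)) (tauN : op K -> R[i]) :=
  exists (f : op H1 -> op K) (g : op H2 -> op K),
    [/\ tracial_vN N tauN,
        trace_embedding M tau N tauN f,
        trace_embedding Q phi N tauN g,
        free_pair tauN (fun b => if b then f @` M else g @` Q)
      & Wstar (f @` M `|` g @` Q) = N].

(* Main.v *)
Require Import Defs.
From mathcomp Require Import ring lra.
From HB Require Import structures.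

Set Implicit Arguments.
Unset Strict Implicit.
Unset Printing Implicit Defensive.

(* Let N = M * Q.  Freeness makes a projection of Q equivalent, already in the von Neumann algebra
   that it generates together with M, to any projection of M of the same trace.  Hence if e is a small
   projection of M and q, q' are projections of Q, an element y = q y q' of N is a sum of pieces
   v^* z w with v, w at hand and z in e N e, and about tau(q) tau(q') / tau(e)^2 elements z occur;
   each of them adds at most tau(e)^2 to the cut weight once e belongs to the partition.  So y costs
   tau(q) tau(q').

   Along a chain of finite-dimensional subalgebras of Q, keep a list of orthogonal projections whose
   sum generates the full ideal.  Splitting a projection of the list into parts of traces a and b
   costs ab, and merging two equivalent projections of trace a costs a^2 / 2: both costs are half of
   the decrease of the sum of the squared traces, which starts at 1 and never falls below
   sum_i alpha_i^2 / k_i^2.  The tail of the chain has arbitrarily small cost, and is encoded in a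
   single element of e N e.  Finally, trace-preserving embeddings are normal, so a von Neumann
   subalgebra of N that contains the images of the generators contains the images of M and Q. *)

(** * Identities in noncommutative rings *)

(** Freeness enters through one identity: if z in N commutes with M and q is a projection of Q, then
    tau(z q) = tau(z) tau(q). An algebra S between M and N need not be a factor, so equal traces
    alone do not make two of its projections equivalent. But central projections of S commute with
    M; the identity and the uniqueness of the trace of M give equal traces against all of them,
    which is what comparison in S tests.

    The cost ab of a split, instead of a(a+b), comes from a rotation: a partial isometry y from r to
    q', both below q, can be corrected so that r y is positive. Then r y is a square root determined
    by the other corner (q-r) y, and only that corner is paid for. The cost a^2/2 of a merge comes
    from cutting a unitary into n pieces, rotating one piece at a time, and letting n tend to
    infinity.

    The embeddings of M and Q are given algebraically. Their normality is derived by carrying 2-norm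
    approximations through the trace and truncating them in N. *)

Inductive ncexp := NCvar of nat | NC0 | NC1 | NCadd of ncexp & ncexp
  | NCmul of ncexp & ncexp | NCopp of ncexp.

Section ncring.
Variable T : pzRingType.
Implicit Types (e : seq T) (l : seq (bool * seq nat)).

Fixpoint nc_eval e x : T :=
  match x with
  | NCvar i => nth 0 e i | NC0 => 0 | NC1 => 1
  | NCadd a b => nc_eval e a + nc_eval e b
  | NCmul a b => nc_eval e a * nc_eval e b
  | NCopp a => - nc_eval e a
  end.

Definition nc_mon e (m : bool * seq nat) : T :=
  (-1) ^+ m.1 * foldr (fun i x => nth 0 e i * x) 1 m.2.

Definition nc_sum e l : T := \sum_(m <- l) nc_mon e m.

Fixpoint nc_norm x : seq (bool * seq nat) :=
  match x with
  | NCvar i => [:: (false, [:: i])] | NC0 => [::] | NC1 => [:: (false, [::])]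
  | NCadd a b => nc_norm a ++ nc_norm b
  | NCmul a b => [seq (m.1 (+) m'.1, m.2 ++ m'.2) | m <- nc_norm a, m' <- nc_norm b]
  | NCopp a => [seq (~~ m.1, m.2) | m <- nc_norm a]
  end.

(** A sum of signed words vanishes when the words cancel in pairs; [k] is fuel, and the length of
    the list is enough of it. *)
Fixpoint nc_zero k l : bool :=
  match k, l with
  | _, [::] => true
  | k.+1, m :: l' => let m' := (~~ m.1, m.2) in
                     (m' \in l') && nc_zero k (rem m' l')
  | 0, _ => false
  end.

Lemma nc_mon_opp e m : nc_mon e (~~ m.1, m.2) = - nc_mon e m.
Proof. by rewrite /nc_mon signrN mulNr. Qed.

Lemma nc_normE e x : nc_eval e x = nc_sum e (nc_norm x).
Proof.
rewrite /nc_sum; elim: x => [i|||a IHa b IHb|a IHa b IHb|a IHa] /=.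
- by rewrite big_seq1 /nc_mon /= mul1r mulr1.
- by rewrite big_nil.
- by rewrite big_seq1 /nc_mon /= mul1r.
- by rewrite big_cat /= IHa IHb.
- rewrite big_allpairs_dep /= IHa IHb mulr_suml; apply: eq_bigr => m _.
  rewrite mulr_sumr; apply: eq_bigr => m' _; rewrite /nc_mon /= signr_addb.
  have -> : foldr (fun i z => e`_i * z) 1 (m.2 ++ m'.2)
     = foldr (fun i z => e`_i * z) 1 m.2 * foldr (fun i z => e`_i * z) 1 m'.2.
    by elim: m.2 => [|i s IH] /=; rewrite ?mul1r // IH mulrA.
  have c (y : T) : y * (-1) ^+ m'.1 = (-1) ^+ m'.1 * y.
    by case: m'.1; rewrite /= ?expr1 ?expr0 ?mulrN ?mulNr ?mulr1 ?mul1r.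
  by rewrite !mulrA; congr (_ * _); rewrite -!mulrA; congr (_ * _); rewrite c.
- by rewrite big_map IHa -sumrN; apply: eq_bigr => m _; rewrite nc_mon_opp.
Qed.

Lemma nc_zeroP e k l : nc_zero k l -> nc_sum e l = 0.
Proof.
rewrite /nc_sum; elim: k l => [|k IH] [|m l] //=; rewrite ?big_nil // => /andP[ml z].
by rewrite big_cons (perm_big _ (perm_to_rem ml)) big_cons nc_mon_opp addNKr IH.
Qed.

Lemma nc_correct e x y : nc_zero (size (nc_norm (NCadd x (NCopp y))))
   (nc_norm (NCadd x (NCopp y))) -> nc_eval e x = nc_eval e y.
Proof.
by move=> /(nc_zeroP e); rewrite -nc_normE /= => /eqP; rewrite subr_eq0 => /eqP.
Qed.

End ncring.

(** Atoms are compared up to conversion rather than syntactically, so that two presentations of one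
    operator share an index. *)
Ltac nc_index x l :=
  lazymatch l with
  | cons ?y ?l' =>
      let b := match goal with _ => let _ := constr:(erefl : x = y) in constr:(true)
               | _ => constr:(false) end in
      lazymatch b with true => constr:(0%N)
      | false => let n := nc_index x l' in constr:(S n) end
  | _ => fail
  end.
Ltac nc_mem x l :=
  lazymatch l with
  | cons ?y ?l' =>
      match goal with _ => let _ := constr:(erefl : x = y) in constr:(true)
               | _ => nc_mem x l' end
  | _ => constr:(false)
  end.
Ltac nc_atoms l t :=
  lazymatch t with
  | GRing.add ?a ?b => let l1 := nc_atoms l a in nc_atoms l1 b
  | Algebra.add ?a ?b => let l1 := nc_atoms l a in nc_atoms l1 b
  | GRing.mul ?a ?b => let l1 := nc_atoms l a in nc_atoms l1 b
  | GRing.opp ?a => nc_atoms l a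
  | Algebra.opp ?a => nc_atoms l a
  | GRing.zero => l
  | Algebra.zero => l
  | GRing.one _ => l
  | _ => let b := nc_mem t l in
         lazymatch b with true => l | false => constr:(cons t l) end
  end.
Ltac nc_reify l t :=
  lazymatch t with
  | GRing.add ?a ?b => let x := nc_reify l a in let y := nc_reify l b in constr:(NCadd x y)
  | Algebra.add ?a ?b => let x := nc_reify l a in let y := nc_reify l b in constr:(NCadd x y)
  | GRing.mul ?a ?b => let x := nc_reify l a in let y := nc_reify l b in constr:(NCmul x y)
  | GRing.opp ?a => let x := nc_reify l a in constr:(NCopp x)
  | Algebra.opp ?a => let x := nc_reify l a in constr:(NCopp x)
  | GRing.zero => constr:(NC0)
  | Algebra.zero => constr:(NC0)
  | GRing.one _ => constr:(NC1)
  | _ => let n := nc_index t l in constr:(NCvar n)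
  end.
Ltac ncring :=
  lazymatch goal with
  | |- @eq ?T ?a ?b =>
     let l0 := nc_atoms (@nil T) a in
     let l := nc_atoms l0 b in
     let x := nc_reify l a in
     let y := nc_reify l b in
     apply: (@nc_correct _ l x y); vm_compute; reflexivity
  end.

(** * Hilbert spaces *)

Section hilbert.
Context {R : realType} {H : hilbertType R}.
Local Notation C := R[i].
Implicit Types (u v w : H) (a : C) (r s e : R).

(** A real inner product with the same norm. Estimates and adjoints are handled with it; [rip_inner]
    recovers the complex product from its values at [u] and at ['i%C *: u]. *)
Definition rip u v : R := complex.Re (inner H u v).
Definition nrm u : R := complex.Re `|u|.

Lemma ReD (a b : C) : complex.Re (a + b) = complex.Re a + complex.Re b.
Proof. by case: a; case: b. Qed.
Lemma ReN (a : C) : complex.Re (- a) = - complex.Re a.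
Proof. by case: a. Qed.
Lemma ReZ r (a : C) : complex.Re (r%:C * a) = r * complex.Re a.
Proof. by case: a => x y /=; rewrite mul0r subr0. Qed.
Lemma ReZr r (a : C) : complex.Re (a * r%:C) = complex.Re a * r.
Proof. by rewrite mulrC ReZ mulrC. Qed.
Lemma Re_conj (a : C) : complex.Re (Num.conj a) = complex.Re a.
Proof. by case: a. Qed.
Lemma le_Re (a b : C) : a <= b -> complex.Re a <= complex.Re b.
Proof. by rewrite lecE => /andP[]. Qed.

Lemma normE u : `|u| = (nrm u)%:C.
Proof. by rewrite RRe_real // normr_real. Qed.

Lemma nrm_ge0 u : 0 <= nrm u.
Proof. by rewrite -ler0c -normE. Qed.
Lemma nrm0 : nrm 0 = 0.
Proof. by rewrite /nrm normr0. Qed.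
Lemma nrm_eq0 u : nrm u = 0 -> u = 0.
Proof. by move=> h; apply/eqP; rewrite -normr_eq0 normE h. Qed.
Lemma nrmD u v : nrm (u + v) <= nrm u + nrm v.
Proof. by rewrite -lecR rmorphD /= -!normE ler_normD. Qed.
Lemma nrmN u : nrm (- u) = nrm u.
Proof. by rewrite /nrm normrN. Qed.
Lemma nrmB u v : nrm (u - v) <= nrm u + nrm v.
Proof. by rewrite -(nrmN v) nrmD. Qed.
Lemma nrmBC u v : nrm (u - v) = nrm (v - u).
Proof. by rewrite -nrmN opprB. Qed.
Lemma nrm_tri w u v : nrm (u - v) <= nrm (u - w) + nrm (w - v).
Proof. by rewrite -[u - v](subrKA w) nrmD. Qed.
Lemma nrmZ a u : nrm (a *: u) = complex.Re `|a| * nrm u.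
Proof. by rewrite /nrm normrZ normE ReZr. Qed.
Lemma normC_real r : `|r%:C : C| = `|r|%:C.
Proof. by rewrite normc_def /= expr0n addr0 sqrtr_sqr. Qed.
Lemma nrmZr r u : nrm (r%:C *: u) = `|r| * nrm u.
Proof. by rewrite nrmZ normC_real. Qed.

Lemma ripDl u v w : rip (u + v) w = rip u w + rip v w.
Proof. by rewrite /rip linearDl ReD. Qed.
Lemma ripDr u v w : rip w (u + v) = rip w u + rip w v.
Proof. by rewrite /rip linearDr ReD. Qed.
Lemma ripNl u v : rip (- u) v = - rip u v.
Proof. by rewrite /rip linearNl ReN. Qed.
Lemma ripNr u v : rip u (- v) = - rip u v.
Proof. by rewrite /rip linearNr ReN. Qed.
Lemma ripBl u v w : rip (u - v) w = rip u w - rip v w.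
Proof. by rewrite ripDl ripNl. Qed.
Lemma ripBr u v w : rip w (u - v) = rip w u - rip w v.
Proof. by rewrite ripDr ripNr. Qed.
Lemma innerZl a u v : inner H (a *: u) v = a * inner H u v.
Proof. by rewrite linearZl_LR. Qed.
Lemma innerC u v : inner H u v = Num.conj (inner H v u).
Proof. by rewrite hermC expr0 mul1r. Qed.
Lemma innerZr a u v : inner H u (a *: v) = Num.conj a * inner H u v.
Proof. by rewrite [LHS]innerC innerZl rmorphM /= [inner H u v]innerC. Qed.
Lemma ripZl r u v : rip (r%:C *: u) v = r * rip u v.
Proof. by rewrite /rip innerZl ReZ. Qed.
Lemma ripC u v : rip u v = rip v u.
Proof. by rewrite /rip innerC Re_conj. Qed.
Lemma ripZr r u v : rip u (r%:C *: v) = r * rip u v.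
Proof. by rewrite ripC ripZl ripC. Qed.
Lemma rip0l u : rip 0 u = 0.
Proof. by rewrite -(subrr (0 : H)) ripBl subrr. Qed.
Lemma rip0r u : rip u 0 = 0.
Proof. by rewrite ripC rip0l. Qed.
Lemma ripE u : rip u u = nrm u ^+ 2.
Proof. by rewrite /rip inner_norm normE -rmorphXn. Qed.
Lemma rip_ge0 u : 0 <= rip u u.
Proof. by rewrite ripE sqr_ge0. Qed.

Lemma nrmD2 u v : nrm (u + v) ^+ 2 = nrm u ^+ 2 + 2 * rip u v + nrm v ^+ 2.
Proof. by rewrite -!ripE ripDl !ripDr (ripC v u); ring. Qed.
Lemma nrmB2 u v : nrm (u - v) ^+ 2 = nrm u ^+ 2 - 2 * rip u v + nrm v ^+ 2.
Proof. by rewrite nrmD2 ripNr nrmN; ring. Qed.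

Lemma cauchy_schwarz u v : `|rip u v| <= nrm u * nrm v.
Proof.
have [v0|v0] := eqVneq (nrm v) 0.
  by rewrite (nrm_eq0 v0) rip0r normr0 nrm0 mulr0.
rewrite -(@ler_pXn2r _ 2) ?nnegrE ?mulr_ge0 ?nrm_ge0 //.
rewrite real_normK ?num_real // exprMn.
have vp : 0 < nrm v ^+ 2 by rewrite exprn_gt0 // lt_neqAle eq_sym v0 nrm_ge0.
have := rip_ge0 (u - (rip u v / nrm v ^+ 2)%:C *: v).
rewrite ripE nrmB2 ripZr nrmZr exprMn real_normK ?num_real //.
move/mulr_ge0 => /(_ _ (ltW vp)).
suff -> : (nrm u ^+ 2 - 2 * (rip u v / nrm v ^+ 2 * rip u v) +
   (rip u v / nrm v ^+ 2) ^+ 2 * nrm v ^+ 2) * nrm v ^+ 2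
   = nrm u ^+ 2 * nrm v ^+ 2 - rip u v ^+ 2 by rewrite subr_ge0.
by field.
Qed.

Lemma le_cs u v : rip u v <= nrm u * nrm v.
Proof. exact: le_trans (ler_norm _) (cauchy_schwarz u v). Qed.

Lemma rip_i u v : rip ('i%C *: u) v = - complex.Im (inner H u v).
Proof. by rewrite /rip innerZl mulrC ReiNIm. Qed.

Lemma rip_inner u v u' v' :
  rip u v = rip u' v' -> rip ('i%C *: u) v = rip ('i%C *: u') v' ->
  inner H u v = inner H u' v'.
Proof.
rewrite !rip_i /rip => h /oppr_inj; move: h.
by case: (inner H u v) => a b; case: (inner H u' v') => c d /= -> ->.
Qed.

Definition ucvg (u_ : nat -> H) l :=
  forall e, 0 < e -> exists N, forall n, (N <= n)%N -> nrm (u_ n - l) < e.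

Definition ucauchy (u_ : nat -> H) :=
  forall e, 0 < e -> exists N, forall m n, (N <= m)%N -> (m <= n)%N ->
    nrm (u_ n - u_ m) < e.

Lemma pos_real_C (c : C) : 0 < c -> exists2 r : R, 0 < r & c = r%:C.
Proof.
case: c => x y; rewrite ltcE /= => /andP[/eqP -> x0]; exists x => //.
Qed.

Lemma ucvgP (u_ : nat -> H) l : ucvg u_ l <-> (u_ n @[n --> \oo] --> l).
Proof.
split=> [h|/cvgrPdist_lt h e e0].
- apply/cvgrPdist_lt => c /pos_real_C[e e0 ->].
  have [N Nh] := h _ e0; exists N => // n /= Nn.
  by rewrite distrC normE ltcR Nh.
- have := h (e%:C); rewrite ltcR => /(_ e0)[N _ Nh].
  by exists N => n Nn; rewrite -ltcR -normE distrC; apply: Nh.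
Qed.

Lemma ucauchy_cvg (u_ : nat -> H) : ucauchy u_ -> exists l, ucvg u_ l.
Proof.
move=> h; suff /cvg_ex[l lh] : cvg (u_ n @[n --> \oo]) by exists l; apply/ucvgP.
apply/cauchy_cvgP/cauchyP => c /pos_real_C[e e0 ->].
have [N Nh] := h _ e0; exists (u_ N); exists N => // n /= Nn.
by rewrite -ball_normE /ball_ /= distrC normE ltcR Nh.
Qed.

Lemma ucvg_unique (u_ : nat -> H) l l' : ucvg u_ l -> ucvg u_ l' -> l = l'.
Proof.
move=> h h'; apply/eqP; rewrite -subr_eq0; apply/eqP/nrm_eq0/eqP.
rewrite eq_le nrm_ge0 andbT; apply/ler_addgt0Pl => e e0; rewrite addr0.
have [N Nh] := h (e / 2) ltac:(lra); have [N' Nh'] := h' (e / 2) ltac:(lra).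
have := Nh (maxn N N') (leq_maxl _ _); have := Nh' (maxn N N') (leq_maxr _ _).
by have := nrm_tri (u_ (maxn N N')) l l'; rewrite (nrmBC l (u_ _)); lra.
Qed.

Lemma ucvgD (u_ v_ : nat -> H) l m : ucvg u_ l -> ucvg v_ m ->
  ucvg (fun n => u_ n + v_ n) (l + m).
Proof. by rewrite !ucvgP; exact: cvgD. Qed.
Lemma ucvgB (u_ v_ : nat -> H) l m : ucvg u_ l -> ucvg v_ m ->
  ucvg (fun n => u_ n - v_ n) (l - m).
Proof. by rewrite !ucvgP; exact: cvgB. Qed.
Lemma ucvgZ a (u_ : nat -> H) l : ucvg u_ l -> ucvg (fun n => a *: u_ n) (a *: l).
Proof. by rewrite !ucvgP => h; apply: cvgZr. Qed.
Lemma ucvg_cst l : ucvg (fun=> l) l.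
Proof. by move=> e e0; exists 0%N => n _; rewrite subrr nrm0. Qed.
Lemma ucvg_shift k (u_ : nat -> H) l : ucvg u_ l -> ucvg (fun n => u_ (n + k)%N) l.
Proof.
move=> h e e0; have [N Nh] := h e e0; exists N => n Nn; apply: Nh.
exact: leq_trans Nn (leq_addr _ _).
Qed.

Lemma ucvg_rip (u_ : nat -> H) l v c : ucvg u_ l ->
  (exists N, forall n, (N <= n)%N -> c <= rip (u_ n) v) -> c <= rip l v.
Proof.
move=> h [N Nh]; apply/ler_addgt0Pl => e e0.
have e1 : 0 < e / (nrm v + 1) by rewrite divr_gt0 // ltr_wpDl ?nrm_ge0.
have [N' Nh'] := h _ e1.
have /le_trans : c <= rip (u_ (maxn N N')) v by apply/Nh/leq_maxl.
apply; have := le_cs (u_ (maxn N N') - l) v; rewrite ripBl.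
have := Nh' _ (leq_maxr N N').
rewrite ltr_pdivlMr ?ltr_wpDl ?nrm_ge0 // => ?.
have := nrm_ge0 v; have := nrm_ge0 (u_ (maxn N N') - l); nra.
Qed.

Lemma ucvg_rip_le (u_ : nat -> H) l v c : ucvg u_ l ->
  (exists N, forall n, (N <= n)%N -> rip (u_ n) v <= c) -> rip l v <= c.
Proof.
move=> h [N Nh]; rewrite -[c]opprK lerNr -ripNr; apply: (ucvg_rip h).
by exists N => n Nn; rewrite ripNr lerN2 Nh.
Qed.

Lemma ucvg_nrm_le (u_ : nat -> H) l c : ucvg u_ l ->
  (exists N, forall n, (N <= n)%N -> nrm (u_ n) <= c) -> nrm l <= c.
Proof.
move=> h [N Nh]; apply/ler_addgt0Pl => e e0; have [N' Nh'] := h _ e0.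
have := Nh _ (leq_maxl N N'); have := Nh' _ (leq_maxr N N').
set w := u_ _; have := nrmB w (w - l); rewrite opprB addrCA subrr addr0; lra.
Qed.

(* Minimising [|w|^2 - 2 phi w] produces the Riesz vector of [phi]. *)
Lemma riesz (phi : H -> R) (c : R) :
  (forall u v, phi (u + v) = phi u + phi v) ->
  (forall r u, phi (r%:C *: u) = r * phi u) ->
  (forall u, `|phi u| <= c * nrm u) ->
  exists v, forall u, phi u = rip u v.
Proof.
move=> phiD phiZ phib; pose J w := nrm w ^+ 2 - 2 * phi w.
pose E := [set J w | w in [set: H]].
have hE : has_inf E.
  split; first by exists (J 0); exists 0.
  exists (- c ^+ 2) => _ [w _ <-].
  have := phib w; rewrite ler_norml => /andP[_] h; rewrite /J.
  by have := sqr_ge0 (nrm w - c); nra.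
have Jinf w : inf E <= J w by apply: ge_inf; [exact: hE.2|exists w].
(* The parallelogram law for [J]: two vectors that nearly minimise [J] are close, because [J] at
   their midpoint is at least the infimum. *)
have par u v : nrm (u - v) ^+ 2 = 2 * J u + 2 * J v - 4 * J (2^-1%:C *: (u + v)).
  rewrite /J nrmB2 phiZ phiD nrmZr ger0_norm ?invr_ge0 // exprMn nrmD2; by field.
have ex n : exists w, J w < inf E + n.+1%:R^-1.
  have n0 : 0 < n.+1%:R^-1 :> R by rewrite invr_gt0 ltr0n.
  by have [_ [w _ <-] h] := inf_adherent n0 hE; exists w.
have [w_ wh] := choice ex.
have [l lh] : exists l, ucvg w_ l.
  apply: ucauchy_cvg => e e0.
  have e2 : 0 < e ^+ 2 / 4 by rewrite divr_gt0 // exprn_gt0.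
  have [N Nh] := ltr_add_invr e2; rewrite add0r in Nh.
  exists N => m n Nm mn; rewrite -(@ltr_pXn2r _ 2) ?nnegrE ?nrm_ge0 // ?ltW //.
  rewrite par; move: (Jinf (2^-1%:C *: (w_ n + w_ m))).
  have h k : (N <= k)%N -> J (w_ k) < inf E + N.+1%:R^-1.
    by move=> Nk; apply: lt_le_trans (wh k) _; rewrite lerD2l lef_pV2 ?posrE ?ler_nat.
  have := h _ Nm; have := h _ (leq_trans Nm mn).
  move: Nh; move: (_^-1) (J _) (J _) (J _) (inf E) (e ^+ 2) => a1 a2 a3 a4 a5 a6; lra.
have Jl : J l <= inf E.
  apply/ler_addgt0Pl => e e0.
  pose k := 2 * nrm l + 2 * `|c| + 2.
  have kp : 0 < k by rewrite /k; have := nrm_ge0 l; have := normr_ge0 c; lra.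
  have d0 : 0 < Num.min 1 (e / (2 * k)).
    by rewrite lt_min ltr01 divr_gt0 // mulr_gt0.
  have [N Nh] := lh _ d0.
  have [N' Nh'] := ltr_add_invr (ltac:(lra) : 0 < e / 2); rewrite add0r in Nh'.
  set n := maxn N N'; have := Nh n (leq_maxl _ _).
  rewrite lt_min => /andP[h1]; rewrite ltr_pdivlMr ?mulr_gt0 // => h2.
  have h3 : J (w_ n) < inf E + e / 2.
    apply: lt_trans (wh n) _; rewrite ltrD2l; apply: le_lt_trans Nh'.
    by rewrite lef_pV2 ?posrE ?ler_nat // ltnS leq_maxr.
  have h4 : J l <= J (w_ n) + k * nrm (w_ n - l).
    rewrite /J; set d := w_ n - l; have -> : w_ n = l + d by rewrite /d addrC subrK.
    rewrite nrmD2 phiD; have := phib d; rewrite ler_norml => /andP[_].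
    have := ler_norm c; have := cauchy_schwarz l d; rewrite ler_norml => /andP[+ _].
    have := nrm_ge0 d; have := nrm_ge0 l; rewrite /k; set x := nrm d; set y := nrm l.
    move=> y0 x0 ? ?; have : c * x <= `|c| * x by rewrite ler_wpM2r.
    by have := sqr_ge0 x; nra.
  nra.
(* First-order condition at the minimiser: a quadratic in [t] that stays nonnegative and has no
   constant term has no linear term either. The test value [- b / (a + 1)] also covers [a = 0]. *)
have lin0 (b a : R) : 0 <= a -> (forall t : R, 0 <= t * b + t ^+ 2 * a) -> b = 0.
  move=> a0 h; apply/eqP; case: (ltrgt0P b) => // b0.
    have := h (- b / (a + 1)); rewrite -(pmulr_rge0 _ (ltac:(nra) : 0 < (a + 1) ^+ 2)).
    have -> : (a + 1) ^+ 2 * (- b / (a + 1) * b + (- b / (a + 1)) ^+ 2 * a)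
      = - b ^+ 2 by field; lra.
    nra.
  have := h (- b / (a + 1)); rewrite -(pmulr_rge0 _ (ltac:(nra) : 0 < (a + 1) ^+ 2)).
  have -> : (a + 1) ^+ 2 * (- b / (a + 1) * b + (- b / (a + 1)) ^+ 2 * a)
      = - b ^+ 2 by field; lra.
  nra.
exists l => u; apply/esym/eqP; rewrite -subr_eq0 -(mulrI_eq0 _ (@mulfI R 2 _)) //.
apply/eqP; apply: (lin0 _ (nrm u ^+ 2)); first exact: sqr_ge0.
move=> t; have := le_trans Jl (Jinf (l + t%:C *: u)).
rewrite /J nrmD2 phiD phiZ ripZr nrmZr exprMn real_normK ?num_real // (ripC l u); lra.
Qed.

End hilbert.

(** * The ring of bounded operators *)

Section bop.
Context {R : realType} (H : hilbertType R).
Local Notation C := R[i].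

Definition bnd : {pred op H} := fun x => `[< bounded_ops x >].

Lemma bounded_ops_bound (x : op H) : bounded_ops x ->
  exists2 c : R, 0 <= c & forall u, nrm (x u) <= c * nrm u.
Proof.
case=> xl xc; pose f : {linear H -> H} := HB.pack x (GRing.isLinear.Build C H H _ x xl).
have /linear_bounded_continuous/bounded_funP/(_ 1)[M Mh] : continuous f by [].
have M0 : 0 <= M by apply: le_trans (Mh 0 _); rewrite ?normr_ge0 // normr0 ler01.
exists (complex.Re M); first by apply: (le_Re M0).
move=> u; have [->|u0] := eqVneq u 0.
  by rewrite -[x 0]/(f 0) linear0 nrm0 mulr0.
have nu : 0 < nrm u.
  by rewrite lt_neqAle nrm_ge0 andbT eq_sym; apply: contra_neq u0; apply: nrm_eq0.
have := Mh ((nrm u)^-1%:C *: u).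
rewrite normE nrmZr ger0_norm ?invr_ge0 ?nrm_ge0 // mulVf ?gt_eqF // lexx => /(_ isT)/le_Re.
by rewrite linearZ /= -/(nrm _) nrmZr ger0_norm ?invr_ge0 ?nrm_ge0 // ler_pdivrMl // mulrC.
Qed.

Lemma bound_bounded_ops (x : op H) (c : R) : linear x ->
  (forall u, nrm (x u) <= c * nrm u) -> bounded_ops x.
Proof.
move=> xl xb; split=> // u; apply/cvgrPdist_lt => _ /pos_real_C[e e0 ->].
have d0 : 0 < e / (`|c| + 1) by rewrite divr_gt0 // ltr_wpDl.
have /cvgrPdist_lt/(_ (e / (`|c| + 1))%:C) : v @[v --> u] --> u by [].
rewrite ltcR => /(_ d0); apply: filterS => v /=.
rewrite normE ltcR ltr_pdivlMr ?ltr_wpDl // => h.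
have -> : x u - x v = x (u - v).
  by have := xl (-1) v u; rewrite !scaleN1r ![- _ + _]addrC => ->.
rewrite normE ltcR; apply: le_lt_trans (xb _) _; apply: le_lt_trans h.
rewrite mulrC ler_wpM2l ?nrm_ge0 //; have := ler_norm c; lra.
Qed.

Lemma bnd_submod : GRing.subsemimod_closed bnd.
Proof.
have bD x y : bounded_ops x -> bounded_ops y -> @bounded_ops R H (x + y).
  move=> [xl xc] [yl yc]; split=> [a u v|u].
    rewrite -[LHS]/(x _ + y _) -[RHS]/(a *: (x u + y u) + (x v + y v)).
    by rewrite xl yl scalerDr addrACA.
  by apply: cvgD; [exact: xc|exact: yc].
split; first split.
- apply/asboolP; split=> [a u v|u]; first by rewrite /= scaler0 addr0.
  exact: cvg_cst.
- by move=> x y /asboolP hx /asboolP hy; apply/asboolP/bD.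
- move=> a x /asboolP[xl xc]; apply/asboolP; split=> [b u v|u].
    rewrite -[LHS]/(a *: x _) -[RHS]/(b *: (a *: x u) + a *: x v).
    by rewrite xl scalerDr !scalerA mulrC.
  by apply: cvgZr; exact: xc.
Qed.

HB.instance Definition _ := GRing.isSubmodClosed.Build C (op H) bnd bnd_submod.

(** Composition distributes over sums on both sides only for additive maps. On this type the bounded
    operators are a ring, to which ring lemmas and [ncring] apply. *)
Record bop := Bop { bval :> op H; bvalP : bval \in bnd }.
HB.instance Definition _ := [isSub for bval].
HB.instance Definition _ := [Choice of bop by <:].
HB.instance Definition _ := [SubChoice_isSubZmodule of bop by <:].
HB.instance Definition _ := [SubZmodule_isSubLmodule of bop by <:].

Lemma bvalB (x : bop) : bounded_ops x.
Proof. by case: x => x /= /asboolP. Qed.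

Definition mkbop (x : op H) (hx : bounded_ops x) : bop := @Bop x (asboolT hx).

Lemma bopP (x y : bop) : (forall u, x u = y u) -> x = y.
Proof. by move=> h; apply/val_inj/funext. Qed.

Lemma bop_linear (x : bop) : linear x. Proof. by case: (bvalB x). Qed.
Lemma bop_bound (x : bop) : exists2 c : R, 0 <= c & forall u, nrm (x u) <= c * nrm u.
Proof. exact: bounded_ops_bound (bvalB x). Qed.

Lemma bopD (x y : bop) u : (x + y) u = x u + y u. Proof. by []. Qed.
Lemma bopN (x : bop) u : (- x) u = - x u. Proof. by []. Qed.
Lemma bopB (x y : bop) u : (x - y) u = x u - y u. Proof. by []. Qed.
Lemma bopZ a (x : bop) u : (a *: x) u = a *: x u. Proof. by []. Qed.
Lemma bop0 u : (0 : bop) u = 0. Proof. by []. Qed.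
Lemma app0 (x : bop) : x 0 = 0.
Proof. by have := bop_linear x (-1) 0 0; rewrite scaler0 addr0 scaleN1r addrC subrr. Qed.
Lemma appD (x : bop) u v : x (u + v) = x u + x v.
Proof. by have := bop_linear x 1 u v; rewrite !scale1r. Qed.
Lemma appZ (x : bop) a u : x (a *: u) = a *: x u.
Proof. by have := bop_linear x a u 0; rewrite app0 !addr0. Qed.
Lemma appN (x : bop) u : x (- u) = - x u.
Proof. by rewrite -scaleN1r appZ scaleN1r. Qed.
Lemma appB (x : bop) u v : x (u - v) = x u - x v.
Proof. by rewrite appD appN. Qed.

Lemma bounded_ops_id : @bounded_ops R H idfun.
Proof. by apply: (bound_bounded_ops (c := 1)) => // u; rewrite mul1r. Qed.
Lemma bounded_ops_comp (x y : op H) : bounded_ops x -> bounded_ops y ->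
  bounded_ops (x \o y).
Proof.
move=> [xl xc] [yl yc]; split=> [a u v /=|u]; first by rewrite yl xl.
by apply: continuous_comp; [exact: yc|exact: xc].
Qed.

Definition bone : bop := mkbop bounded_ops_id.
Definition bmul (x y : bop) : bop := mkbop (bounded_ops_comp (bvalB x) (bvalB y)).

Lemma bmulA : associative bmul. Proof. by move=> x y z; apply: bopP. Qed.
Lemma bmul1 : left_id bone bmul. Proof. by move=> x; apply: bopP. Qed.
Lemma bmulr1 : right_id bone bmul. Proof. by move=> x; apply: bopP. Qed.
Lemma bmulDl : left_distributive bmul +%R. Proof. by move=> x y z; apply: bopP. Qed.
Lemma bmulDr : right_distributive bmul +%R.
Proof. by move=> x y z; apply: bopP => u; apply: appD. Qed.

HB.instance Definition _ := GRing.Zmodule_isPzRing.Build bop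
  bmulA bmul1 bmulr1 bmulDl bmulDr.

Lemma bopM (x y : bop) u : (x * y) u = x (y u). Proof. by []. Qed.
Lemma bop1 u : (1 : bop) u = u. Proof. by []. Qed.
Lemma bval1 : bval 1 = idfun. Proof. by []. Qed.
Lemma bvalM (x y : bop) : bval (x * y) = x \o y. Proof. by []. Qed.
Lemma bscaleAl a (x y : bop) : a *: (x * y) = (a *: x) * y.
Proof. exact: bopP. Qed.
Lemma bscaleAr a (x y : bop) : a *: (x * y) = x * (a *: y).
Proof. by apply: bopP => u; rewrite bopZ !bopM bopZ appZ. Qed.

(** Riesz representation of the functional sending [u] to [rip (x u) v]. Only real linearity is put
    in; complex linearity of the adjoint follows from the complex identity [inn]. *)
Lemma adjoint_ex (x : bop) : exists y : bop, forall u v, rip (x u) v = rip u (y v).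
Proof.
have [c c0 cb] := bop_bound x.
have ex v : exists w, forall u, rip (x u) v = rip u w.
  apply: (@riesz _ _ (fun u => rip (x u) v) (c * nrm v)) => [u w|r u|u].
  - by rewrite appD ripDl.
  - by rewrite appZ ripZl.
  - apply: le_trans (cauchy_schwarz _ _) _; rewrite mulrAC ler_wpM2r ?nrm_ge0 //.
have [y yh] := choice ex.
have ext (w w' : H) : (forall u, rip u w = rip u w') -> w = w'.
  move=> h; apply/eqP; rewrite -subr_eq0; apply/eqP/nrm_eq0/eqP.
  by rewrite -sqrf_eq0 -ripE ripBr h subrr.
have inn u v : inner H (x u) v = inner H u (y v).
  by apply: rip_inner; rewrite -?appZ yh.
have yl : linear y.
  move=> a v w; apply: ext => u; rewrite -yh !ripDr -yh; congr (_ + _).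
  by rewrite /rip !innerZr inn.
have yb u : nrm (y u) <= c * nrm u.
  have [y0|y0] := eqVneq (nrm (y u)) 0; first by rewrite y0 mulr_ge0 ?nrm_ge0.
  rewrite -(ler_pM2l (_ : 0 < nrm (y u))); last by rewrite lt_neqAle eq_sym y0 nrm_ge0.
  rewrite -expr2 -ripE -yh; apply: le_trans (le_cs _ _) _.
  by rewrite mulrA ler_wpM2r ?nrm_ge0 // mulrC.
by exists (mkbop (bound_bounded_ops yl yb)) => u v; rewrite yh.
Qed.

Definition star (x : bop) : bop := projT1 (cid (adjoint_ex x)).
End bop.

Notation "x ^'*" := (star x) (at level 1, format "x ^'*") : ring_scope.

(** * Adjoints and positivity *)

Section star.
Context {R : realType} {H : hilbertType R}.
Local Notation C := R[i].
Implicit Types (x y z p q a b : bop H) (u v w : H) (r : R).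

Lemma starP x u v : rip (x u) v = rip u (x^'* v).
Proof. exact: (projT2 (cid (adjoint_ex x))). Qed.
Lemma starP' x u v : rip (x^'* u) v = rip u (x v).
Proof. by rewrite ripC -starP ripC. Qed.

Lemma rip_ext (u v : H) : (forall w, rip w u = rip w v) -> u = v.
Proof.
move=> h; apply/eqP; rewrite -subr_eq0; apply/eqP/nrm_eq0/eqP.
by rewrite -sqrf_eq0 -ripE ripBr h subrr.
Qed.

Lemma star_unique x y : (forall u v, rip (x u) v = rip u (y v)) -> y = x^'*.
Proof. by move=> h; apply: bopP => v; apply: rip_ext => u; rewrite -h starP. Qed.

Lemma starK x : x^'*^'* = x.
Proof. by symmetry; apply: star_unique => u v; rewrite starP'. Qed.
Lemma star_inj : injective (@star R H). Proof. exact: can_inj starK. Qed.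
Lemma starD x y : (x + y)^'* = x^'* + y^'*.
Proof. by symmetry; apply: star_unique => u v; rewrite !bopD ripDl ripDr !starP. Qed.
Lemma starN x : (- x)^'* = - x^'*.
Proof. by symmetry; apply: star_unique => u v; rewrite !bopN ripNl ripNr !starP. Qed.
Lemma starB x y : (x - y)^'* = x^'* - y^'*.
Proof. by rewrite starD starN. Qed.
Lemma starM x y : (x * y)^'* = y^'* * x^'*.
Proof. by symmetry; apply: star_unique => u v; rewrite !bopM !starP. Qed.
Lemma star1 : 1^'* = 1 :> bop H.
Proof. by symmetry; apply: star_unique. Qed.
Lemma star0 : 0^'* = 0 :> bop H.
Proof. by symmetry; apply: star_unique => u v; rewrite !bop0 rip0l rip0r. Qed.
Lemma inner_star x u v : inner H (x u) v = inner H u (x^'* v).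
Proof. by apply: rip_inner; rewrite -?appZ starP. Qed.
Lemma starZ c x : (c *: x)^'* = (Num.conj c) *: x^'*.
Proof.
symmetry; apply: star_unique => u v.
by rewrite !bopZ /rip innerZl innerZr -inner_star conjCK.
Qed.
Lemma conj_real r : Num.conj (r%:C) = r%:C :> C.
Proof. exact: conjc_real. Qed.
Lemma starZr r x : (r%:C *: x)^'* = r%:C *: x^'*.
Proof. by rewrite starZ conj_real. Qed.
Lemma starX x n : (x ^+ n)^'* = x^'* ^+ n.
Proof. by elim: n => [|n IH]; rewrite ?star1 // exprS starM IH exprSr. Qed.
Lemma star_sum (I : Type) (s : seq I) (P : pred I) (F : I -> bop H) :
  (\sum_(i <- s | P i) F i)^'* = \sum_(i <- s | P i) (F i)^'*.
Proof. by elim/big_rec2: _ => [|i x y _ <-]; rewrite ?star0 ?starD. Qed.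

Lemma adj_star x : adj x = x^'* :> op H.
Proof.
rewrite /adj; case: xgetP => [y _ [yb yh]|/(_ (x^'*)) []]; last first.
  by split; [exact: bvalB|move=> u v; exact: inner_star].
rewrite -[y]/(bval (mkbop yb)); congr bval; apply: star_unique => u v.
by rewrite /rip yh.
Qed.

Lemma nrm_star x u : nrm (x u) ^+ 2 = rip ((x^'* * x) u) u.
Proof. by rewrite bopM starP' ripE. Qed.

Lemma star_mul0 x : x^'* * x = 0 -> x = 0.
Proof.
move=> h; apply: bopP => u; apply: nrm_eq0; apply/eqP.
by rewrite -sqrf_eq0 nrm_star h rip0l.
Qed.

Definition sa x := x^'* = x.
Definition pos x := sa x /\ forall u, 0 <= rip (x u) u.

Lemma saD x y : sa x -> sa y -> sa (x + y). Proof. by rewrite /sa starD => -> ->. Qed.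
Lemma saN x : sa x -> sa (- x). Proof. by rewrite /sa starN => ->. Qed.
Lemma saB x y : sa x -> sa y -> sa (x - y). Proof. by rewrite /sa starB => -> ->. Qed.
Lemma saZ r x : sa x -> sa (r%:C *: x). Proof. by rewrite /sa starZr => ->. Qed.
Lemma sa1 : sa 1. Proof. exact: star1. Qed.
Lemma sa0 : sa 0. Proof. exact: star0. Qed.
Lemma saX x n : sa x -> sa (x ^+ n). Proof. by rewrite /sa starX => ->. Qed.
Lemma sa_conj x y : sa x -> sa (y^'* * x * y).
Proof. by rewrite /sa !starM starK => ->; rewrite mulrA. Qed.
Lemma sa_mulstar x : sa (x^'* * x). Proof. by rewrite /sa starM starK. Qed.

Lemma pos_sa x : pos x -> x^'* = x. Proof. by case. Qed.
Lemma posD x y : pos x -> pos y -> pos (x + y).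
Proof. by move=> [sx px] [sy py]; split=> [|u]; [exact: saD|rewrite bopD ripDl addr_ge0]. Qed.
Lemma posZ r x : 0 <= r -> pos x -> pos (r%:C *: x).
Proof. by move=> r0 [sx px]; split=> [|u]; [exact: saZ|rewrite bopZ ripZl mulr_ge0]. Qed.
Lemma pos0 : pos 0. Proof. by split=> [|u]; [exact: sa0|rewrite bop0 rip0l]. Qed.
Lemma pos1 : pos 1. Proof. by split=> [|u]; [exact: sa1|rewrite rip_ge0]. Qed.
Lemma pos_conj x y : pos x -> pos (y^'* * x * y).
Proof.
move=> [sx px]; split=> [|u]; first exact: sa_conj.
by rewrite !bopM starP' px.
Qed.
Lemma pos_conjr x y : pos x -> pos (y * x * y^'*).
Proof. by move=> /(pos_conj (y^'*)); rewrite starK. Qed.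
Lemma pos_conj_sa x y : sa y -> pos x -> pos (y * x * y).
Proof. by move=> sy /(pos_conj y); rewrite sy. Qed.
Lemma pos_mulstar x : pos (x^'* * x).
Proof. by have := pos_conj x pos1; rewrite mulr1. Qed.
Lemma pos_sqr x : sa x -> pos (x * x).
Proof. by move=> sx; rewrite -{1}sx; apply: pos_mulstar. Qed.
(** Induction in steps of two: [x ^+ n.+2 = x * x ^+ n * x] is a conjugate of [x ^+ n]. *)
Lemma posX x n : pos x -> pos (x ^+ n).
Proof.
move=> px; elim/ltn_ind: n => -[|[|n]] IH; first exact: pos1.
  by rewrite expr1.
rewrite exprS exprSr mulrA; apply: pos_conj_sa (pos_sa px) _.
exact: IH.
Qed.

Lemma sa_rip0 x : sa x -> (forall u, rip (x u) u = 0) -> x = 0.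
Proof.
move=> sx h; apply: bopP => u; apply: rip_ext => w; rewrite bop0 rip0r.
have := h (u + w); rewrite appD ripDl !ripDr !h add0r addr0 (starP x w).
by rewrite sx (ripC w) -mulr2n => /eqP; rewrite mulrn_eq0 /= ripC => /eqP.
Qed.

Lemma pos_anti x : pos x -> pos (- x) -> x = 0.
Proof.
move=> [sx px] [_ nx]; apply: sa_rip0 sx _ => u; apply/eqP.
by rewrite eq_le px andbT -oppr_ge0 -ripNl nx.
Qed.

(* [x - x^2 = x (1 - x) x + (1 - x) x (1 - x)]. *)
Lemma pos_sqr_le x : pos x -> pos (1 - x) -> pos (x - x * x).
Proof.
move=> px p1; have -> : x - x * x = x * (1 - x) * x + (1 - x) * x * (1 - x) by ncring.
by apply: posD; apply: pos_conj_sa => //; [exact: pos_sa|exact: pos_sa].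
Qed.

Lemma contr_nrm x u : pos x -> pos (1 - x) -> nrm (x u) ^+ 2 <= rip (x u) u.
Proof.
move=> px p1; have := (pos_sqr_le px p1).2 u.
by rewrite bopB ripBl subr_ge0 bopM starP (pos_sa px) ripE.
Qed.

Lemma contr_le1 x u : pos x -> pos (1 - x) -> nrm (x u) <= nrm u.
Proof.
move=> px p1; have [->|x0] := eqVneq (nrm (x u)) 0; first exact: nrm_ge0.
have xp : 0 < nrm (x u) by rewrite lt_neqAle eq_sym x0 nrm_ge0.
rewrite -(ler_pM2l xp) -expr2; exact: le_trans (contr_nrm u px p1) (le_cs _ _).
Qed.

Lemma pos_bound x : sa x -> exists2 c : R, 0 < c & pos (c%:C *: (1 : bop H) - x).
Proof.
move=> sx; have [c c0 cb] := bop_bound x; exists (c + 1); first by lra.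
split=> [|u]; first by apply: saB => //; apply/saZ/sa1.
rewrite bopB ripBl bopZ bop1 ripZl ripE subr_ge0.
apply: le_trans (le_cs _ _) _.
have := cb u; have := nrm_ge0 u; nra.
Qed.

Lemma scaleC_eq0 r x : r != 0 -> r%:C *: x = 0 -> x = 0.
Proof.
move=> r0 h.
by rewrite -[x]scale1r -[1]/(1%:C) -(mulVf r0) rmorphM /= -scalerA h scaler0.
Qed.

End star.

(** * Strong limits, square roots, polar decomposition, spectral projections *)

Section sconv.
Context {R : realType} {H : hilbertType R}.
Local Notation C := R[i].
Implicit Types (x y z p q a b c d e f g s v h : bop H) (u w : H) (r k : R) (A : set (bop H)).

Definition sconv (x_ : nat -> bop H) x := forall u, ucvg (fun n => x_ n u) (x u).

Lemma ucvg_ripR (u_ : nat -> H) u w : ucvg u_ u -> rip (u_ n) w @[n --> \oo] --> rip u w.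
Proof.
move=> h; apply/cvgrPdist_lt => e e0.
have e1 : 0 < e / (nrm w + 1) by rewrite divr_gt0 // ltr_wpDl ?nrm_ge0.
have [N Nh] := h _ e1; exists N => // n /= Nn.
rewrite -ripBl; apply: le_lt_trans (cauchy_schwarz _ _) _.
have := Nh _ Nn; rewrite nrmBC ltr_pdivlMr ?ltr_wpDl ?nrm_ge0 // => ?.
have := nrm_ge0 w; have := nrm_ge0 (u - u_ n); nra.
Qed.

Lemma ucvg_rip2 (u_ : nat -> H) u : ucvg u_ u -> nrm (u_ n) @[n --> \oo] --> nrm u.
Proof.
move=> h; apply/cvgrPdist_lt => e e0; have [N Nh] := h _ e0; exists N => // n /= Nn.
have := Nh _ Nn; have := nrm_tri 0 u (u_ n); have := nrmD (u - u_ n) (u_ n).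
have := nrmD (u_ n - u) u; rewrite !subrK (nrmBC u) ltr_norml => h1 h2 h3 h4.
by apply/andP; split; lra.
Qed.

Lemma real_lim_eq (f g : nat -> R) k l : f n @[n --> \oo] --> k -> g n @[n --> \oo] --> l ->
  (forall n, f n = g n) -> k = l.
Proof.
move=> hf hg e; have fg : f = g by apply/funext.
by rewrite -(cvg_lim (@Rhausdorff R) hf) -(cvg_lim (@Rhausdorff R) hg) fg.
Qed.

Lemma sconv_unique (x_ : nat -> bop H) x y : sconv x_ x -> sconv x_ y -> x = y.
Proof. by move=> hx hy; apply: bopP => u; apply: ucvg_unique (hx u) (hy u). Qed.
Lemma sconv_cst x : sconv (fun=> x) x.
Proof. by move=> u; apply: ucvg_cst. Qed.
Lemma sconvD (x_ y_ : nat -> bop H) x y :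
  sconv x_ x -> sconv y_ y -> sconv (fun n => x_ n + y_ n) (x + y).
Proof. by move=> hx hy u; exact: (ucvgD (hx u) (hy u)). Qed.
Lemma sconvB (x_ y_ : nat -> bop H) x y :
  sconv x_ x -> sconv y_ y -> sconv (fun n => x_ n - y_ n) (x - y).
Proof. by move=> hx hy u; exact: (ucvgB (hx u) (hy u)). Qed.
Lemma sconvZ (x_ : nat -> bop H) x (c : C) :
  sconv x_ x -> sconv (fun n => c *: x_ n) (c *: x).
Proof. by move=> hx u; exact: (ucvgZ c (hx u)). Qed.
Lemma sconvMr (x_ : nat -> bop H) x y : sconv x_ x -> sconv (fun n => x_ n * y) (x * y).
Proof. by move=> hx u; exact: (hx (y u)). Qed.
Lemma ucvg_app x (u_ : nat -> H) u : ucvg u_ u -> ucvg (fun n => x (u_ n)) (x u).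
Proof.
move=> h e e0; have [k k0 kb] := bop_bound x.
have [N Nh] := h (e / (k + 1)) ltac:(by rewrite divr_gt0 // ltr_wpDl).
exists N => n Nn; rewrite -appB; apply: le_lt_trans (kb _) _.
by have := Nh _ Nn; rewrite ltr_pdivlMr ?ltr_wpDl // => ?; have := nrm_ge0 (u_ n - u); lra.
Qed.
Lemma sconvMl (x_ : nat -> bop H) x y : sconv x_ x -> sconv (fun n => y * x_ n) (y * x).
Proof. by move=> hx u; exact: (ucvg_app y (hx u)). Qed.
(** Strong continuity of the product in both factors at once relies on a uniform bound for the left
    ones. *)
Lemma sconvM (x_ y_ : nat -> bop H) x y k : (forall n u, nrm (x_ n u) <= k * nrm u) ->
  sconv x_ x -> sconv y_ y -> sconv (fun n => x_ n * y_ n) (x * y).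
Proof.
move=> kb hx hy u e e0.
have k1 : 0 < `|k| + 1 by rewrite ltr_wpDl.
have [N Nh] := hy u (e / 2 / (`|k| + 1)) ltac:(by rewrite !divr_gt0).
have [N' Nh'] := hx (y u) (e / 2) ltac:(by rewrite divr_gt0).
exists (maxn N N') => n; rewrite geq_max => /andP[/Nh + /Nh'].
rewrite ltr_pdivlMr // !bopM => h1 h2.
apply: le_lt_trans (nrm_tri (x_ n (y u)) _ _) _.
rewrite -appB; have := kb n (y_ n u - y u); have := ler_norm k.
have := nrm_ge0 (y_ n u - y u); nra.
Qed.
Lemma sconv_shift (x_ : nat -> bop H) x j : sconv x_ x -> sconv (fun n => x_ (n + j)%N) x.
Proof. by move=> h u; apply: ucvg_shift (h u). Qed.
Lemma sconv_ext (x_ y_ : nat -> bop H) x : (forall n, x_ n = y_ n) -> sconv x_ x -> sconv y_ x.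
Proof. by move=> h; have -> : y_ = x_ by apply/funext => n. Qed.

Lemma sconv_sa (x_ : nat -> bop H) x : (forall n, sa (x_ n)) -> sconv x_ x -> sa x.
Proof.
move=> sx hx; symmetry; apply: star_unique => u w; rewrite [RHS]ripC.
apply: (real_lim_eq (ucvg_ripR (w := w) (hx u)) (ucvg_ripR (w := u) (hx w))) => n.
by rewrite starP sx ripC.
Qed.

Lemma sconv_pos (x_ : nat -> bop H) x : (forall n, pos (x_ n)) -> sconv x_ x -> pos x.
Proof.
move=> px hx; split; first by apply: sconv_sa hx => n; case: (px n).
by move=> u; apply: (ucvg_rip (hx u)); exists 0%N => n _; apply: (px n).2.
Qed.

Lemma slim_ex (x_ : nat -> bop H) k : (forall n u, nrm (x_ n u) <= k * nrm u) ->
  (forall u, ucauchy (fun n => x_ n u)) ->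
  exists2 x, sconv x_ x & forall u, nrm (x u) <= k * nrm u.
Proof.
move=> kb cx.
have /choice[x xh] : forall u, exists l, ucvg (fun n => x_ n u) l.
  by move=> u; apply: ucauchy_cvg.
have xl : linear x.
  move=> a u w; apply: ucvg_unique (xh _) _.
  have -> : (fun n => x_ n (a *: u + w)) = (fun n => a *: x_ n u + x_ n w).
    by apply/funext => n; rewrite appD appZ.
  by apply: ucvgD => //; apply: ucvgZ.
have xb u : nrm (x u) <= k * nrm u.
  by apply: (ucvg_nrm_le (xh u)); exists 0%N => n _; apply: kb.
by exists (mkbop (bound_bounded_ops xl xb)).
Qed.

(* Vigier's theorem; the Cauchy estimate is [d^2 <= d] for [0 <= d <= 1]. *)
Lemma vigier (x_ : nat -> bop H) : (forall n, pos (x_ n)) ->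
  (forall n, pos (1 - x_ n)) -> (forall n, pos (x_ n.+1 - x_ n)) ->
  exists x, [/\ sconv x_ x, pos x, pos (1 - x) & forall n, pos (x - x_ n)].
Proof.
move=> p0 p1 pS.
have pm m n : (m <= n)%N -> pos (x_ n - x_ m).
  move=> /subnK <-; elim: (n - m)%N => [|j IH]; first by rewrite subrr; apply: pos0.
  by rewrite addSn -(subrKA (x_ (j + m)%N)); apply: posD.
have [x hx _] : exists2 x, sconv x_ x & forall u, nrm (x u) <= 1 * nrm u.
  apply: slim_ex => [n u|u e e0]; first by rewrite mul1r; apply: contr_le1.
  pose E := [set rip (x_ n u) u | n in [set: nat]].
  have hE : has_sup E.
    split; first by exists (rip (x_ 0%N u) u), 0%N.
    exists (rip u u) => _ [n _ <-]; have := (p1 n).2 u.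
    by rewrite bopB bop1 ripBl subr_ge0.
  have [_ [N _ <-] Nh] := sup_adherent (ltac:(by rewrite exprn_gt0) : 0 < e ^+ 2) hE.
  exists N => m n Nm mn; rewrite -(@ltr_pXn2r _ 2) ?nnegrE ?nrm_ge0 // ?ltW //.
  have pd : pos (1 - (x_ n - x_ m)).
    have -> : 1 - (x_ n - x_ m) = (1 - x_ n) + x_ m by ncring.
    exact: posD.
  rewrite -bopB; apply: le_lt_trans (contr_nrm u (pm _ _ mn) pd) _.
  have h1 : rip (x_ n u) u <= sup E by apply: sup_upper_bound => //; exists n.
  have := (pm _ _ Nm).2 u; rewrite bopB !ripBl; lra.
exists x; split => //; first exact: sconv_pos hx.
  by apply: sconv_pos (sconvB (sconv_cst 1) hx).
move=> n; apply: sconv_pos (sconvB (sconv_shift n hx) (sconv_cst (x_ n))) => j.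
by apply: pm; rewrite leq_addl.
Qed.

(* Sequential strong closure suffices: every limit taken below is one of a sequence. *)
Record vna A : Prop := Vna {
  vna1 : A 1;
  vna_lin : forall (c : C) x y, A x -> A y -> A (c *: x + y);
  vnaM : forall x y, A x -> A y -> A (x * y);
  vna_star : forall x, A x -> A (x^'*);
  vna_lim : forall (x_ : nat -> bop H) x, (forall n, A (x_ n)) -> sconv x_ x -> A x
}.

Section vna_theory.
Variables (A : set (bop H)) (hA : vna A).
Lemma vnaD x y : A x -> A y -> A (x + y).
Proof. by move=> Ax Ay; have := vna_lin hA 1 Ax Ay; rewrite scale1r. Qed.
Lemma vna0 : A 0.
Proof.
by have := vna_lin hA (-1) (vna1 hA) (vna1 hA); rewrite scaleN1r addNr.
Qed.
Lemma vnaZ (c : C) x : A x -> A (c *: x).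
Proof. by move=> Ax; have := vna_lin hA c Ax vna0; rewrite addr0. Qed.
Lemma vnaN x : A x -> A (- x).
Proof. by move=> /(vnaZ (-1)); rewrite scaleN1r. Qed.
Lemma vnaB x y : A x -> A y -> A (x - y).
Proof. by move=> Ax Ay; apply: vnaD => //; apply: vnaN. Qed.
Lemma vnaX x n : A x -> A (x ^+ n).
Proof. by move=> Ax; elim: n => [|n IH]; [exact: vna1|rewrite exprS; exact: vnaM]. Qed.
Lemma vna_sum (I : Type) (l : seq I) (P : pred I) (F : I -> bop H) :
  (forall i, P i -> A (F i)) -> A (\sum_(i <- l | P i) F i).
Proof. by move=> h; elim/big_rec: _ => [|i x Pi Ax]; [exact: vna0|exact/vnaD/Ax/h]. Qed.
End vna_theory.

(** This is how square roots inherit commutation: a root lies in every [vna] containing the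
    operator, and commutants are among these. *)
Lemma vna_comm b : sa b -> vna [set z | z * b = b * z].
Proof.
move=> sb; split => /=.
- by rewrite mul1r mulr1.
- by move=> c x y hx hy; rewrite mulrDl mulrDr -bscaleAl -bscaleAr hx hy.
- by move=> x y hx hy; rewrite -mulrA hy mulrA hx mulrA.
- by move=> x hx; apply: star_inj; rewrite !starM starK sb hx.
- move=> x_ x hx cx; apply: sconv_unique (sconvMr b cx) _.
  by apply: sconv_ext (sconvMl b cx) => n; rewrite hx.
Qed.

Definition isproj p := sa p /\ p * p = p.

Lemma isprojC p : isproj p -> isproj (1 - p).
Proof.
move=> [sp pp]; split; first by apply: saB => //; exact: sa1.
have -> : (1 - p) * (1 - p) = 1 - p - p + p * p by ncring.
by rewrite pp; ncring.
Qed.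
Lemma isproj0 : isproj 0. Proof. by split; [exact: sa0|rewrite mul0r]. Qed.
Lemma isproj1 : isproj 1. Proof. by split; [exact: sa1|rewrite mul1r]. Qed.
Lemma proj_pos p : isproj p -> pos p.
Proof. by move=> [sp pp]; rewrite -pp; apply: pos_sqr. Qed.
Lemma proj_le1 p : isproj p -> pos (1 - p).
Proof. by move/isprojC/proj_pos. Qed.

Lemma pos_powmul a n : pos a -> pos (1 - a) -> pos ((1 - a) ^+ n * a).
Proof.
move=> pa p1; elim/ltn_ind: n => -[|[|n]] IH; first by rewrite expr0 mul1r.
  rewrite expr1; have -> : (1 - a) * a = a - a * a by ncring.
  exact: pos_sqr_le.
have -> : (1 - a) ^+ n.+2 * a = (1 - a) * ((1 - a) ^+ n * a) * (1 - a).
  have e : (1 - a) * a = a * (1 - a) by ncring.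
  by rewrite exprS exprSr -!mulrA; do 2!congr (_ * _); rewrite e.
by apply: pos_conj_sa; [exact: pos_sa|exact: IH].
Qed.

(** The support projection is the limit of [1 - (1 - a) ^+ n], which increases because consecutive
    terms differ by the positive operator [(1 - a) ^+ n * a]. If [a * b = 0], every power of [1 - a]
    fixes [b], so the limit kills [b]. *)
Lemma supp_contr a : pos a -> pos (1 - a) -> exists s,
  [/\ isproj s, sconv (fun n => 1 - (1 - a) ^+ n) s, s * a = a, a * s = a
    & (forall b, a * b = 0 -> s * b = 0) /\ (forall b, b * a = 0 -> b * s = 0)].
Proof.
move=> pa p1; pose x_ n := 1 - (1 - a) ^+ n.
have [n|n|n|s [hs ps ps1 sm]] := @vigier x_.
- rewrite /x_; elim: n => [|n IH]; first by rewrite expr0 subrr; apply: pos0.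
  have -> : 1 - (1 - a) ^+ n.+1 = 1 - (1 - a) ^+ n + (1 - a) ^+ n * a.
    by rewrite exprSr; ncring.
  by apply: posD => //; apply: pos_powmul.
- by rewrite /x_ opprB addrCA subrr addr0; apply: posX.
- rewrite /x_; have -> : 1 - (1 - a) ^+ n.+1 - (1 - (1 - a) ^+ n) = (1 - a) ^+ n * a.
    by rewrite exprSr; ncring.
  exact: pos_powmul.
have he : sconv (fun n => (1 - a) ^+ n) (1 - s).
  apply: sconv_ext (sconvB (sconv_cst 1) hs) => n.
  by rewrite /x_ opprB addrCA subrr addr0.
have e1 : (1 - a) * (1 - s) = 1 - s.
  have := sconv_shift 1 he; apply: sconv_unique.
  by apply: sconv_ext (sconvMl (1 - a) he) => n; rewrite addn1 exprS.
have ae : a * (1 - s) = 0.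
  have -> : a * (1 - s) = 1 - s - (1 - a) * (1 - s) by ncring.
  by rewrite e1 subrr.
have as_ : a * s = a by have := ae; rewrite mulrBr mulr1 => /eqP; rewrite subr_eq0 => /eqP.
have sa_ : s * a = a.
  by apply: star_inj; rewrite starM (pos_sa pa) (pos_sa ps).
have ab b : a * b = 0 -> s * b = 0.
  move=> h; have e n : (1 - a) ^+ n * b = b.
    elim: n => [|n IH]; first by rewrite expr0 mul1r.
    by rewrite exprSr -mulrA mulrBl mul1r h subr0.
  have := sconvMr b he; move/(sconv_ext e)/sconv_unique => /(_ _ (sconv_cst b)).
  by rewrite mulrBl mul1r => /eqP; rewrite subr_eq addrC -subr_eq subrr eq_sym => /eqP.
exists s; split=> //.
- split; first exact: (pos_sa ps).
  have := ab _ ae; rewrite mulrBr mulr1 => /eqP; rewrite subr_eq0 => /eqP <- //.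
- split=> // b h; apply: star_inj; rewrite starM (pos_sa ps) star0; apply: ab.
  by rewrite -[a](pos_sa pa) -starM h star0.
Qed.

Lemma pos_scale b : sa b -> exists2 k, 0 < k & pos (1 - k%:C *: b).
Proof.
move=> sb; have [c c0 pc] := pos_bound sb; exists c^-1; first by rewrite invr_gt0.
have -> : 1 - c^-1%:C *: b = c^-1%:C *: (c%:C *: (1 : bop H) - b).
  by rewrite scalerBr scalerA -rmorphM /= mulVf ?gt_eqF // scale1r.
by apply: posZ => //; rewrite invr_ge0 ltW.
Qed.

Lemma scale_inj k x y : k != 0 -> k%:C *: x = k%:C *: y -> x = y.
Proof.
move=> k0 /eqP; rewrite -subr_eq0 -scalerBr => /eqP/(scaleC_eq0 k0)/eqP.
by rewrite subr_eq0 => /eqP.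
Qed.

Lemma supp_ex A a : vna A -> A a -> pos a -> exists s,
  [/\ isproj s, A s, s * a = a, a * s = a
    & (forall b, a * b = 0 -> s * b = 0) /\ (forall b, b * a = 0 -> b * s = 0)].
Proof.
move=> hA Aa pa; have [k k0 pk] := pos_scale (pos_sa pa).
have kn : k != 0 by rewrite gt_eqF.
have [s [ps hs s1 s2 [s3 s4]]] := supp_contr (posZ (ltW k0) pa) pk.
exists s; split=> //.
- apply: (vna_lim hA _ hs) => n; apply: (vnaB hA) => //; first exact: (vna1 hA).
  by apply/(vnaX hA)/(vnaB hA) => //; [exact: (vna1 hA)|exact: (vnaZ hA)].
- by apply: (scale_inj kn); rewrite bscaleAr.
- by apply: (scale_inj kn); rewrite bscaleAl.
- by split=> b h; [apply: s3; rewrite -bscaleAl h scaler0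
                  |apply: s4; rewrite -bscaleAr h scaler0].
Qed.

(** Polynomials in [a] with nonnegative coefficients. They are positive when [a] is, and closed
    under products, so that monotonicity of the square root iteration becomes a matter of signs of
    coefficients. *)
Inductive ppoly a : bop H -> Prop :=
| ppoly0 : ppoly a 0
| ppolyD (r : R) n z : 0 <= r -> ppoly a z -> ppoly a (r%:C *: a ^+ n + z).

Lemma ppoly_pos a z : pos a -> ppoly a z -> pos z.
Proof.
move=> pa; elim => [|r n z' r0 _ IH]; first exact: pos0.
by apply: posD => //; apply: posZ => //; apply: posX.
Qed.
Lemma ppoly_add a y z : ppoly a y -> ppoly a z -> ppoly a (y + z).
Proof.
move=> hy hz; elim: hy => [|r n z' r0 _ IH]; first by rewrite add0r.
by rewrite -addrA; apply: ppolyD.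
Qed.
Lemma ppoly_mulX a r n z : 0 <= r -> ppoly a z -> ppoly a (r%:C *: a ^+ n * z).
Proof.
move=> r0; elim => [|k m z' k0 _ IH]; first by rewrite mulr0; exact: ppoly0.
rewrite mulrDr -bscaleAr -bscaleAl -exprD scalerA -rmorphM /=.
by apply: ppolyD => //; rewrite mulr_ge0.
Qed.
Lemma ppoly_mul a y z : ppoly a y -> ppoly a z -> ppoly a (y * z).
Proof.
move=> hy hz; elim: hy => [|r n z' r0 _ IH]; first by rewrite mul0r; exact: ppoly0.
by rewrite mulrDl; apply: ppoly_add => //; apply: ppoly_mulX.
Qed.
Lemma ppoly_scale a r z : 0 <= r -> ppoly a z -> ppoly a (r%:C *: z).
Proof.
by move=> r0 /(ppoly_mulX 0 r0); rewrite expr0 -bscaleAl mul1r.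
Qed.
Lemma ppoly_comm a y b : a * b = b * a -> ppoly a y -> y * b = b * y.
Proof.
move=> ab; elim => [|r n z' _ _ IH]; first by rewrite mul0r mulr0.
rewrite mulrDl mulrDr IH -bscaleAl -bscaleAr; congr (_ *: _ + _).
elim: n => [|n IHn]; first by rewrite expr0 mul1r mulr1.
by rewrite exprS -mulrA IHn !mulrA ab.
Qed.
Lemma ppoly_comm2 a y z : ppoly a y -> ppoly a z -> y * z = z * y.
Proof. by move=> hy hz; apply: ppoly_comm hy; symmetry; apply: ppoly_comm hz. Qed.

Lemma half2 x : 2^-1%:C *: x + 2^-1%:C *: x = x.
Proof.
by rewrite -scalerDl -rmorphD /= (_ : 2^-1 + 2^-1 = 1 :> R) ?scale1r //; field.
Qed.

(* The iteration [y <- (a + y^2) / 2] increases to [1 - sqrt (1 - a)]. *)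
Lemma sqrt_contr a : pos a -> pos (1 - a) -> exists c,
  [/\ pos c, pos (1 - c), c * c = 1 - a & forall A, vna A -> A a -> A c].
Proof.
move=> pa p1; pose y_ := fix y n := if n is n'.+1
  then 2^-1%:C *: (a + y n' * y n') else 0.
have h0 : 0 <= 2^-1 :> R by rewrite invr_ge0.
have yp n : ppoly a (y_ n).
  elim: n => [|n IH]; first exact: ppoly0.
  apply: ppoly_scale => //; apply: ppoly_add; last exact: ppoly_mul.
  by have := @ppolyD a 1 1 0 ler01 (ppoly0 a); rewrite addr0 expr1 scale1r.
have yS n : ppoly a (y_ n.+1 - y_ n).
  elim: n => [|n IH]; first by rewrite /= subr0; exact: (yp 1%N).
  (* The increment is half of a difference of two squares, which factors because polynomials in [a]
     commute. *)
  have -> : y_ n.+2 - y_ n.+1 = 2^-1%:C *: ((y_ n.+1 - y_ n) * (y_ n.+1 + y_ n)).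
    have cm := ppoly_comm2 (yp n.+1) (yp n).
    rewrite -[y_ n.+2]/(2^-1%:C *: (a + y_ n.+1 * y_ n.+1)) {2}/y_ -/(y_ n).
    rewrite -scalerBr; congr (_ *: _).
    have -> : (y_ n.+1 - y_ n) * (y_ n.+1 + y_ n) = y_ n.+1 * y_ n.+1 +
      y_ n.+1 * y_ n - y_ n * y_ n.+1 - y_ n * y_ n by ncring.
    by rewrite cm; ncring.
  by apply: ppoly_scale => //; apply: ppoly_mul => //; apply: ppoly_add.
have y1 n : pos (1 - y_ n).
  elim: n => [|n IH]; first by rewrite subr0; exact: pos1.
  have -> : 1 - y_ n.+1 = 2^-1%:C *: ((1 - a) + ((1 - y_ n) + (y_ n - y_ n * y_ n))).
    rewrite -[in LHS](half2 1) [y_ n.+1]/(2^-1%:C *: (a + y_ n * y_ n)).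
    rewrite -scalerDr -scalerBr; congr (_ *: _); ncring.
  apply: posZ => //; apply: posD => //; apply: posD => //.
  by apply: pos_sqr_le => //; apply: ppoly_pos (yp n).
have [n|n|n|y [hy py py1 _]] := @vigier y_.
- exact: ppoly_pos (yp n).
- exact: y1.
- exact: ppoly_pos (yS n).
have ye0 : y = 2^-1%:C *: (a + y * y).
  have := sconv_shift 1 hy; move/sconv_unique; apply.
  apply: (@sconv_ext (fun n => 2^-1%:C *: (a + y_ n * y_ n))).
    by move=> n; rewrite addn1.
  apply: sconvZ; apply: sconvD; first exact: sconv_cst.
  apply: (@sconvM _ _ _ _ 1) => // n u; rewrite mul1r; apply: contr_le1 => //.
  exact: ppoly_pos (yp n).
have ye : y + y = a + y * y by rewrite -[RHS]half2 -ye0.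
exists (1 - y); split=> //.
- by rewrite opprB addrCA subrr addr0.
- have -> : (1 - y) * (1 - y) = 1 - (y + y) + y * y by ncring.
  by rewrite ye; ncring.
- move=> A hA Aa; apply: (vnaB hA) => //; first exact: (vna1 hA).
  apply: (vna_lim hA _ hy); elim=> [|n IH]; first exact: (vna0 hA).
  by apply: (vnaZ hA) => //; apply: (vnaD hA) => //; apply: (vnaM hA).
Qed.

(** The third clause puts the root into every algebra that contains [b], commutants included; it
    serves both for membership and for commutation. *)
Lemma sqrt_ex b : pos b -> exists c,
  [/\ pos c, c * c = b, forall A, vna A -> A b -> A c
    & pos (1 - b) -> pos (1 - c)].
Proof.
suff base b0 : pos b0 -> pos (1 - b0) -> exists c,
   [/\ pos c, pos (1 - c), c * c = b0 & forall A, vna A -> A b0 -> A c].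
  move=> pb; have [pb1|npb] := EM (pos (1 - b)).
    by have [c [? ? ? ?]] := base b pb pb1; exists c.
  have [k k0 pk] := pos_scale (pos_sa pb).
  have [c [pc _ cc cA]] := base _ (posZ (ltW k0) pb) pk.
  exists ((Num.sqrt k)^-1%:C *: c); split=> //.
  - by apply: posZ => //; rewrite invr_ge0 sqrtr_ge0.
  - rewrite -bscaleAl -bscaleAr cc !scalerA -!rmorphM /= -invfM -expr2 sqr_sqrtr ?ltW //.
    by rewrite mulVf ?gt_eqF // scale1r.
  - by move=> A hA Ab; apply: (vnaZ hA) => //; apply: cA => //; apply: (vnaZ hA).
move=> pb pb1; have [||c [pc pc1 cc cA]] := @sqrt_contr (1 - b0).
- by [].
- by rewrite opprB addrCA subrr addr0.
exists c; split=> //; first by rewrite cc opprB addrCA subrr addr0.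
by move=> A hA Ab; apply: cA => //; apply: (vnaB hA) => //; exact: (vna1 hA).
Qed.

Lemma pos_add0 a b : pos a -> pos b -> a + b = 0 -> a = 0.
Proof. by move=> pa pb h; apply: pos_anti => //; rewrite (addr0_eq h). Qed.

Lemma sa_sqr0 e : sa e -> e * e = 0 -> e = 0.
Proof. by move=> se; rewrite -{1}se => /star_mul0. Qed.

(** If c and d commute and z = c - d, then z c z + z d z = z (c^2 - d^2) = 0 with both terms
    positive, so z^3 = 0 and z = 0. In general both are compared with the root [s] of [c * c], which
    commutes with each of them. *)
Lemma sqrt_uniq c d : pos c -> pos d -> c * c = d * d -> c = d.
Proof.
move=> pc pd e; suff base c0 d0 : pos c0 -> pos d0 -> c0 * c0 = d0 * d0 ->
    c0 * d0 = d0 * c0 -> c0 = d0.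
  have [s [ps ss sA _]] := sqrt_ex (pos_sqr (pos_sa pc)).
  rewrite (base c s) // ?ss //; last first.
    have /= := sA _ (vna_comm (pos_sa pc)); rewrite mulrA => -> //.
  rewrite (base d s) // ?ss //; have /= := sA _ (vna_comm (pos_sa pd)).
  by rewrite e mulrA => -> //.
move=> {}pc {}pd {}e cd.
set z := c0 - d0; have sz : sa z by apply: saB; exact: pos_sa.
have h : z * c0 * z + z * d0 * z = 0.
  have -> : z * c0 * z + z * d0 * z = z * (c0 * c0 - d0 * d0 - c0 * d0 + d0 * c0).
    by rewrite /z; ncring.
  by rewrite e cd; ncring.
have z1 : z * c0 * z = 0 by apply: pos_add0 h; apply: pos_conj_sa.
have z2 : z * d0 * z = 0 by move: h; rewrite z1 add0r.
have z3 : z * z * z = 0.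
  by rewrite -[RHS](subrr 0) -{1}z1 -z2 {2}/z; ncring.
have zz : sa (z * z) by rewrite /sa starM sz.
apply/eqP; rewrite -subr_eq0 -/z; apply/eqP/sa_sqr0 => //; apply: sa_sqr0 => //.
by rewrite mulrA z3 mul0r.
Qed.

Lemma pos_comm_mul p q : pos p -> pos q -> p * q = q * p -> pos (p * q).
Proof.
move=> pp pq e; have [c [pc cc cA _]] := sqrt_ex pp.
have cq : c * q = q * c by have /= -> := cA _ (vna_comm (pos_sa pq)).
by rewrite -cc -mulrA cq mulrA; apply: pos_conj_sa => //; exact: pos_sa.
Qed.

(** Partial sums of the Neumann series for the inverse of [h]. When 0 <= h <= 1, the product
    [h * geom h n] tends to the support of [h]. *)
Definition geom h n := \sum_(i < n) (1 - h) ^+ i.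

Lemma geomE h n : h * geom h n = 1 - (1 - h) ^+ n.
Proof.
rewrite /geom; elim: n => [|n IH]; first by rewrite big_ord0 mulr0 subrr.
by rewrite big_ord_recr /= mulrDr IH exprS; ncring.
Qed.
Lemma geomEr h n : geom h n * h = 1 - (1 - h) ^+ n.
Proof.
rewrite /geom; elim: n => [|n IH]; first by rewrite big_ord0 mul0r subrr.
by rewrite big_ord_recr /= mulrDl IH exprSr; ncring.
Qed.
Lemma geom_A h n A : vna A -> A h -> A (geom h n).
Proof.
move=> hA Ah; apply: (vna_sum hA) => // i _; apply: (vnaX hA) => //.
by apply: (vnaB hA) => //; exact: (vna1 hA).
Qed.

Lemma nrm_eq_star x y u : x^'* * x = y^'* * y -> nrm (x u) = nrm (y u).
Proof.
move=> e; apply/eqP; rewrite -(@eqrXn2 _ 2) ?nrm_ge0 //.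
by rewrite !nrm_star e.
Qed.

Lemma star_mul_eq0 x y z : x^'* * x = y^'* * y -> y * z = 0 -> x * z = 0.
Proof.
move=> e h; apply: bopP => u; apply: nrm_eq0.
by rewrite bopM (nrm_eq_star _ e) -bopM h bop0 nrm0.
Qed.

(** The partial isometry is the limit of [x * geom h n], with [h] the square root of [x^'* * x].
    Since [x] and [h] give every vector the same norm, this sequence is Cauchy because
    [1 - (1 - h) ^+ n] converges to the support of [h]. *)
Lemma polar A x : vna A -> A x -> exists v h s,
  [/\ [/\ A v, A h & A s], [/\ pos h, h * h = x^'* * x & v * h = x],
      [/\ isproj s, v^'* * v = s, v * s = v & s * h = h]
    & (forall b, h * b = 0 -> s * b = 0) /\ (forall b, b * h = 0 -> b * s = 0)].
Proof.
move=> hA Ax.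
suff base y : A y -> pos (1 - y^'* * y) -> exists v h s,
  [/\ [/\ A v, A h & A s], [/\ pos h, h * h = y^'* * y & v * h = y],
      [/\ isproj s, v^'* * v = s, v * s = v & s * h = h]
    & (forall b, h * b = 0 -> s * b = 0) /\ (forall b, b * h = 0 -> b * s = 0)].
  have [k k0 pk] := pos_scale (sa_mulstar x).
  set j := Num.sqrt k; have j0 : 0 < j by rewrite sqrtr_gt0.
  have jn : j^-1 * j = 1 by rewrite mulVf ?gt_eqF.
  have [||v [h [s [[Av Ah As] [ph hh vh] [ps vv vs sh] [h1 h2]]]]] := base (j%:C *: x).
  - exact: (vnaZ hA).
  - rewrite starZr -bscaleAl -bscaleAr scalerA -rmorphM /= -expr2 sqr_sqrtr //.
    exact: ltW.
  have ij : j^-1 != 0 by rewrite invr_eq0 gt_eqF.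
  exists v, (j^-1%:C *: h), s; split=> //; split=> //.
  - exact: (vnaZ hA).
  - by apply: posZ => //; rewrite invr_ge0 ltW.
  - rewrite -bscaleAl -bscaleAr hh starZr -bscaleAl -bscaleAr !scalerA -!rmorphM /=.
    rewrite [X in X%:C](_ : _ = 1) ?scale1r //; field; exact: lt0r_neq0.
  - by rewrite -bscaleAr vh scalerA -rmorphM /= jn scale1r.
  - by rewrite -bscaleAr sh.
  - by move=> b; rewrite -bscaleAl => /(scaleC_eq0 ij)/h1.
  - by move=> b; rewrite -bscaleAr => /(scaleC_eq0 ij)/h2.
move=> {x Ax}; move: y => x Ax p1.
have [h [ph hh hB hle]] := sqrt_ex (pos_mulstar x).
have Ah : A h by apply: hB => //; apply: (vnaM hA) => //; apply: (vna_star hA).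
have ph1 := hle p1.
have sh : h^'* = h by exact: pos_sa.
have xh : x^'* * x = h^'* * h by rewrite sh.
have [s [ps hs s1 s2 [s3 s4]]] := supp_contr ph ph1.
have As : A s.
  apply: (vna_lim hA _ hs) => n; apply: (vnaB hA) => //; first exact: (vna1 hA).
  by apply/(vnaX hA)/(vnaB hA) => //; exact: (vna1 hA).
pose s_ n := 1 - (1 - h) ^+ n.
have nv n u : nrm ((x * geom h n) u) = nrm (s_ n u).
  by rewrite bopM (nrm_eq_star _ xh) -bopM geomE.
have nvB n m u : nrm ((x * geom h n) u - (x * geom h m) u) = nrm (s_ n u - s_ m u).
  rewrite -bopB -mulrBr bopM (nrm_eq_star _ xh) -bopM mulrBr !geomE.
  by rewrite -bopB.
have s_le n u : nrm (s_ n u) <= 1 * nrm u.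
  rewrite mul1r; apply: contr_le1.
    rewrite /s_; elim: n => [|n IH]; first by rewrite expr0 subrr; apply: pos0.
    have -> : 1 - (1 - h) ^+ n.+1 = 1 - (1 - h) ^+ n + (1 - h) ^+ n * h.
      by rewrite exprSr; ncring.
    by apply: posD => //; apply: pos_powmul.
  by rewrite /s_ opprB addrCA subrr addr0; apply: posX.
have [v hv _] : exists2 v, sconv (fun n => x * geom h n) v & forall u, nrm (v u) <= 1 * nrm u.
  apply: slim_ex => [n u|u e e0]; first by rewrite nv s_le.
  have [N Nh] := hs u (e / 2) ltac:(by rewrite divr_gt0).
  exists N => m n Nm mn; rewrite nvB; apply: le_lt_trans (nrm_tri (s u) _ _) _.
  have := Nh _ Nm; have := Nh _ (leq_trans Nm mn); rewrite (nrmBC (s u)) -/(s_ m) -/(s_ n).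
  lra.
have Av : A v.
  by apply: (vna_lim hA _ hv) => n; apply: (vnaM hA) => //; apply: geom_A.
have vv : v^'* * v = s.
  apply/eqP; rewrite -subr_eq0; apply/eqP/sa_rip0.
    by apply: saB; [exact: sa_mulstar|case: ps].
  move=> u; rewrite bopB ripBl -nrm_star -{1}ps.2 -{1}ps.1 -nrm_star.
  rewrite (_ : nrm (v u) = nrm (s u)) ?subrr //.
  by apply: (real_lim_eq (ucvg_rip2 (hv u)) (ucvg_rip2 (hs u))) => n; rewrite nv.
have vs : v * s = v.
  have : v * (1 - s) = 0.
    apply: star_mul0; rewrite starM mulrA -[_ * _ * v]mulrA vv -mulrA.
    by rewrite mulrBr ps.2 mulr1 subrr mulr0.
  by rewrite mulrBr mulr1 => /eqP; rewrite subr_eq0 => /eqP.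
exists v, h, s; split=> //; split=> //.
have xs : x * s = x.
  have : x * (1 - s) = 0.
    by apply: (star_mul_eq0 xh); rewrite mulrBr mulr1 s2 subrr.
  by rewrite mulrBr mulr1 => /eqP; rewrite subr_eq0 => /eqP.
rewrite -[RHS]xs; have := sconvMr h hv; move/sconv_unique; apply.
apply: sconv_ext (sconvMl x hs) => n.
by rewrite -mulrA geomEr.
Qed.

(* [|b| + b >= 0]: with [c = |b| + b] one has [c^2 = 2 |b| c], so [|b| c |b| = c |b| c / 2]. *)
Lemma spec_ex A b : vna A -> A b -> sa b -> exists f,
  [/\ isproj f, A f, f * b = b * f, pos (f * b) & pos (- ((1 - f) * b))].
Proof.
move=> hA Ab sb.
suff base b0 : A b0 -> sa b0 -> pos (1 - b0 * b0) -> exists f,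
  [/\ isproj f, A f, f * b0 = b0 * f, pos (f * b0) & pos (- ((1 - f) * b0))].
  have [k k0 pk] := pos_scale (saX 2 sb).
  set j := Num.sqrt k; have j0 : 0 < j by rewrite sqrtr_gt0.
  have jn : j^-1 * j = 1 by rewrite mulVf ?gt_eqF.
  have [|||f [pf Af fb p1 p2]] := base (j%:C *: b).
  - exact: (vnaZ hA).
  - exact: saZ.
  - rewrite -bscaleAl -bscaleAr scalerA -rmorphM /= -!expr2 sqr_sqrtr //.
    exact: ltW.
  have jp : 0 <= j^-1 by rewrite invr_ge0 ltW.
  exists f; split=> //.
  - by apply: (@scale_inj j); rewrite ?gt_eqF // bscaleAr fb bscaleAl.
  - by have := posZ jp p1; rewrite -bscaleAr scalerA -rmorphM /= jn scale1r.
  - by have := posZ jp p2; rewrite -bscaleAr -scalerN scalerA -rmorphM /= jn scale1r.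
move=> {b Ab sb}; move: b0 => b Ab sb p1.
have [h [ph hh hB hle]] := sqrt_ex (pos_sqr sb).
have Ah : A h by apply: hB => //; apply: (vnaM hA).
have ph1 := hle p1; have sh := pos_sa ph.
have hb : h * b = b * h.
  by have /= := hB _ (vna_comm sb); rewrite mulrA => ->.
have [s [ps hs s1 s2 [s3 s4]]] := supp_contr ph ph1.
have bs : b * s = b.
  have : b * (1 - s) = 0.
    apply: (@star_mul_eq0 _ h); first by rewrite sb sh.
    by rewrite mulrBr mulr1 s2 subrr.
  by rewrite mulrBr mulr1 => /eqP; rewrite subr_eq0 => /eqP.
have sb' : s * b = b by apply: star_inj; rewrite starM sb ps.1.
(* Stated for [d] so as to serve both [b] and [- b]. Positivity passes from [h * c * h] to [c]:
   sandwiched between two copies of [geom h n], the former tends to [s * c * s = c]. *)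
have pc d : sa d -> d * d = h * h -> d * h = h * d -> s * d = d -> d * s = d -> pos (h + d).
  move=> sd dd dh sd' ds; set c := h + d.
  have sc : sa c by apply: saD.
  have cc : c * c = h * c + h * c.
    have -> : c * c = h * h + h * d + d * h + d * d by rewrite /c; ncring.
    by rewrite dd dh /c; ncring.
  have ch : c * h = h * c by rewrite /c mulrDl mulrDr dh.
  have hch : pos (h * c * h).
    have -> : h * c * h = 2^-1%:C *: (c * h * c).
      by rewrite -[LHS]half2 -scalerDr; congr (_ *: _); rewrite -mulrDl -cc -!mulrA ch.
    by apply: posZ; [rewrite invr_ge0|apply: pos_conj_sa].
  have scs : s * c * s = c by rewrite /c !(mulrDl, mulrDr) s1 s2 sd' ds.
  rewrite -scs.
  have s_le n : pos (1 - (1 - h) ^+ n) /\ pos (1 - (1 - (1 - h) ^+ n)).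
    split; last by rewrite opprB addrCA subrr addr0; apply: posX.
    elim: n => [|n IH]; first by rewrite expr0 subrr; apply: pos0.
    have -> : 1 - (1 - h) ^+ n.+1 = 1 - (1 - h) ^+ n + (1 - h) ^+ n * h.
      by rewrite exprSr; ncring.
    by apply: posD => //; apply: pos_powmul.
  have hm : sconv (fun n => (1 - (1 - h) ^+ n) * c * (1 - (1 - h) ^+ n)) (s * c * s).
    have [k k0 kb] := bop_bound c.
    apply: (@sconvM _ _ _ _ k) => [n u||//]; last exact: sconvMr.
    rewrite bopM; have [pn pn1] := s_le n.
    exact: le_trans (contr_le1 _ pn pn1) (kb u).
  apply: sconv_pos hm => n.
  rewrite -{1}geomEr -geomE mulrA -[_ * h * c]mulrA -[_ * (h * c) * h]mulrA.
  apply: pos_conj_sa => //; rewrite /sa /geom star_sum; apply: eq_bigr => i _.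
  by apply: saX; apply: saB => //; exact: sa1.
have pp : pos (h + b) by apply: pc.
have pn : pos (h - b).
  apply: pc; rewrite ?mulrNN ?mulrN ?mulNr ?hh ?hb ?sb' ?bs //; exact: saN.
have h0 : 0 <= 2^-1 :> R by rewrite invr_ge0.
(* The projection sought is the support of [h + b], twice the positive part of [b]. It annihilates
   [h - b], because the product of the two is zero. *)
have [f [pf Af f1 f2 [_ f4]]] := supp_ex hA (vnaD hA Ah Ab) pp.
have fn : (h - b) * f = 0.
  by apply: f4; rewrite mulrBl !mulrDr hh hb; ncring.
have fn' : f * (h - b) = 0.
  by apply: star_inj; rewrite starM (pos_sa pn) pf.1 fn star0.
have e : b = 2^-1%:C *: (h + b) - 2^-1%:C *: (h - b).
  by rewrite -scalerBr -[LHS]half2 -scalerDr; congr (_ *: _); ncring.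
have fb : f * b = 2^-1%:C *: (h + b).
  by rewrite {1}e mulrBr -!bscaleAr f1 fn' scaler0 subr0.
have bf : b * f = 2^-1%:C *: (h + b).
  by rewrite {1}e mulrBl -!bscaleAl f2 fn scaler0 subr0.
exists f; split=> //; first by rewrite fb bf.
  by rewrite fb; apply: posZ.
rewrite mulrBl mul1r opprB fb {2}e opprB addrC subrK.
exact: posZ.
Qed.

End sconv.

Ltac vna_tac hA :=
  try assumption;
  lazymatch goal with
  | |- _ (Algebra.add _ _) => apply (vnaD hA); vna_tac hA
  | |- _ (Algebra.opp _) => apply (vnaN hA); vna_tac hA
  | |- _ (GRing.mul _ _) => apply (vnaM hA); vna_tac hA
  | |- _ (GRing.scale _ _) => apply (vnaZ hA); vna_tac hA
  | |- _ (star _) => apply (vna_star hA); vna_tac hA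
  | |- _ (GRing.one _) => exact (vna1 hA)
  | |- _ (Algebra.zero) => exact (vna0 hA)
  end.

(* A countable substitute for Zorn's lemma, for a preorder with a bounded monotone gauge [m]. *)
Lemma max_principle (R : realType) (X : Type) (P : X -> Prop) (le : X -> X -> Prop)
    (m : X -> R) (B : R) (x0 : X) :
  P x0 -> (forall x, P x -> le x x) ->
  (forall x y z, P x -> P y -> P z -> le x y -> le y z -> le x z) ->
  (forall x, P x -> m x <= B) ->
  (forall x y, P x -> P y -> le x y -> m x <= m y) ->
  (forall x_ : nat -> X, (forall n, P (x_ n)) -> (forall n, le (x_ n) (x_ n.+1)) ->
     exists2 y, P y & forall n, le (x_ n) y) ->
  exists x, [/\ P x, le x0 x & forall y, P y -> le x y -> m y = m x].
Proof.
move=> P0 lerefl letr mB mle chain.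
pose S x := sup [set m y | y in [set y | P y /\ le x y]].
have hS x : P x -> has_sup [set m y | y in [set y | P y /\ le x y]].
  move=> Px; split; first by exists (m x), x => //; split => //; apply: lerefl.
  by exists B => _ [y [Py _] <-]; apply: mB.
(* The successor chosen at stage n realises, up to 1/(n+1), the supremum of [m] over everything
   above the current element. Nothing above an upper bound of the resulting chain can then increase
   [m]. *)
have next (nx : nat * X) : exists y, P nx.2 ->
    [/\ P y, le nx.2 y & S nx.2 - nx.1.+1%:R^-1 < m y].
  case: nx => n x /=; have [Px|nPx] := EM (P x); last by exists x.
  have e0 : 0 < n.+1%:R^-1 :> R by rewrite invr_gt0 ltr0n.
  by have [_ [y [Py xy] <-] h] := sup_adherent e0 (hS x Px); exists y.
have [g hg] := choice next.
pose x_ := fix x n := if n is n'.+1 then g (n', x n') else x0.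
have Px n : P (x_ n) by elim: n => //= n IH; have [] := hg (n, x_ n) IH.
have lex n : le (x_ n) (x_ n.+1) by have [] := hg (n, x_ n) (Px n).
have [y Py hy] := chain x_ Px lex.
exists y; split=> //; first exact: hy 0%N.
move=> z Pz yz; apply/eqP; rewrite eq_le; apply/andP; split; last exact: mle.
apply/ler_addgt0Pl => e e0; have [n nh] := ltr_add_invr e0; rewrite add0r in nh.
have [_ _] := hg (n, x_ n) (Px n); rewrite /= -/(x_ n.+1) => h.
have h1 : m z <= S (x_ n).
  apply: sup_upper_bound; first exact: hS.
  by exists z => //; split => //; apply: (letr _ y).
have := mle _ _ (Px n.+1) Py (hy n.+1); rewrite /=.
move: h h1 nh; move: (S _) (m (g _)) (m z) (m y) (_^-1) => *; lra.
Qed.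

(** * Traces and comparison of projections *)

Section traces.
Context {R : realType} {H : hilbertType R}.
Local Notation C := R[i].
Implicit Types (x y z p q a b c d e f g s v w h : bop H) (u : H) (r k : R) (A : set (bop H)).

Definition ple p q := p * q = p.

Lemma ple_r p q : isproj p -> isproj q -> ple p q -> q * p = p.
Proof. by move=> [sp _] [sq _] h; apply: star_inj; rewrite starM sp sq. Qed.
Lemma ple_sub p q : isproj p -> isproj q -> ple p q -> isproj (q - p).
Proof.
move=> pp pq h; split; first by apply: saB; [case: pq|case: pp].
have -> : (q - p) * (q - p) = q * q - q * p - p * q + p * p by ncring.
by rewrite (ple_r pp pq h) h pp.2 pq.2; ncring.
Qed.
Lemma ple_trans p q s : ple p q -> ple q s -> ple p s.
Proof. by rewrite /ple => h1 h2; rewrite -h1 -mulrA h2. Qed.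
Lemma ple_refl p : isproj p -> ple p p. Proof. by case. Qed.
Lemma ple1 p : ple p 1. Proof. by rewrite /ple mulr1. Qed.
Lemma ple_sub_orth p q : isproj p -> isproj q -> ple p q -> p * (q - p) = 0 /\ (q - p) * p = 0.
Proof.
by move=> pp pq h; rewrite mulrBr mulrBl h (ple_r pp pq h) pp.2 subrr.
Qed.
Lemma orth_sym p q : sa p -> sa q -> p * q = 0 -> q * p = 0.
Proof. by move=> sp sq h; apply: star_inj; rewrite starM sp sq h star0. Qed.
Lemma proj_add p q : isproj p -> isproj q -> p * q = 0 -> isproj (p + q).
Proof.
move=> [sp pp] [sq qq] h; split; first exact: saD.
have -> : (p + q) * (p + q) = p * p + p * q + q * p + q * q by ncring.
by rewrite pp qq h (orth_sym sp sq h) !addr0.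
Qed.
Lemma ple_subl p q : isproj p -> isproj q -> ple p q -> ple (q - p) q.
Proof. by move=> pp pq h; rewrite /ple mulrBl h pq.2. Qed.

Lemma inc_proj (e_ : nat -> bop H) : (forall n, isproj (e_ n)) ->
  (forall n, ple (e_ n) (e_ n.+1)) ->
  exists e, [/\ isproj e, sconv e_ e & forall n, ple (e_ n) e].
Proof.
move=> pe le; have lem m n : (m <= n)%N -> ple (e_ m) (e_ n).
  move=> /subnK <-; elim: (n - m)%N => [|j IH]; first exact/ple_refl/pe.
  by rewrite addSn; apply: ple_trans (le _).
have [n|n|n|e [he ee _ _]] := @vigier _ _ e_.
- exact/proj_pos.
- exact/proj_le1.
- exact/proj_pos/ple_sub.
have l n : ple (e_ n) e.
  have := sconvMl (e_ n) (sconv_shift n he); move/sconv_unique; apply.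
  by apply: sconv_ext (sconv_cst (e_ n)) => m; rewrite lem // leq_addl.
exists e; split=> //; split; first exact: pos_sa.
apply: sconv_unique (sconvMr e he) _; apply: sconv_ext he => n; exact/esym/l.
Qed.

(* Normality is only required along increasing sequences of projections. *)
Record nfun A (t : bop H -> R) : Prop := NFun {
  nf_lin : forall r x y, A x -> A y -> t (r%:C *: x + y) = r * t x + t y;
  nf_pos : forall x, A x -> pos x -> 0 <= t x;
  nf_norm : forall (e_ : nat -> bop H) e, (forall n, isproj (e_ n) /\ A (e_ n)) ->
    (forall n, ple (e_ n) (e_ n.+1)) -> isproj e -> A e -> sconv e_ e ->
    forall r, (forall n, t (e_ n) <= r) -> t e <= r
}.

Record trace A (t : bop H -> R) : Prop := Trace {
  tr_nfun : nfun A t;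
  tr1 : t 1 = 1;
  trC : forall x y, A x -> A y -> t (x * y) = t (y * x);
  tr_faith : forall x, A x -> t (x^'* * x) = 0 -> x = 0
}.

Section nfun_theory.
Variables (A : set (bop H)) (hA : vna A) (t : bop H -> R) (ht : nfun A t).
Lemma nfD x y : A x -> A y -> t (x + y) = t x + t y.
Proof. by move=> Ax Ay; have := nf_lin ht 1 Ax Ay; rewrite scale1r mul1r. Qed.
Lemma nf0 : t 0 = 0.
Proof.
have := nfD (vna0 hA) (vna0 hA); rewrite addr0 => /eqP.
by rewrite -subr_eq0 opprD addrA subrr add0r oppr_eq0 => /eqP.
Qed.
Lemma nfZ r x : A x -> t (r%:C *: x) = r * t x.
Proof. by move=> Ax; have := nf_lin ht r Ax (vna0 hA); rewrite nf0 !addr0. Qed.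
Lemma nfN x : A x -> t (- x) = - t x.
Proof.
move=> Ax; have := nfZ (-1) Ax.
by rewrite rmorphN /= scaleN1r mulN1r.
Qed.
Lemma nfB x y : A x -> A y -> t (x - y) = t x - t y.
Proof. by move=> Ax Ay; rewrite nfD ?nfN //; apply: (vnaN hA). Qed.
Lemma nf_sum (I : eqType) (l : seq I) (F : I -> bop H) :
  (forall i, i \in l -> A (F i)) -> t (\sum_(i <- l) F i) = \sum_(i <- l) t (F i).
Proof.
elim: l => [|i l IH] h; first by rewrite !big_nil nf0.
have h' j : j \in l -> A (F j) by move=> jl; apply: h; rewrite inE jl orbT.
rewrite !big_cons nfD ?IH //; first by apply: h; rewrite mem_head.
by rewrite big_seq; apply: (vna_sum hA).
Qed.
Lemma nf_le x y : A x -> A y -> pos (y - x) -> t x <= t y.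
Proof.
by move=> Ax Ay h; rewrite -subr_ge0 -nfB //; apply: (nf_pos ht) => //; apply: (vnaB hA).
Qed.
Lemma nf_ge0 p : A p -> isproj p -> 0 <= t p.
Proof. by move=> Ap /proj_pos; apply: (nf_pos ht). Qed.
Lemma nf_ple p q : A p -> A q -> isproj p -> isproj q -> ple p q -> t p <= t q.
Proof. by move=> *; apply: nf_le => //; apply/proj_pos/ple_sub. Qed.
End nfun_theory.

(* Murray-von Neumann equivalence. *)
Definition mvn A p q := exists v, [/\ A v, v^'* * v = p & v * v^'* = q].

Lemma pi_r v p : isproj p -> v^'* * v = p -> v * p = v.
Proof.
move=> pp vv; have : v * (1 - p) = 0.
  apply: star_mul0; rewrite starM mulrA -[_ * _ * v]mulrA vv -mulrA.
  by rewrite mulrBr pp.2 mulr1 subrr mulr0.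
by rewrite mulrBr mulr1 => /eqP; rewrite subr_eq0 => /eqP.
Qed.
Lemma pi_star v p : isproj p -> v^'* * v = p -> isproj (v * v^'*).
Proof.
move=> pp vv; split; first by rewrite /sa starM starK.
by rewrite mulrA -(mulrA v) vv (pi_r pp vv).
Qed.
Lemma pi_l v q : isproj q -> v * v^'* = q -> q * v = v.
Proof.
move=> pq vv; apply: star_inj; rewrite starM pq.1; apply: pi_r => //.
by rewrite starK.
Qed.
Lemma star_pi_r v p : isproj p -> v^'* * v = p -> p * v^'* = v^'*.
Proof. by move=> pp vv; apply: star_inj; rewrite starM starK pp.1 (pi_r pp vv). Qed.
Lemma star_pi_l v q : isproj q -> v * v^'* = q -> v^'* * q = v^'*.
Proof. by move=> pq vv; apply: star_inj; rewrite starM starK pq.1 (pi_l pq vv). Qed.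

Lemma mvn_refl A p : isproj p -> A p -> mvn A p p.
Proof. by move=> [sp pp] Ap; exists p; split; rewrite ?sp. Qed.
Lemma mvn_sym A p q : vna A -> mvn A p q -> mvn A q p.
Proof.
move=> hA [v [Av vp vq]]; exists (v^'*); split; rewrite ?starK //.
exact: (vna_star hA).
Qed.
Lemma mvn_trans A p q s : vna A -> isproj p -> isproj q -> mvn A p q -> mvn A q s -> mvn A p s.
Proof.
move=> hA pp pq [v [Av vp vq]] [w [Aw wq ws]]; exists (w * v); split.
- exact: (vnaM hA).
- by rewrite starM mulrA -(mulrA (v^'*)) wq (star_pi_l pq vq).
- by rewrite starM mulrA -(mulrA w) vq (pi_r pq wq).
Qed.
Lemma mvn_mono A B p q : A `<=` B -> mvn A p q -> mvn B p q.
Proof. by move=> AB [v [Av vp vq]]; exists v; split => //; apply: AB. Qed.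

Lemma mvn_sub A p q p' : vna A -> isproj p -> isproj q -> isproj p' -> A p' ->
  ple p' p -> mvn A p q -> exists q', [/\ isproj q', A q', ple q' q, mvn A p' q'
     & A p -> mvn A (p - p') (q - q')].
Proof.
move=> hA pp pq pp' Ap' le [v [Av vp vq]].
have e d : d * p = d -> p * d = d -> d * d = d -> sa d ->
    (v * d)^'* * (v * d) = d /\ (v * d) * (v * d)^'* = v * d * v^'*.
  move=> h1 h2 h3 sd; rewrite starM sd; split.
    by rewrite mulrA -(mulrA d) vp h1 h3.
  by rewrite mulrA -(mulrA v) h3.
have r1 := ple_r pp' pp le.
have [e1 e2] := e p' le r1 pp'.2 pp'.1.
have [s1 s2] := ple_sub pp' pp le.
have [||e3 e4] := e (p - p') _ _ s2 s1.
- by rewrite mulrBl pp.2 le.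
- by rewrite mulrBr pp.2 r1.
exists (v * p' * v^'*); split.
- by rewrite -e2; apply: pi_star e1.
- by apply: (vnaM hA); [apply: (vnaM hA)|apply: (vna_star hA)].
- by rewrite /ple -[LHS]mulrA (star_pi_l pq vq).
- by exists (v * p'); split=> //; apply: (vnaM hA).
- move=> Ap; exists (v * (p - p')); split=> //; first by apply: (vnaM hA) => //; apply: (vnaB hA).
  by rewrite e4 mulrBr mulrBl (pi_r pp vp) vq.
Qed.

Lemma pi_add p q p' q' v w : isproj p -> isproj q -> isproj p' -> isproj q' ->
  p * p' = 0 -> q * q' = 0 -> v^'* * v = p -> v * v^'* = q -> w^'* * w = p' -> w * w^'* = q' ->
  (v + w)^'* * (v + w) = p + p' /\ (v + w) * (v + w)^'* = q + q'.
Proof.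
move=> pp pq pp' pq' op oq vp vq wp wq; split.
- rewrite starD mulrDl !mulrDr vp wp.
  have -> : v^'* * w = 0.
    by rewrite -(star_pi_l pq vq) -(pi_l pq' wq) mulrA -(mulrA (v^'*)) oq mulr0 mul0r.
  have -> : w^'* * v = 0.
    rewrite -(star_pi_l pq' wq) -(pi_l pq vq) mulrA -(mulrA (w^'*)).
    by rewrite (orth_sym pq.1 pq'.1 oq) mulr0 mul0r.
  by rewrite addr0 add0r.
- rewrite starD mulrDl !mulrDr vq wq.
  have -> : v * w^'* = 0.
    by rewrite -(pi_r pp vp) -(star_pi_r pp' wp) mulrA -(mulrA v) op mulr0 mul0r.
  have -> : w * v^'* = 0.
    rewrite -(pi_r pp' wp) -(star_pi_r pp vp) mulrA -(mulrA w).
    by rewrite (orth_sym pp.1 pp'.1 op) mulr0 mul0r.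
  by rewrite addr0 add0r.
Qed.

Lemma polar_corner A x p q : vna A -> A x -> isproj p -> isproj q -> x * p = x -> q * x = x ->
  exists v h s,
  [/\ [/\ A v, A h & A s], [/\ pos h, h * h = x^'* * x & v * h = x],
      [/\ isproj s, v^'* * v = s, v * s = v & s * h = h]
    & [/\ s * p = s, h * p = h, v * p = v & q * v = v]].
Proof.
move=> hA Ax pp pq xp qx.
have [v [h [s [hAs [ph hh vh] [ps vv vs sh] [s1 s2]]]]] := polar hA Ax.
have hp : h * (1 - p) = 0.
  apply: (@star_mul_eq0 _ _ _ x); first by rewrite (pos_sa ph).
  by rewrite mulrBr mulr1 xp subrr.
have sp : s * p = s.
  by have := s1 _ hp; rewrite mulrBr mulr1 => /eqP; rewrite subr_eq0 eq_sym => /eqP.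
exists v, h, s; split=> //; split=> //.
- by move: hp; rewrite mulrBr mulr1 => /eqP; rewrite subr_eq0 eq_sym => /eqP.
- by rewrite -vs -mulrA sp.
- have : (1 - q) * v * s = 0.
    by apply: s2; rewrite -mulrA vh mulrBl mul1r qx subrr.
  by rewrite -mulrA vs mulrBl mul1r => /eqP; rewrite subr_eq0 eq_sym => /eqP.
Qed.

Section trace_theory.
Variables (A : set (bop H)) (hA : vna A) (t : bop H -> R) (ht : trace A t).
Let nt := tr_nfun ht.

Lemma mvn_tr p q : mvn A p q -> t p = t q.
Proof. by move=> [v [Av <- <-]]; apply: (trC ht) => //; apply: (vna_star hA). Qed.

Lemma mvn_trz p q z : A z -> (forall x, A x -> z * x = x * z) -> mvn A p q ->
  t (z * p) = t (z * q).
Proof.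
move=> Az cz [v [Av <- <-]]; have Avs := vna_star hA Av.
rewrite mulrA (trC ht) ?mulrA //; last exact: (vnaM hA).
by rewrite (cz _ Av).
Qed.

Lemma tr_eq0 p : A p -> isproj p -> t p = 0 -> p = 0.
Proof. by move=> Ap [sp pp] h; apply: (tr_faith ht) => //; rewrite sp pp. Qed.
Lemma tr_gt0 p : A p -> isproj p -> p <> 0 -> 0 < t p.
Proof.
move=> Ap pp p0; rewrite lt_neqAle (nf_ge0 nt) // andbT eq_sym.
by apply/eqP => /(tr_eq0 Ap pp).
Qed.
Lemma tr_le1 p : A p -> isproj p -> t p <= 1.
Proof.
move=> Ap pp; rewrite -(tr1 ht); apply: (nf_ple hA nt) => //; first exact: (vna1 hA).
  exact: isproj1.
exact: ple1.
Qed.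

(** The faithful trace is the gauge for [max_principle]: a projection above another one of the same
    trace equals it, so the element found is maximal for the order itself. *)
Lemma max_proj (F : set (bop H)) e0 : (forall e, F e -> isproj e /\ A e) -> F e0 ->
  (forall (e_ : nat -> bop H) e, (forall n, F (e_ n)) -> (forall n, ple (e_ n) (e_ n.+1)) ->
     isproj e -> A e -> sconv e_ e -> F e) ->
  exists e, [/\ F e, ple e0 e & forall f, F f -> ple e f -> f = e].
Proof.
move=> FP F0 Fl; have [||||||e [Fe le eM]] := @max_principle R _ F ple t 1 e0.
- by [].
- by move=> x /FP[/ple_refl].
- by move=> x y z _ _ _; apply: ple_trans.
- by move=> x /FP[px Ax]; apply: tr_le1.
- by move=> x y /FP[px Ax] /FP[py Ay]; apply: (nf_ple hA nt).
- move=> e_ Fe le; have [n|e [pe he lee]] := inc_proj _ le; first by case: (FP _ (Fe n)).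
  have Ae : A e by apply: (vna_lim hA _ he) => n; case: (FP _ (Fe n)).
  by exists e => //; apply: Fl he.
exists e; split=> // f Ff ef; have [pe Ae] := FP _ Fe; have [pf Af] := FP _ Ff.
have h : f - e = 0.
  apply: tr_eq0; [exact: (vnaB hA)|exact: ple_sub|].
  by rewrite (nfB hA nt) // (eM _ Ff ef) subrr.
by apply/eqP; rewrite -subr_eq0 h.
Qed.

(** Partial isometries from below [p] to below [q] are ordered by extension and measured by the
    trace of the initial projection. A nonzero element in the corner of the last clause would have a
    polar part that could be added to a maximal [v]. *)
Lemma max_pi p q : A p -> A q -> isproj p -> isproj q -> exists v,
  [/\ A v, isproj (v^'* * v), v * p = v, q * v = v &
   forall x, A x -> (q - v * v^'*) * x * (p - v^'* * v) = 0].
Proof.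
move=> Ap Aq pp pq.
pose P v := [/\ A v, isproj (v^'* * v), v * p = v & q * v = v].
pose le v w := w * (v^'* * v) = v.
have eE v w : P v -> P w -> le v w -> ple (v^'* * v) (w^'* * w).
  move=> [Av pv vp qv] [Aw pw wp qw] vw; rewrite /ple.
  apply: star_inj; rewrite starM pv.1 pw.1 -mulrA vw.
  have e1 : v^'* = v^'* * v * w^'* by rewrite -{1}vw starM pv.1.
  have e3 : v^'* * v = v^'* * v * (w^'* * w) * (v^'* * v).
    by rewrite {1}e1 -{3}vw !mulrA.
  rewrite -[w^'* * v]/(w^'* * v) -{1}vw mulrA.
  have pi : (1 - w^'* * w) * (v^'* * v) = 0.
    apply: star_mul0; rewrite starM pv.1 (isprojC pw).1 mulrA.
    rewrite -[_ * (1 - _) * (1 - _)]mulrA (isprojC pw).2.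
    by rewrite mulrBr mulr1 mulrBl pv.2 -e3 subrr.
  by move: pi; rewrite mulrBl mul1r => /eqP; rewrite subr_eq0 => /eqP.
have P0 : P 0.
  by split; rewrite ?mulr0 ?mul0r //; [exact: (vna0 hA)|exact: isproj0].
have [||||||v [Pv _ vM]] := @max_principle R _ P le (fun v => t (v^'* * v)) 1 0.
- exact: P0.
- by move=> v [Av pv _ _]; rewrite /le (pi_r pv).
- move=> x y z Px Py Pz xy yz; have [Ax px _ _] := Px; have [Ay py _ _] := Py.
  by rewrite /le -(ple_r px py (eE _ _ Px Py xy)) mulrA yz xy.
- by move=> x [Ax px _ _]; apply: tr_le1 => //; apply: (vnaM hA) => //; apply: (vna_star hA).
- move=> x y Px Py xy; have [Ax px _ _] := Px; have [Ay py _ _] := Py.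
  by apply: (nf_ple hA nt) (eE _ _ Px Py xy) => //; apply: (vnaM hA) => //; apply: (vna_star hA).
- move=> v_ Pv lev; pose e_ n := (v_ n)^'* * v_ n.
  have pe n : isproj (e_ n) by case: (Pv n).
  have lee n : ple (e_ n) (e_ n.+1) by apply: eE.
  have [e [pe' he le']] := inc_proj pe lee.
  have leem m n : (m <= n)%N -> ple (e_ m) (e_ n).
    move=> /subnK <-; elim: (n - m)%N => [|j IH]; first exact: ple_refl.
    by rewrite addSn; apply: ple_trans IH (lee _).
  have lev' m n : (m <= n)%N -> v_ n * e_ m = v_ m.
    move=> /subnK <-; elim: (n - m)%N => [|j IH]; first exact: (pi_r (pe m)).
    rewrite addSn -(ple_r (pe m) (pe (j + m)%N) (leem _ _ (leq_addl _ _))) mulrA.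
    by rewrite [v_ _ * _]lev IH.
  (* Because [e_ n] is the initial projection of [v_ n], differences of the [v_] have the norms of
     differences of the [e_]: the chain converges strongly since its initial projections do. *)
  have nv n d u : nrm ((v_ n * d) u) = nrm ((e_ n * d) u).
    rewrite bopM (nrm_eq_star (y := e_ n)); first by rewrite -bopM.
    by rewrite (pe n).1 (pe n).2.
  have [v hv vb] : exists2 v, sconv v_ v & forall u, nrm (v u) <= 1 * nrm u.
    apply: slim_ex => [n u|u r r0].
      rewrite -[v_ n]mulr1 nv mulr1 mul1r.
      by apply: contr_le1; [exact: proj_pos|exact: proj_le1].
    have [N Nh] := he u (r / 2) ltac:(by rewrite divr_gt0).
    exists N => m n Nm mn.
    have -> : v_ n u - v_ m u = (v_ n * (1 - e_ m)) u.
      by rewrite mulrBr mulr1 (lev' _ _ mn).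
    rewrite nv; have -> : e_ n * (1 - e_ m) = e_ n - e_ m.
      by rewrite mulrBr mulr1 (ple_r (pe m) (pe n) (leem _ _ mn)).
    rewrite bopB; apply: le_lt_trans (nrm_tri (e u) _ _) _.
    have := Nh _ Nm; have := Nh _ (leq_trans Nm mn); rewrite (nrmBC (e u)).
    lra.
  have ve n : v * e_ n = v_ n.
    have := sconvMr (e_ n) (sconv_shift n hv); move/sconv_unique; apply.
    by apply: sconv_ext (sconv_cst (v_ n)) => m; rewrite lev' // leq_addl.
  have vv : v^'* * v = e.
    apply/eqP; rewrite -subr_eq0; apply/eqP/sa_rip0.
      by apply: saB; [exact: sa_mulstar|case: pe'].
    move=> u; rewrite bopB ripBl -nrm_star -{1}pe'.2 -{1}pe'.1 -nrm_star.
    rewrite (_ : nrm (v u) = nrm (e u)) ?subrr //.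
    apply: (real_lim_eq (ucvg_rip2 (hv u)) (ucvg_rip2 (he u))) => n.
    by rewrite -{1}[v_ n]mulr1 nv mulr1.
  exists v; last by move=> n; apply: ve.
  split; first by apply: (vna_lim hA _ hv) => n; case: (Pv n).
  + by rewrite vv.
  + apply: sconv_unique (sconvMr p hv) _.
    by apply: sconv_ext hv => n; case: (Pv n) => _ _ ->.
  + apply: sconv_unique (sconvMl q hv) _.
    by apply: sconv_ext hv => n; case: (Pv n) => _ _ _ ->.
have [Av pv vp qv] := Pv; exists v; split=> // x Ax.
have Avs := vna_star hA Av.
set p' := p - v^'* * v; set q' := q - v * v^'*.
have pq0 : isproj (v * v^'*) by apply: pi_star pv _.
have lp : ple (v^'* * v) p by rewrite /ple -mulrA vp.
have lq : ple (v * v^'*) q.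
  by rewrite /ple; apply: star_inj; rewrite starM pq.1 pq0.1 mulrA qv.
have pp' : isproj p' by apply: ple_sub.
have pq' : isproj q' by apply: ple_sub.
set y := q' * x * p'.
have Ap' : A p' by apply: (vnaB hA) => //; apply: (vnaM hA).
have Aq' : A q' by apply: (vnaB hA) => //; apply: (vnaM hA).
have Ay : A y by do 2!apply: (vnaM hA) => //.
have yp : y * p' = y by rewrite /y -mulrA pp'.2.
have qy : q' * y = y by rewrite /y !mulrA pq'.2.
have [w [h [s [[Aw Ah As] [ph hh wh] [ps ww ws sh] [sp _ wp qw]]]]] :=
  polar_corner hA Ay pp' pq' yp qy.
have [oo1 oo2] := ple_sub_orth pv pp lp; have [oo3 oo4] := ple_sub_orth pq0 pq lq.
have pw : p' * w^'* = w^'* by apply: star_inj; rewrite starM starK pp'.1.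
have wq : w^'* * q' = w^'* by apply: star_inj; rewrite starM starK pq'.1.
have vw0 : v^'* * w = 0.
  by rewrite -(star_pi_l pq0 (erefl _)) -qw mulrA -(mulrA (v^'*)) oo3 mulr0 mul0r.
have wv0 : w^'* * v = 0 by apply: star_inj; rewrite starM starK vw0 star0.
have P1 : P (v + w).
  have e : (v + w)^'* * (v + w) = v^'* * v + s.
    by rewrite starD mulrDl !mulrDr vw0 wv0 ww addr0 add0r.
  split.
  - exact: (vnaD hA).
  - rewrite e; apply: proj_add => //.
    have sv : s * (v^'* * v) = 0 by rewrite -sp -mulrA oo2 mulr0.
    by apply: orth_sym sv; [case: ps|exact: sa_mulstar].
  - by rewrite mulrDl vp -[in LHS]wp -mulrA (_ : p' * p = p') ?wp // /p' mulrBl pp.2 lp.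
  - by rewrite mulrDr qv -[in LHS]qw mulrA (_ : q * q' = q') ?qw // /q' mulrBr pq.2 (ple_r pq0 pq lq).
have le1 : le v (v + w).
  by rewrite /le mulrDl (pi_r pv) // -{1}wp -mulrA oo2 mulr0 addr0.
have := vM _ P1 le1.
have -> : (v + w)^'* * (v + w) = v^'* * v + s.
  by rewrite starD mulrDl !mulrDr vw0 wv0 ww addr0 add0r.
rewrite (nfD nt) //; last exact: (vnaM hA).
move=> h0; have s0 : s = 0 by apply: (tr_eq0 As ps); lra.
by rewrite -wh -ws s0 mulr0 mul0r.
Qed.

(* The ideal [{x | q A x = 0}] has a unit, which is a central projection of [A]. *)
Lemma central_cut p q : A p -> A q -> isproj p -> isproj q ->
  (forall x, A x -> q * x * p = 0) ->
  exists z, [/\ isproj z, A z, forall x, A x -> z * x = x * z, z * p = p & z * q = 0].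
Proof.
move=> Ap Aq pp pq qAp.
pose J x := A x /\ forall a, A a -> q * a * x = 0.
have J0 : J 0 by split; [exact: (vna0 hA)|move=> a _; rewrite mulr0].
have JD x y : J x -> J y -> J (x + y).
  move=> [Ax Jx] [Ay Jy]; split; first exact: (vnaD hA).
  by move=> a Aa; rewrite mulrDr Jx // Jy // addr0.
have JZ (c : C) x : J x -> J (c *: x).
  move=> [Ax Jx]; split; first exact: (vnaZ hA).
  by move=> a Aa; rewrite -bscaleAr Jx // scaler0.
have JM x y : A x -> J y -> J (x * y).
  move=> Ax [Ay Jy]; split; first exact: (vnaM hA).
  by move=> a Aa; rewrite mulrA -(mulrA q) Jy //; apply: (vnaM hA).
have JMr x y : J x -> A y -> J (x * y).
  move=> [Ax Jx] Ay; split; first exact: (vnaM hA).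
  by move=> a Aa; rewrite mulrA Jx // mul0r.
have Jlim (x_ : nat -> bop H) x : (forall n, J (x_ n)) -> sconv x_ x -> J x.
  move=> Jx hx; split; first by apply: (vna_lim hA _ hx) => n; case: (Jx n).
  move=> a Aa; apply: sconv_unique (sconvMl (q * a) hx) _.
  by apply: sconv_ext (sconv_cst 0) => n; rewrite (Jx n).2.
have [|||z [[Jz pz] _ zM]] := @max_proj [set e | J e /\ isproj e] 0.
- by move=> e [[Ae _] pe].
- by split=> //; exact: isproj0.
- by move=> e_ e Fe _ pe Ae he; split=> //; apply: Jlim he => n; case: (Fe n).
have Az : A z by case: Jz.
(* Otherwise [y = x * (1 - z)] is a nonzero element of the ideal, and the support of a multiple of
   [y^'* * y] is a nonzero projection of the ideal orthogonal to the maximal [z]. *)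
have Jz_unit x : J x -> x * z = x.
  move=> Jx; set y := x * (1 - z).
  have Jy : J y by apply: JMr => //; apply: (vnaB hA) => //; exact: (vna1 hA).
  have Ay : A y by case: Jy.
  have Jb : J (y^'* * y) by apply: JM => //; apply: (vna_star hA).
  have [k k0 pk] := pos_scale (sa_mulstar y).
  set b := k%:C *: (y^'* * y); have Jb' : J b by apply: JZ.
  have pb : pos b by apply: posZ (ltW k0) (pos_mulstar y).
  have [s [ps hs s1 s2 [s3 s4]]] := supp_contr pb pk.
  have Js : J s.
    apply: Jlim hs; elim=> [|n IH]; first by rewrite expr0 subrr.
    have -> : 1 - (1 - b) ^+ n.+1 = 1 - (1 - b) ^+ n + (1 - b) ^+ n * b.
      by rewrite exprSr; ncring.
    apply: JD => //; apply: JM => //; apply: (vnaX hA); apply: (vnaB hA).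
      exact: (vna1 hA).
    by case: Jb'.
  have sz : s * z = 0.
    have yz : y * z = 0 by rewrite /y -mulrA mulrBl mul1r pz.2 subrr mulr0.
    by apply: s3; rewrite /b -bscaleAl -mulrA yz mulr0 scaler0.
  have zs := orth_sym ps.1 pz.1 sz.
  have h : s = 0.
    have : z + s = z.
      apply: zM; last by rewrite /ple mulrDr pz.2 zs addr0.
      by split; [exact: JD|exact: proj_add].
    by rewrite -[RHS]addr0 => /addrI.
  have y0 : y = 0.
    apply: star_mul0; apply: (scaleC_eq0 (r := k)); first by rewrite gt_eqF.
    by rewrite -/b -s1 h mul0r.
  by move: y0; rewrite /y mulrBr mulr1 => /eqP; rewrite subr_eq0 eq_sym => /eqP.
have zx x : A x -> z * x = z * x * z.
  by move=> Ax; rewrite Jz_unit //; apply: JMr.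
exists z; split=> //.
- move=> x Ax; rewrite zx //; apply: star_inj; rewrite !starM pz.1 mulrA.
  by rewrite -zx //; apply: (vna_star hA).
- have : p * z = p by apply: Jz_unit; split.
  by move=> h; apply: star_inj; rewrite starM pz.1 pp.1.
- apply: orth_sym; [by case: pq|by case: pz|].
  by have := Jz.2 1 (vna1 hA); rewrite mulr1.
Qed.

(** What a maximal partial isometry leaves of [p] and of [q] is separated by a central projection
    [z], by [central_cut]. Since [p] and [q] have equal traces against [z], the remainder of [p] has
    trace 0, and then so has that of [q]. *)
Lemma comparison p q : A p -> A q -> isproj p -> isproj q ->
  (forall z, A z -> isproj z -> (forall x, A x -> z * x = x * z) -> t (z * p) = t (z * q)) ->
  mvn A p q.
Proof.
move=> Ap Aq pp pq h; have [v [Av pv vp qv h0]] := max_pi Ap Aq pp pq.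
have Avs := vna_star hA Av.
have pq0 : isproj (v * v^'*) by apply: pi_star pv _.
have lp : ple (v^'* * v) p by rewrite /ple -mulrA vp.
have lq : ple (v * v^'*) q.
  by rewrite /ple; apply: star_inj; rewrite starM pq.1 pq0.1 mulrA qv.
have pp' := ple_sub pv pp lp; have pq' := ple_sub pq0 pq lq.
set p' := p - v^'* * v in h0 pp'; set q' := q - v * v^'* in h0 pq'.
have Avv : A (v^'* * v) by apply: (vnaM hA).
have Avv' : A (v * v^'*) by apply: (vnaM hA).
have Ap' : A p' by apply: (vnaB hA).
have Aq' : A q' by apply: (vnaB hA).
have [z [pz Az zc zp zq]] := central_cut Ap' Aq' pp' pq' h0.
have mv : mvn A (v^'* * v) (v * v^'*) by exists v.
have tp' : t p' = 0.
  rewrite -zp /p' mulrBr (nfB hA nt); try exact: (vnaM hA).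
  rewrite (h _ Az pz zc) (mvn_trz Az zc mv) -(nfB hA nt); try exact: (vnaM hA).
  by rewrite -mulrBr -/q' zq (nf0 hA nt).
have tq' : t q' = 0.
  have := h 1 (vna1 hA) isproj1 ltac:(by move=> x _; rewrite mul1r mulr1).
  rewrite !mul1r /q' (nfB hA nt) // => <-; rewrite -(mvn_tr mv).
  by rewrite -(nfB hA nt).
exists v; split=> //; apply/esym/eqP; rewrite -subr_eq0; apply/eqP.
  exact: tr_eq0 tp'.
exact: tr_eq0 tq'.
Qed.

End trace_theory.
End traces.

(** * Consequences of comparison: corners, meets and the Hahn decomposition *)

Section traces2.
Context {R : realType} {H : hilbertType R}.
Local Notation C := R[i].
Implicit Types (x y z p q a b c d e f g s v w h : bop H) (u : H) (r k : R) (A S : set (bop H)).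

Lemma subr0_eq' x y : x - y = 0 -> x = y.
Proof. by move=> /eqP; rewrite subr_eq0 => /eqP. Qed.

(** The two corners of [y] satisfy a Pythagorean identity: the square of the positive operator
    [p * y] is [p] minus [(g * y)^'* * (g * y)]. By uniqueness of positive roots the off-diagonal
    corner [g * y] determines [y]. *)
Lemma recover S p g y : vna S -> isproj p -> (p + g) * y = y -> isproj g -> p * g = 0 ->
  y^'* * y = p -> pos (p * y) -> S p -> S (g * y) -> S y.
Proof.
move=> hS pp pgy pg og yy pc Sp Sx.
have cc : (p * y) * (p * y) = p - (g * y)^'* * (g * y).
  have l1 d : isproj d -> (d * y)^'* * (d * y) = y^'* * d * y.
    by move=> [sd d2]; rewrite starM sd mulrA -(mulrA _ d d) d2.
  have yE : y^'* * p * y + y^'* * g * y = p.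
    by rewrite -!mulrA -mulrDr -mulrDl pgy.
  by rewrite -{1}(pos_sa pc) !l1 // -{2}yE addrK.
have [d [pd dd dS _]] := sqrt_ex (pos_sqr (pos_sa pc)).
have cd : p * y = d by apply: sqrt_uniq.
have Sc : S (p * y).
  rewrite cd; apply: dS => //; rewrite cc; apply: (vnaB hS) => //.
  by apply: (vnaM hS) => //; apply: (vna_star hS).
by rewrite -pgy mulrDl; apply: (vnaD hS).
Qed.

Section with_trace.
Variables (A : set (bop H)) (hA : vna A) (t : bop H -> R) (ht : trace A t).
Let nt := tr_nfun ht.

(** Equivalence is decided by traces against central projections, and these can be subtracted. *)
Lemma mvn_cancel p q p' q' : A p -> A q -> A p' -> A q' ->
  isproj p -> isproj q -> isproj p' -> isproj q' -> ple p' p -> ple q' q ->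
  mvn A p q -> mvn A p' q' -> mvn A (p - p') (q - q').
Proof.
move=> Ap Aq Ap' Aq' pp pq pp' pq' lp lq h h'.
apply: (comparison hA ht); rewrite ?(vnaB hA) //; try exact: ple_sub.
- exact: (vnaB hA).
- exact: (vnaB hA).
move=> z Az pz cz; rewrite !mulrBr !(nfB hA nt); try exact: (vnaM hA).
by rewrite (mvn_trz hA ht Az cz h) (mvn_trz hA ht Az cz h').
Qed.

(** Write [p * y0 * p = v * h]. By cancellation [v] extends to a unitary [U] of the corner of [p],
    and [w = U^'*] works, since [p * y0 * w = U * h * w] is a conjugate of [h]. *)
Lemma pos_corner p q y0 : isproj p -> isproj q -> A y0 -> y0^'* * y0 = p -> y0 * y0^'* = q ->
  exists y w, [/\ A w, y = y0 * w, w^'* * w = p, w * w^'* = p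
     & [/\ A y, y^'* * y = p, y * y^'* = q & pos (p * y)]].
Proof.
move=> pp pq Ay yp yq.
have Ap : A p by rewrite -yp; apply: (vnaM hA) => //; apply: (vna_star hA).
have [|||v [h [s [[Av Ah As] [ph hh vh] [ps vv vs sh] [sp hp vp pv]]]]] :=
  @polar_corner _ _ A (p * y0 * p) p p hA _ pp pp.
- by apply: (vnaM hA) => //; apply: (vnaM hA).
- by rewrite -mulrA pp.2.
- by rewrite !mulrA pp.2.
have pvv : isproj (v * v^'*) by apply: (@pi_star _ _ _ s).
have Avs := vna_star hA Av.
have ls : ple s p by [].
have lvv : ple (v * v^'*) p.
  by rewrite /ple; apply: star_inj; rewrite starM pp.1 pvv.1 mulrA pv.
have [w [Aw wp wq]] : mvn A (p - s) (p - v * v^'*).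
  apply: mvn_cancel => //; [exact: (vnaM hA)|exact: mvn_refl|by exists v].
have [oo1 _] := ple_sub_orth ps pp ls; have [oo2 _] := ple_sub_orth pvv pp lvv.
have [U1 U2] := pi_add ps pvv (ple_sub ps pp ls) (ple_sub pvv pp lvv) oo1 oo2 vv (erefl _) wp wq.
rewrite [s + _]addrC subrK in U1; rewrite [v * _ + _]addrC subrK in U2.
set U := v + w in U1 U2.
have AU : A U by apply: (vnaD hA).
have ph' : p * h = h by apply: star_inj; rewrite starM pp.1 (pos_sa ph) hp.
have Uh : U * h = p * y0 * p.
  have wh : w * h = 0.
    by rewrite -(pi_r (ple_sub ps pp ls) wp) -mulrA mulrBl ph' sh subrr mulr0.
  by rewrite /U mulrDl vh wh addr0.
have y0p : y0 * p = y0 by apply: pi_r.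
exists (y0 * U^'*), (U^'*); rewrite starK; split=> //; first exact: (vna_star hA).
split.
- by apply: (vnaM hA) => //; apply: (vna_star hA).
- by rewrite starM starK mulrA -(mulrA U) yp (pi_r pp U1).
- by rewrite starM starK mulrA -(mulrA y0) U1 y0p.
- rewrite mulrA -(star_pi_r pp U1) mulrA -Uh; exact: pos_conjr.
Qed.

(** The projection is [p] minus the right support of [(1 - q) * p]. That support is equivalent to a
    projection below [1 - q], which bounds its trace. *)
Lemma meet p q : A p -> A q -> isproj p -> isproj q ->
  exists e, [/\ A e, isproj e, ple e p, ple e q & t p + t q - 1 <= t e].
Proof.
move=> Ap Aq pp pq; have A1 := vna1 hA.
have [|||v [h [s [[Av Ah As] [ph hh vh] [ps vv vs sh] [sp hp vp qv]]]]] :=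
  @polar_corner _ _ A ((1 - q) * p) p (1 - q) hA _ pp (isprojC pq).
- by apply: (vnaM hA) => //; apply: (vnaB hA).
- by rewrite -mulrA pp.2.
- by rewrite mulrA (isprojC pq).2.
have hs : h * s = h by apply: star_inj; rewrite starM ps.1 (pos_sa ph) sh.
have ls : ple s p by [].
have pe : isproj (p - s) by apply: ple_sub.
have Ae : A (p - s) by apply: (vnaB hA).
exists (p - s); split=> //; first exact: ple_subl.
- have h0 : (1 - q) * (p - s) = 0.
    have : (1 - q) * p * (p - s) = 0 by rewrite -vh -mulrA mulrBr hp hs subrr mulr0.
    by rewrite -mulrA (ple_r pe pp (ple_subl ps pp ls)).
  rewrite /ple; apply: star_inj; rewrite starM pe.1 pq.1.
  by apply/esym/subr0_eq'; rewrite -{1}[p - s]mul1r -mulrBl.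
- have pvv : isproj (v * v^'*) by apply: (@pi_star _ _ _ s).
  have Avv : A (v * v^'*) by apply: (vnaM hA) => //; apply: (vna_star hA).
  have AC : A (1 - q) by apply: (vnaB hA).
  rewrite (nfB hA nt) // (mvn_tr hA ht (p := s) (q := v * v^'*)); last by exists v.
  have : t (v * v^'*) <= t (1 - q).
    apply: (nf_ple hA nt) => //; first exact: isprojC.
    by rewrite /ple; apply: star_inj; rewrite starM (isprojC pq).1 pvv.1 mulrA qv.
  by rewrite (nfB hA nt) // (tr1 ht); lra.
Qed.

(** Extraction of a binary digit: [f] is a spectral projection of [a + a - 1], and the remainder
    [a + a - f] is again between 0 and 1. *)
Lemma half_proj a : A a -> pos a -> pos (1 - a) -> exists f,
  [/\ isproj f, A f, pos (a + a - f), pos (1 - (a + a - f))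
    & forall e, isproj e -> a * e = a -> f * e = f].
Proof.
move=> Aa pa p1; have A1 := vna1 hA.
have [||f [pf Af fb p2 p3]] := @spec_ex _ _ A (a + a - 1) hA.
- by apply: (vnaB hA) => //; apply: (vnaD hA).
- by apply: saB; [apply: saD; exact: pos_sa|exact: sa1].
have fa : f * a = a * f.
  have : f * (a + a) = (a + a) * f.
    have -> : f * (a + a) = f * (a + a - 1) + f by ncring.
    by rewrite fb; ncring.
  rewrite mulrDl mulrDr => e; rewrite -[LHS]half2 -[RHS]half2 -!scalerDr.
  by rewrite e.
have pC := isprojC pf.
have P : pos (a + a - f).
  have -> : a + a - f = f * (a + a - 1) + ((1 - f) * a * (1 - f) + (1 - f) * a * (1 - f)).
    have -> : (1 - f) * a * (1 - f) = (1 - f) * a.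
      have c1 : (1 - f) * a = a * (1 - f) by rewrite mulrBl mulrBr fa mul1r mulr1.
      by rewrite c1 -mulrA pC.2.
    by ncring.
  by apply: posD => //; apply: posD; apply: pos_conj_sa => //; case: pC.
exists f; split=> //.
- have -> : 1 - (a + a - f) = - ((1 - f) * (a + a - 1)) +
    (f * (1 - a) * f + f * (1 - a) * f).
    have -> : f * (1 - a) * f = f * (1 - a).
      have c1 : f * (1 - a) = (1 - a) * f by rewrite mulrBl mulrBr fa mul1r mulr1.
      by rewrite c1 -mulrA pf.2.
    by ncring.
  by apply: posD => //; apply: posD; apply: pos_conj_sa => //; case: pf.
- move=> e pe ae; set g := 1 - e; have pg := isprojC pe.
  have ag : a * g = 0 by rewrite /g mulrBr mulr1 ae subrr.
  have h1 : pos (- (g * f * g)).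
    have -> : - (g * f * g) = g * (a + a - f) * g.
      have -> : g * (a + a - f) * g = g * (a * g) + g * (a * g) - g * f * g by ncring.
      by rewrite ag mulr0 addr0 sub0r.
    by apply: pos_conj_sa => //; case: pg.
  have h2 : pos (g * f * g) by apply: pos_conj_sa; [case: pg|exact: proj_pos].
  have h3 : f * g = 0.
    apply: star_mul0; rewrite starM pg.1 pf.1 -mulrA (mulrA f) pf.2 mulrA.
    exact: pos_anti.
  by apply/esym/subr0_eq'; rewrite -{1}[f]mulr1 -mulrBr.
Qed.

(** Iterating [half_proj] expands a contraction in projections below [e] with weights 2^-n. After n
    digits the remainder contributes at most 2^-n times [phi 1]. *)
Lemma layer_cake (phi psi : bop H -> R) e : nfun A phi -> nfun A psi -> A e -> isproj e ->
  (forall f, A f -> isproj f -> ple f e -> phi f <= psi f) ->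
  forall a, A a -> pos a -> a * e = a -> phi a <= psi a.
Proof.
move=> hphi hpsi Ae pe hle.
have phi1 : 0 <= phi 1 by apply: (nf_pos hphi); [exact: (vna1 hA)|exact: pos1].
have ind n : forall a, A a -> pos a -> pos (1 - a) -> a * e = a ->
    phi a <= psi a + 2^-1 ^+ n * phi 1.
  elim: n => [|n IH] a Aa pa p1 ae.
    rewrite expr0 mul1r; apply: le_trans (_ : phi 1 <= _).
      by apply: (nf_le hA hphi) => //; exact: (vna1 hA).
    by rewrite lerDr; apply: (nf_pos hpsi).
  have [f [pf Af p2 p3 hf]] := half_proj Aa pa p1.
  have fe := hf _ pe ae.
  have Aa' : A (a + a - f) by apply: (vnaB hA) => //; apply: (vnaD hA).
  have := IH (a + a - f) Aa' p2 p3 ltac:(by rewrite mulrBl mulrDl ae fe).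
  have := hle _ Af pf fe.
  rewrite (nfB hA hphi) ?(nfB hA hpsi) ?(nfD hphi) ?(nfD hpsi) //; try exact: (vnaD hA).
  rewrite exprS -mulrA; move: (_ * phi 1) => K; lra.
have le1 a : A a -> pos a -> pos (1 - a) -> a * e = a -> phi a <= psi a.
  move=> Aa pa p1 ae; apply/ler_addgt0Pl => r r0.
  have [n nh] : exists n, 2^-1 ^+ n * phi 1 < r.
    have [m mh] := ltr_add_invr (divr_gt0 r0 (ltr_wpDl phi1 ltr01)); rewrite add0r in mh.
    exists m; apply: le_lt_trans (_ : m.+1%:R^-1 * (phi 1 + 1) < r); last first.
      by move: mh; rewrite ltr_pdivlMr // ltr_wpDl.
    have h0 : 0 <= 2^-1 ^+ m :> R by rewrite exprn_ge0 // invr_ge0.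
    apply: ler_pM => //; last by lra.
    rewrite exprVn lef_pV2 ?posrE ?exprn_gt0 //.
    by rewrite -natrX ler_nat ltn_expl.
  have := ind n a Aa pa p1 ae; lra.
move=> a Aa pa ae; have [k k0 pk] := pos_scale (pos_sa pa).
have := le1 (k%:C *: a) (vnaZ hA _ Aa) (posZ (ltW k0) pa) pk ltac:(by rewrite -bscaleAl ae).
by rewrite (nfZ hA hphi) // (nfZ hA hpsi) // ler_pM2l.
Qed.

(** Take [e'] maximal among the projections below [d] with [psi e' <= phi e'], and [e = d - e']. A
    projection below [e] that violates [phi <= psi] could be added to [e']; [layer_cake] passes from
    projections to positive elements. *)
Lemma hahn (phi psi : bop H -> R) d : nfun A phi -> nfun A psi -> A d -> isproj d -> exists e,
  [/\ isproj e, A e, ple e d, forall a, A a -> pos a -> a * e = a -> phi a <= psi a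
    & psi (d - e) <= phi (d - e)].
Proof.
move=> hphi hpsi Ad pd.
pose F := [set e | [/\ isproj e, A e, ple e d & psi e <= phi e]].
have [|||e' [[pe' Ae' ld le'] _ eM]] := max_proj hA ht (F := F) (e0 := 0).
- by move=> e [].
- split; [exact: isproj0|exact: (vna0 hA)|by rewrite /ple mul0r|].
  by rewrite (nf0 hA hphi) (nf0 hA hpsi).
- move=> e_ e Fe le pe Ae he.
  have [e2 [pe2 he2 lee]] := inc_proj (fun n => let: And4 p _ _ _ := Fe n in p) le.
  have ee : e2 = e by apply: sconv_unique he2 he.
  split=> //.
    apply: sconv_unique (sconvMr d he) _.
    by apply: sconv_ext he => n; case: (Fe n) => _ _ ->.
  apply: (nf_norm hpsi (e_ := e_)) => // [n|n]; first by case: (Fe n).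
  case: (Fe n) => pn An _ len; apply: le_trans len _.
  by apply: (nf_ple hA hphi) => //; rewrite -ee; apply: lee.
have pC := ple_sub pe' pd ld; have lC := ple_subl pe' pd ld.
have AC : A (d - e') by apply: (vnaB hA).
exists (d - e'); split=> //; last by rewrite opprB addrCA subrr addr0.
apply: layer_cake => // f Af pf lf; rewrite leNgt; apply/negP => hlt.
have of1 : e' * f = 0.
  by rewrite -(ple_r pf pC lf) mulrA mulrBr ld pe'.2 subrr mul0r.
have h : e' + f = e'.
  apply: eM; last by rewrite /ple mulrDr pe'.2 of1 addr0.
  split; [exact: proj_add|exact: (vnaD hA)| |].
    by rewrite /ple mulrDl ld -{1}lf -mulrA lC lf.
  by rewrite (nfD hphi) ?(nfD hpsi) // lerD // ltW.
have f0 : f = 0 by move: h; rewrite -[RHS]addr0 => /addrI.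
by move: hlt; rewrite f0 (nf0 hA hphi) (nf0 hA hpsi) ltxx.
Qed.

End with_trace.
End traces2.

(** * Vector states and the 2-norm *)

Section vectors.
Context {R : realType} {H : hilbertType R}.
Local Notation C := R[i].
Implicit Types (x y z p q a b c d e f g s v w h : bop H) (u xi : H) (r k : R) (A S : set (bop H)).

Definition vstate xi x : R := rip (x xi) xi.

Lemma vstate_nfun A xi : nfun A (vstate xi).
Proof.
rewrite /vstate; split.
- by move=> r x y _ _; rewrite bopD ripDl bopZ ripZl.
- by move=> x _ [_ px]; apply: px.
- move=> e_ e _ _ _ _ he r h; apply: (ucvg_rip_le (he xi)).
  by exists 0%N => n _; apply: h.
Qed.

Lemma vstate_star xi a : vstate xi (a^'* * a) = nrm (a xi) ^+ 2.
Proof. by rewrite nrm_star. Qed.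

Lemma nfun_scale A t r : nfun A t -> 0 <= r -> nfun A (fun x => r * t x).
Proof.
move=> [l p n] r0; split.
- by move=> k x y Ax Ay; rewrite l //; ring.
- by move=> x Ax px; apply: mulr_ge0 => //; apply: p.
- move=> e_ e pe le pe' Ae he k h; have [r1|r1] := eqVneq r 0.
    by move: (h 0%N); rewrite r1 !mul0r.
  have rp : 0 < r by rewrite lt_neqAle eq_sym r1.
  rewrite -ler_pdivlMl //; apply: (n _ _ pe le pe' Ae he) => m.
  by rewrite ler_pdivlMl.
Qed.

Section trace_vectors.
Variables (A : set (bop H)) (hA : vna A) (t : bop H -> R) (ht : trace A t).
Let nt := tr_nfun ht.

(** The square of the 2-norm given by the trace. *)
Definition n2 a : R := t (a^'* * a).

Lemma tr_pos x : A x -> pos x -> 0 <= t x. Proof. exact: nf_pos nt x. Qed.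
Lemma n2_ge0 a : A a -> 0 <= n2 a.
Proof.
by move=> Aa; apply: tr_pos; [apply: (vnaM hA) => //; apply: (vna_star hA)|apply: pos_mulstar].
Qed.

Lemma n2_add a b : A a -> A b -> n2 (a + b) <= 2 * n2 a + 2 * n2 b.
Proof.
move=> Aa Ab; have As := vna_star hA Aa; have Bs := vna_star hA Ab.
have := n2_ge0 (vnaB hA Aa Ab); rewrite /n2 !starD starN.
rewrite !(mulrDl, mulrDr, mulrN, mulNr, opprK).
rewrite !(nfD nt) ?(nfN hA nt); try vna_tac hA.
by lra.
Qed.

Lemma n2_star a : A a -> n2 (a^'*) = n2 a.
Proof. by move=> Aa; rewrite /n2 starK; apply: (trC ht) => //; apply: (vna_star hA). Qed.

Lemma n2_bound k a c : A a -> A c -> pos (k%:C *: (1 : bop H) - a^'* * a) ->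
  n2 (a * c) <= k * n2 c.
Proof.
move=> Aa Ac pk; have As := vna_star hA Aa; have Cs := vna_star hA Ac.
rewrite /n2 -(nfZ hA nt); last exact: (vnaM hA).
apply: (nf_le hA nt).
- by rewrite starM; do 3?apply: (vnaM hA).
- by apply: (vnaZ hA); exact: (vnaM hA).
have -> : k%:C *: (c^'* * c) - (a * c)^'* * (a * c) = c^'* * (k%:C *: (1 : bop H) - a^'* * a) * c.
  by rewrite mulrBr mulrBl -bscaleAr -bscaleAl mulr1 starM !mulrA.
exact: pos_conj.
Qed.

Lemma n2_boundr k a c : A a -> A c -> pos (k%:C *: (1 : bop H) - a * a^'*) ->
  n2 (c * a) <= k * n2 c.
Proof.
move=> Aa Ac pk; have As := vna_star hA Aa; have Cs := vna_star hA Ac.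
rewrite -[n2 (c * a)]n2_star; last exact: (vnaM hA).
by rewrite starM -(n2_star Ac); apply: n2_bound => //; rewrite starK.
Qed.

Lemma n2_projr p c : A p -> A c -> isproj p -> n2 (c * p) <= n2 c.
Proof.
move=> Ap Ac pp; have := @n2_boundr 1 p c Ap Ac; rewrite mul1r scale1r pp.1 pp.2.
by apply; apply: proj_le1.
Qed.

Lemma n2_proj p : isproj p -> n2 p = t p.
Proof. by move=> [sp pp]; rewrite /n2 sp pp. Qed.

Lemma tr_inc (e_ : nat -> bop H) e r : (forall n, isproj (e_ n) /\ A (e_ n)) ->
  (forall n, ple (e_ n) (e_ n.+1)) -> isproj e -> A e -> sconv e_ e -> 0 < r ->
  exists n, t (e - e_ n) <= r.
Proof.
move=> pe le pe' Ae he r0; apply: contrapT => h.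
suff : t e <= t e - r by lra.
apply: (nf_norm nt pe le pe' Ae he) => n.
rewrite leNgt; apply/negP => hn; apply: h; exists n.
by rewrite (nfB hA nt) //; [lra|case: (pe n)].
Qed.

Lemma trace_vector d : A d -> isproj d -> d <> 0 -> exists e xi,
  [/\ isproj e, A e, ple e d, e <> 0 & forall a, A a -> n2 (a * e) <= nrm (a xi) ^+ 2].
Proof.
move=> Ad pd d0.
have [u u0] : exists u, d u <> 0.
  by apply: contrapT => h; apply: d0; apply: bopP => u; apply: contrapT => h1; apply: h; exists u.
have n0 : 0 < nrm (d u).
  rewrite lt_neqAle nrm_ge0 andbT eq_sym; apply/eqP => /nrm_eq0; exact: u0.
(* Norm 2 makes the vector state equal to 4 on [d], where the trace is at most 1. Hence the Hahn
   projection, on whose corner the trace lies below the vector state, is not 0. *)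
pose xi := (2 / nrm (d u))%:C *: d u.
have nxi : nrm xi = 2.
  by rewrite /xi nrmZr ger0_norm ?divr_ge0 ?nrm_ge0 // divfK ?gt_eqF.
have dxi : d xi = xi by rewrite /xi appZ -bopM pd.2.
have [e [pe Ae le h1 h2]] := hahn hA ht nt (vstate_nfun A xi) Ad pd.
exists e, (e xi); split=> //.
- move=> e0; move: h2; rewrite e0 subr0 /vstate dxi ripE nxi.
  have := tr_le1 hA ht Ad pd; lra.
- move=> a Aa; rewrite -bopM -vstate_star; apply: h1.
  + by apply: (vnaM hA); [apply: (vna_star hA)|]; exact: (vnaM hA).
  + exact: pos_mulstar.
  + by rewrite -!mulrA pe.2.
Qed.

(** Off a projection of small trace, finitely many vector states dominate the trace. Closeness on
    finitely many vectors therefore gives closeness in 2-norm on the corner. *)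
Lemma trace_vectors r : 0 < r -> exists e (l : seq H),
  [/\ isproj e, A e, t (1 - e) <= r & forall a, A a -> n2 (a * e) <= \sum_(u <- l) nrm (a u) ^+ 2].
Proof.
move=> r0.
pose P e := exists l : seq H, forall a, A a -> n2 (a * e) <= \sum_(u <- l) nrm (a u) ^+ 2.
(* An increasing limit of projections with a finite family of vectors need not have one, so
   maximality is sought among the projections that such ones approximate in trace. *)
pose F := [set e | [/\ isproj e, A e & forall r, 0 < r -> exists g,
   [/\ isproj g, A g, ple g e, P g & t (e - g) <= r]]].
have A1 := vna1 hA.
have [|||e [[pe Ae he] _ eM]] := max_proj hA ht (F := F) (e0 := 0).
- by move=> e [].
- split; [exact: isproj0|exact: (vna0 hA)|move=> k k0; exists 0; split].
  + exact: isproj0.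
  + exact: (vna0 hA).
  + by rewrite /ple mul0r.
  + by exists [::] => a _; rewrite big_nil mulr0 /n2 mulr0 (nf0 hA nt).
  + by rewrite subrr (nf0 hA nt) ltW.
- move=> e_ e Fe le pe Ae he; split=> // k k0.
  have pA n : isproj (e_ n) /\ A (e_ n) by case: (Fe n).
  have k2 : 0 < k / 2 by rewrite divr_gt0.
  have [n hn] := tr_inc pA le pe Ae he k2.
  have [pn An /(_ _ k2)[g [pg Ag lg Pg hg]]] := Fe n.
  have [e2 [pe2 he2 lee]] := inc_proj (fun n => (pA n).1) le.
  have ee : e2 = e by apply: sconv_unique he2 he.
  exists g; split=> //; first by apply: ple_trans lg _; rewrite -ee; apply: lee.
  rewrite -(subrKA (e_ n)) (nfD nt); [lra|exact: (vnaB hA)|exact: (vnaB hA)].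
have [e1|e1] := EM (1 - e = 0).
  have [g [pg Ag lg [l hl] hg]] := he r r0.
  by exists g, l; split=> //; rewrite -[1](subrK e) e1 add0r.
have pC := isprojC pe; have AC : A (1 - e) by apply: (vnaB hA).
have [e' [xi [pe' Ae' le' e'0 he']]] := trace_vector AC pC e1.
have oe : e * e' = 0.
  by rewrite -(ple_r pe' pC le') mulrA mulrBr mulr1 pe.2 subrr mul0r.
exfalso; apply: e'0; suff : e + e' = e by rewrite -[RHS]addr0 => /addrI.
apply: eM; last by rewrite /ple mulrDr pe.2 oe addr0.
split; [exact: proj_add|exact: (vnaD hA)|move=> k k0].
have [g [pg Ag lg [l hl] hg]] := he k k0.
have og : g * e' = 0 by rewrite -lg -mulrA oe mulr0.
exists (g + e'); split; [exact: proj_add|exact: (vnaD hA)| | |].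
- by rewrite /ple mulrDl !mulrDr lg og pe'.2 (orth_sym _ _ oe) ?addr0 ?add0r //; case: pe; case: pe'.
- exists (xi :: l) => a Aa; rewrite big_cons.
  have -> : n2 (a * (g + e')) = n2 (a * e') + n2 (a * g).
    have E p : A p -> isproj p -> n2 (a * p) = t (a^'* * a * p).
      move=> Ap pp; rewrite /n2 starM pp.1 -mulrA (trC ht) //.
        by rewrite -!mulrA pp.2.
      by apply: (vnaM hA); [apply: (vna_star hA)|apply: (vnaM hA)].
    rewrite !E //; [|exact: (vnaD hA)|exact: proj_add].
    by rewrite mulrDr (nfD nt); [rewrite addrC|vna_tac hA|vna_tac hA].
  by apply: lerD; [exact: he'|exact: hl].
- by rewrite opprD addrACA subrr addr0.
Qed.

(** Vectors on which the 2-norm controls the operators of [A]; they are shown to be dense, so that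
    2-norm estimates yield strong convergence. *)
Definition tbounded xi := exists k, forall a, A a -> nrm (a xi) ^+ 2 <= k * n2 a.

Lemma tbounded_add xi xi' : tbounded xi -> tbounded xi' -> tbounded (xi + xi').
Proof.
move=> [k hk] [k' hk']; exists (2 * k + 2 * k') => a Aa.
rewrite appD nrmD2; have := hk a Aa; have := hk' a Aa.
have := le_cs (a xi) (a xi'); have := sqr_ge0 (nrm (a xi) - nrm (a xi')); nra.
Qed.

Lemma tbounded_ex d xi : A d -> isproj d -> d <> 0 -> exists e,
  [/\ isproj e, A e, ple e d, e <> 0 & tbounded (e xi)].
Proof.
move=> Ad pd d0; have td := tr_gt0 ht Ad pd d0.
(* With this constant [k * t d] exceeds the value of the vector state at [d], which forces the Hahn
   projection to be nonzero. *)
pose k := (nrm xi ^+ 2 + 1) / t d.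
have k0 : 0 <= k by rewrite divr_ge0 ?ltW // ltr_wpDl ?sqr_ge0.
have [e [pe Ae le h1 h2]] := hahn hA ht (vstate_nfun A xi) (nfun_scale nt k0) Ad pd.
exists e; split=> //.
- move=> e0; move: h2; rewrite e0 subr0 /k divfK ?gt_eqF //.
  have : vstate xi d <= nrm xi ^+ 2.
    by rewrite -ripE; have := (proj_le1 pd).2 xi; rewrite bopB ripBl bop1 subr_ge0.
  lra.
- exists k => a Aa; rewrite -bopM -vstate_star; apply: le_trans (h1 _ _ _ _) _.
  + by apply: (vnaM hA); [apply: (vna_star hA)|]; exact: (vnaM hA).
  + exact: pos_mulstar.
  + by rewrite -!mulrA pe.2.
  + by rewrite ler_wpM2l //; apply: n2_projr.
Qed.

Lemma tbounded_dense xi r : 0 < r -> exists2 xi', tbounded xi' & nrm (xi - xi') < r.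
Proof.
move=> r0.
pose F := [set e | [/\ isproj e, A e & forall r, 0 < r ->
   exists2 xi', tbounded xi' & nrm (e xi - xi') < r]].
have A1 := vna1 hA.
have [|||e [[pe Ae he] _ eM]] := max_proj hA ht (F := F) (e0 := 0).
- by move=> e [].
- split; [exact: isproj0|exact: (vna0 hA)|move=> k k0; exists 0].
    by exists 0 => a _; rewrite app0 nrm0 expr0n mul0r.
  by rewrite subr0 bop0 nrm0.
- move=> e_ e Fe le pe Ae he; split=> // k k0.
  have [N Nh] := he xi (k / 2) ltac:(by rewrite divr_gt0).
  have [_ _ /(_ (k / 2) ltac:(by rewrite divr_gt0))[xi' b h]] := Fe N.
  exists xi' => //; apply: le_lt_trans (nrm_tri (e_ N xi) _ _) _.
  have := Nh N (leqnn _); rewrite nrmBC; lra.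
have [e1|e1] := EM (1 - e = 0).
  by have := he r r0; rewrite -(subr0_eq' e1).
have pC := isprojC pe; have AC : A (1 - e) by apply: (vnaB hA).
have [e' [pe' Ae' le' e'0 he']] := tbounded_ex xi AC pC e1.
have oe : e * e' = 0.
  by rewrite -(ple_r pe' pC le') mulrA mulrBr mulr1 pe.2 subrr mul0r.
exfalso; apply: e'0; suff : e + e' = e by rewrite -[RHS]addr0 => /addrI.
apply: eM; last by rewrite /ple mulrDr pe.2 oe addr0.
split; [exact: proj_add|exact: (vnaD hA)|move=> k k0].
have [xi' b h] := he k k0; exists (xi' + e' xi); first exact: tbounded_add.
by rewrite bopD opprD addrACA subrr addr0.
Qed.

(** For a bounded sequence it is enough to check convergence on the dense set of [tbounded] vectors,
    where the 2-norm controls it. *)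
Lemma n2_sconv (y_ : nat -> bop H) x k : A x -> (forall n, A (y_ n)) ->
  (forall n u, nrm (y_ n u) <= k * nrm u) ->
  (forall r, 0 < r -> exists N, forall n, (N <= n)%N -> n2 (y_ n - x) < r) -> sconv y_ x.
Proof.
move=> Ax Ay yb hy u e e0; have [j j0 xb] := bop_bound x.
set K := `|k| + j + 1; have K0 : 0 < K by rewrite ltr_wpDl ?addr_ge0.
have [u' [c hc] hu] := tbounded_dense u (divr_gt0 e0 (mulr_gt0 (ltr0n _ 2) K0)).
have c0 : 0 < `|c| + 1 by rewrite ltr_wpDl.
have [N Nh] := hy ((e / 2) ^+ 2 / (`|c| + 1)) ltac:(by rewrite divr_gt0 // exprn_gt0 // divr_gt0).
exists N => n Nn; rewrite -bopB.
have -> : u = (u - u') + u' by rewrite subrK.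
rewrite appD; apply: le_lt_trans (nrmD _ _) _.
have h1 : nrm ((y_ n - x) (u - u')) <= K * nrm (u - u').
  rewrite bopB; apply: le_trans (nrmB _ _) _.
  have := yb n (u - u'); have := xb (u - u'); have := nrm_ge0 (u - u').
  have := ler_norm k; rewrite /K; nra.
have h2 : nrm ((y_ n - x) u') < e / 2.
  rewrite -(@ltr_pXn2r _ 2) ?nnegrE ?nrm_ge0 // ?divr_ge0 ?ltW //.
  have An : A (y_ n - x) by apply: (vnaB hA).
  apply: le_lt_trans (hc _ An) _; have := Nh n Nn; rewrite ltr_pdivlMr //.
  have := n2_ge0 An; have := ler_norm c; nra.
have : K * nrm (u - u') < e / 2.
  by move: hu; rewrite invfM mulrA ltr_pdivlMr // mulrC.
lra.
Qed.

(* Truncation: [y = x g] with [g] the spectral projection of [x^* x] below 4. *)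
Lemma truncate S x y e r : vna S -> S `<=` A -> S y -> A x -> A e -> isproj e -> 0 < r ->
  pos (1 - x^'* * x) -> n2 ((y - x) * e) <= r -> t (1 - e) <= r ->
  exists g, [/\ isproj g, S g, pos (4%:C *: (1 : bop H) - (y * g)^'* * (y * g))
     & n2 (y * g - x) <= 62 * r].
Proof.
move=> hS SA Sy Ax Ae pe r0 px hye he.
have Ay := SA _ Sy; have A1 := vna1 hA.
pose b := y^'* * y - 4%:C *: (1 : bop H).
have Sb : S b.
  apply: (vnaB hS); last by apply/(vnaZ hS)/(vna1 hS).
  by apply: (vnaM hS) => //; apply: (vna_star hS).
have sb : sa b by apply: saB; [exact: sa_mulstar|exact/saZ/sa1].
have [f [pf Sf fb p1 p2]] := spec_ex hS Sb sb.
have Af := SA _ Sf; have pC := isprojC pf.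
have Ag : A (1 - f) by apply: (vnaB hA).
have Sg : S (1 - f) by apply: (vnaB hS) => //; exact: (vna1 hS).
have gbg : (1 - f) * b * (1 - f) = (1 - f) * b.
  have -> : (1 - f) * b = b * (1 - f) by rewrite mulrBl [RHS]mulrBr mul1r mulr1 fb.
  by rewrite -mulrA pC.2.
have fbf : f * b * f = f * b by rewrite fb -mulrA pf.2.
have pbp p : isproj p -> p * b * p = (y * p)^'* * (y * p) - 4%:C *: p.
  move=> pp; rewrite /b [p * (_ - _)]mulrBr [(_ - _) * p]mulrBl -bscaleAr -bscaleAl.
  by rewrite mulr1 pp.2 starM pp.1 !mulrA.
have yg : pos (4%:C *: (1 : bop H) - (y * (1 - f))^'* * (y * (1 - f))).
  have -> : 4%:C *: (1 : bop H) - (y * (1 - f))^'* * (y * (1 - f)) =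
     - ((1 - f) * b) + 4%:C *: f.
    by rewrite -gbg (pbp _ pC) scalerBr; ncring.
  by apply: posD => //; apply: posZ => //; apply: proj_pos.
(* Below [f] the square of [y] is at least 4, while below [e] it is close to the contraction [x]. So
   4 t(r1) <= 2 r + 2 t(r1), which gives t(r1) <= r and t(f) <= 2 r. *)
have [r1 [Ar1 pr1 l1 l2 h1]] := meet hA ht Af Ae pf pe.
have n2y : 4 * t r1 <= n2 (y * r1).
  rewrite /n2 -(nfZ hA nt) //; apply: (nf_le hA nt).
  - exact: (vnaZ hA).
  - by apply: (vnaM hA); [apply: (vna_star hA)|]; exact: (vnaM hA).
  have -> : (y * r1)^'* * (y * r1) - 4%:C *: r1 = r1 * (f * b) * r1.
    by rewrite -(pbp _ pr1) mulrA l1.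
  by apply: pos_conj_sa => //; case: pr1.
have ye1 : n2 ((y - x) * r1) <= r.
  apply: le_trans hye; rewrite -(ple_r pr1 pe l2) mulrA; apply: n2_projr => //.
  by apply: (vnaM hA) => //; apply: (vnaB hA).
have x1 p : A p -> isproj p -> n2 (x * p) <= t p.
  by move=> Ap pp; rewrite -[t p]mul1r -(n2_proj pp); apply: n2_bound; rewrite ?scale1r.
have tr1' : t r1 <= r.
  have := @n2_add ((y - x) * r1) (x * r1); rewrite -mulrDl subrK.
  have := x1 _ Ar1 pr1 => h3 /(_ (vnaM hA (vnaB hA Ay Ax) Ar1) (vnaM hA Ax Ar1)) h4.
  lra.
have te : t (1 - e) = 1 - t e by rewrite (nfB hA nt) // (tr1 ht).
have tf : t f <= 2 * r by lra.
(* The complement of [r2] has trace at most 3 r; there the truncated [y], of square at most 4, and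
   [x] contribute at most (8 + 2) times 3 r. Below [r2] the error is at most r. Doubling both gives
   2 r + 60 r = 62 r. *)
have [r2 [Ar2 pr2 l3 l4 h2]] := meet hA ht Ae Ag pe pC.
have tg : t (1 - f) = 1 - t f by rewrite (nfB hA nt) // (tr1 ht).
exists (1 - f); split=> //.
have pr2C := isprojC pr2; have Ar2C : A (1 - r2) by apply: (vnaB hA).
have AY : A (y * (1 - f)) by apply: (vnaM hA).
have AYx : A (y * (1 - f) - x) by apply: (vnaB hA).
have hc : t (1 - r2) <= 3 * r by rewrite (nfB hA nt) // (tr1 ht); lra.
have -> : y * (1 - f) - x = (y * (1 - f) - x) * r2 + (y * (1 - f) - x) * (1 - r2).
  by rewrite -mulrDr addrCA subrr addr0 mulr1.
apply: le_trans (n2_add _ _) _; [exact: (vnaM hA)|exact: (vnaM hA)|].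
have h3 : n2 ((y * (1 - f) - x) * r2) <= r.
  apply: le_trans hye; have -> : (y * (1 - f) - x) * r2 = (y - x) * e * r2.
    by rewrite -[RHS]mulrA (ple_r pr2 pe l3) !mulrBl -mulrA (ple_r pr2 pC l4).
  by apply: n2_projr => //; apply: (vnaM hA) => //; apply: (vnaB hA).
have h4 : n2 ((y * (1 - f) - x) * (1 - r2)) <= 2 * (4 * t (1 - r2)) + 2 * t (1 - r2).
  rewrite mulrBl -mulrN; apply: le_trans (n2_add _ _) _; try exact: (vnaM hA).
    by apply: (vnaM hA) => //; apply: (vnaN hA).
  apply: lerD; rewrite ler_pM2l //.
    by rewrite -(n2_proj pr2C); apply: n2_bound.
  have -> : n2 (x * - (1 - r2)) = n2 (x * (1 - r2)) by rewrite mulrN /n2 starN mulrNN.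
  exact: x1.
lra.
Qed.

End trace_vectors.
End vectors.

(** * Von Neumann algebras of functions and of bounded operators *)

Section lift.
Context {R : realType} {H : hilbertType R}.
Local Notation C := R[i].
Implicit Types (x y z p q a b c d e f g s v w h : bop H) (u xi : H) (r k : R) (A S : set (bop H)).

Definition lift (S : set (op H)) : set (bop H) := [set x | S (bval x)].

(** The non-unital counterpart of [vna]: the subalgebras that cut out [Wstar] may miss the identity
    of the space. *)
Record nvna S : Prop := Nvna {
  nv0 : S 0;
  nv_lin : forall (c : C) x y, S x -> S y -> S (c *: x + y);
  nvM : forall x y, S x -> S y -> S (x * y);
  nv_star : forall x, S x -> S (x^'*);
  nv_lim : forall (x_ : nat -> bop H) x, (forall n, S (x_ n)) -> sconv x_ x -> S x
}.

Lemma sot_seq (S : set (op H)) (x_ : nat -> bop H) x : sot_closed S ->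
  (forall n, S (x_ n)) -> sconv x_ x -> S x.
Proof.
move=> hS Sx hx; apply: hS; first exact: bvalB.
have /pointwise_cvgP h : forall u, (fun g : H -> H => g u) @
   ((fun n => bval (x_ n)) @ \oo) --> x u.
  by move=> u; have /ucvgP := hx u.
move=> B /h[N _ Nh]; exists (bval (x_ N)); split; first exact: Sx.
exact: (Nh N (leqnn N)).
Qed.

Lemma lift_nvna (S : set (op H)) : vn_subalgebra S -> nvna (lift S).
Proof.
move=> [hS sS]; split.
- exact: (ssa_zero hS).
- by move=> c x y; apply: (ssa_linear hS).
- by move=> x y; apply: (ssa_mul hS).
- by move=> x Sx; rewrite /lift /= -adj_star; apply: (ssa_adj hS).
- by move=> x_ x; apply: sot_seq.
Qed.

Lemma nvna_vna S : nvna S -> S 1 -> vna S.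
Proof. by move=> [h0 hl hM hs hlim] S1; split. Qed.

Lemma lift_vna (S : set (op H)) : von_neumann_algebra S -> vna (lift S).
Proof. by move=> [hS S1]; apply: nvna_vna => //; apply: lift_nvna. Qed.

Lemma ptws_nbhs (x : op H) (l : seq H) r : 0 < r ->
  nbhs (x : {ptws H -> H}) [set y : {ptws H -> H} | forall u, u \in l -> nrm (y u - x u) < r].
Proof.
move=> r0; elim: l => [|u l IH]; first by apply: filterS filterT => y _ u.
have nb : nbhs (x u) [set v | nrm (v - x u) < r].
  have /cvgrPdist_lt/(_ (r%:C)) : v @[v --> x u] --> x u by [].
  rewrite ltcR => /(_ r0); apply: filterS => v /=.
  by rewrite distrC normE ltcR.
have h : nbhs (x : {ptws H -> H}) [set y : {ptws H -> H} | nrm (y u - x u) < r].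
  by have /pointwise_cvgP/(_ u)/(_ _ nb) : (nbhs (x : {ptws H -> H})) --> (x : {ptws H -> H}) by [].
have sub : ([set y : {ptws H -> H} | nrm (y u - x u) < r] `&`
   [set y : {ptws H -> H} | forall v : H, v \in l -> nrm (y v - x v) < r]) `<=`
   [set y : {ptws H -> H} | forall v : H, v \in u :: l -> nrm (y v - x v) < r].
  by move=> y [h1 h2] v; rewrite inE => /predU1P[->//|]; apply: h2.
exact: (filterS sub (filterI h IH)).
Qed.

Lemma closure_approx (S : set (op H)) (x : op H) : closure (S : set {ptws H -> H}) x ->
  forall (l : seq H) r, 0 < r -> exists2 y : op H, S y & forall u, u \in l -> nrm (y u - x u) < r.
Proof. by move=> h l r r0; have [y [Sy hy]] := h _ (ptws_nbhs x l r0); exists y. Qed.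

Lemma inner_sa x u : sa x -> inner H (x u) u = (rip (x u) u)%:C.
Proof.
move=> sx; have : inner H (x u) u = Num.conj (inner H (x u) u).
  by rewrite -innerC inner_star sx.
rewrite /rip; case: (inner H (x u) u) => a b [] /= /eqP.
by rewrite -subr_eq0 opprK -mulr2n mulrn_eq0 /= => /eqP ->.
Qed.

Lemma pos_op_le x y : pos (y - x) -> op_le x y.
Proof.
move=> [s h] u; have -> : ((y : op H) - x) u = (y - x) u by [].
by rewrite inner_sa // ler0c.
Qed.

Definition retr (tau : op H -> C) (x : bop H) : R := complex.Re (tau x).

Lemma trace_lift (M : set (op H)) (tau : op H -> C) : tracial_vN M tau ->
  trace (lift M) (retr tau).
Proof.
move=> [vM tM]; have hA := lift_vna vM.
have trpos x : lift M x -> pos x -> 0 <= tau x.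
  move=> Mx px; have [c [pc cc cA _]] := sqrt_ex px.
  have Mc : lift M c by apply: cA.
  by have := tr_positive tM Mc; rewrite adj_star -[X in tau X]/(bval (c^'* * c)) (pos_sa pc) cc.
have ReE (z : C) : 0 <= z -> z = (complex.Re z)%:C.
  by move=> z0; rewrite RRe_real // ger0_real.
split.
- split.
  + by move=> r x y Mx My; rewrite /retr [bval _]/(r%:C *: bval x + bval y) (tr_linear tM) // ReD ReZ.
  + by move=> x Mx px; apply: (le_Re (trpos _ Mx px)).
  + move=> e_ e pe le pe' Me he r h.
    have [e2 [pe2 he2 lee]] := inc_proj (fun n => (pe n).1) le.
    have ee : e2 = e by apply: sconv_unique he2 he.
    rewrite {}ee in lee.
    have lem m n : (m <= n)%N -> ple (e_ m) (e_ n).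
      move=> /subnK <-; elim: (n - m)%N => [|j IH]; first exact: ple_refl (pe m).1.
      by rewrite addSn; apply: ple_trans (le _).
    pose D := range (fun n => bval (e_ n)).
    have := @tr_normal _ _ _ _ tM D (bval e).
    have le_proj p q : isproj p -> isproj q -> ple p q -> op_le p q.
      by move=> pp pq lpq; apply/pos_op_le/proj_pos/ple_sub.
    move=> /(_ _ _ _ _ Me _ _ (r%:C)) tn.
    have : tau e <= r%:C; last by move/le_Re.
    apply: tn.
    * by move=> _ [n _ <-]; case: (pe n).
    * by exists (bval (e_ 0%N)), 0%N.
    * move=> _ [n _ <-]; apply: (@pos_op_le 0); rewrite subr0; exact/proj_pos/(pe n).1.
    * move=> _ _ [n _ <-] [m _ <-]; exists (bval (e_ (maxn n m))); split; first by exists (maxn n m).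
        by apply: le_proj; [exact: (pe n).1|exact: (pe _).1|apply/lem/leq_maxl].
      by apply: le_proj; [exact: (pe m).1|exact: (pe _).1|apply/lem/leq_maxr].
    * by move=> _ [n _ <-]; apply: le_proj => //; case: (pe n).
    * move=> z Mz hz; have bz : bounded_ops z by apply: (ssa_bounded vM.1.1).
      pose zb := mkbop bz; move=> u.
      have hz' n : 0 <= inner H ((zb - e_ n) u) u by apply: (hz (bval (e_ n))); exists n.
      have hu := sconvB (sconv_cst zb) he.
      have -> : inner H ((z - bval e) u) u = inner H ((zb - e) u) u by [].
      (* The Loewner order compares complex numbers and [zb] is not known to be self-adjoint, so the
         vanishing of the imaginary part and the sign of the real part are passed to the limit
         separately. *)
      rewrite lecE; apply/andP; split.
        rewrite /= -oppr_eq0 -rip_i; apply/eqP.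
        apply: (real_lim_eq (ucvg_ripR (w := u) (ucvgZ 'i%C (hu u)))
           (cvg_cst 0)) => n.
        by rewrite rip_i (ger0_Im (hz' n)) oppr0.
      apply: (ucvg_rip (hu u)); exists 0%N => n _; exact: (le_Re (hz' n)).
    * move=> _ [n _ <-]; have [pn Mn] := pe n.
      by rewrite (ReE _ (trpos _ Mn (proj_pos pn))) lecR; apply: h.
- by rewrite /retr bval1 (tr_one tM).
- by move=> x y Mx My; rewrite /retr !bvalM (tr_commute tM).
- move=> x Mx h; apply: val_inj; apply: (tr_faithful tM) => //.
  have := tr_positive tM Mx; rewrite adj_star -[X in tau X]/(bval (x^'* * x)) => /ReE ->.
  by rewrite -/(retr tau (x^'* * x)) h.
Qed.

End lift.

Lemma sum_le_const (R : numDomainType) (T : eqType) (l : seq T) (F : T -> R) (c : R) :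
  (forall u, u \in l -> F u <= c) -> \sum_(u <- l) F u <= (size l)%:R * c.
Proof.
elim: l => [|u l IH] h; first by rewrite big_nil mul0r.
rewrite big_cons -natr1 mulrDl mul1r addrC lerD ?h ?mem_head //.
by apply: IH => v vl; apply: h; rewrite inE vl orbT.
Qed.

Lemma vnaI (R : realType) (H : hilbertType R) (A A' : set (bop H)) : vna A -> vna A' -> vna (A `&` A').
Proof.
move=> h h'; split.
- by split; apply: vna1.
- by move=> c x y [? ?] [? ?]; split; apply: vna_lin.
- by move=> x y [? ?] [? ?]; split; apply: vnaM.
- by move=> x [? ?]; split; apply: vna_star.
- by move=> x_ x hx cx; split; apply: vna_lim cx => // n; case: (hx n).
Qed.

(** * Normality of trace-preserving homomorphisms *)

Section emb.
Context {R : realType} {H K : hilbertType R}.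
Local Notation C := R[i].
Implicit Types (A : set (bop H)) (B S : set (bop K)) (r k : R).

Record emb A (t : bop H -> R) B (tB : bop K -> R) (F : bop H -> bop K) : Prop := Emb {
  em_into : forall x, A x -> B (F x);
  em_lin : forall (c : C) x y, A x -> A y -> F (c *: x + y) = c *: F x + F y;
  em_mul : forall x y, A x -> A y -> F (x * y) = F x * F y;
  em_star : forall x, A x -> F (x^'*) = (F x)^'*;
  em_1 : F 1 = 1;
  em_tr : forall x, A x -> tB (F x) = t x
}.

Section emb_theory.
Variables (A : set (bop H)) (t : bop H -> R) (B : set (bop K)) (tB : bop K -> R).
Variables (F : bop H -> bop K) (hA : vna A) (hB : vna B).
Hypothesis hF : emb A t B tB F.

Lemma emD x y : A x -> A y -> F (x + y) = F x + F y.
Proof. by move=> Ax Ay; have := em_lin hF 1 Ax Ay; rewrite !scale1r. Qed.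
Lemma em0 : F 0 = 0.
Proof. by have := emD (vna0 hA) (vna0 hA); rewrite addr0 -{1}[F 0]addr0 => /addrI. Qed.
Lemma emZ (c : C) x : A x -> F (c *: x) = c *: F x.
Proof. by move=> Ax; have := em_lin hF c Ax (vna0 hA); rewrite em0 !addr0. Qed.
Lemma emN x : A x -> F (- x) = - F x.
Proof. by move=> Ax; have := emZ (-1) Ax; rewrite !scaleN1r. Qed.
Lemma emB x y : A x -> A y -> F (x - y) = F x - F y.
Proof. by move=> Ax Ay; rewrite emD ?emN //; exact: (vnaN hA). Qed.
Lemma em_sum (I : eqType) (l : seq I) (G : I -> bop H) :
  (forall i, i \in l -> A (G i)) -> F (\sum_(i <- l) G i) = \sum_(i <- l) F (G i).
Proof.
elim: l => [|i l IH] h; first by rewrite !big_nil em0.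
have h' j : j \in l -> A (G j) by move=> jl; apply: h; rewrite inE jl orbT.
rewrite !big_cons emD ?IH //; first by apply: h; rewrite mem_head.
by rewrite big_seq; apply: (vna_sum hA).
Qed.
Lemma em_proj p : A p -> isproj p -> isproj (F p).
Proof. by move=> Ap [sp pp]; split; rewrite /sa -?(em_star hF) ?sp // -(em_mul hF) // pp. Qed.
Lemma em_pos x : A x -> pos x -> pos (F x).
Proof.
move=> Ax px; have [c [pc cc cA _]] := sqrt_ex px.
have Ac : A c by apply: cA.
rewrite -cc (em_mul hF) // -{1}(pos_sa pc) (em_star hF) //; exact: pos_mulstar.
Qed.
Lemma em_ple p q : A p -> A q -> ple p q -> ple (F p) (F q).
Proof. by move=> Ap Aq h; rewrite /ple -(em_mul hF) // h. Qed.
Lemma em_mvn p q S : (forall x, A x -> S (F x)) -> mvn A p q -> mvn S (F p) (F q).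
Proof.
move=> AS [v [Av vp vq]]; have Avs := vna_star hA Av.
by exists (F v); split; [exact: AS|rewrite -(em_star hF) // -(em_mul hF) // vp
                         |rewrite -(em_star hF) // -(em_mul hF) // vq].
Qed.

End emb_theory.

(** The two-sided multipliers of [S]. They form a [vna] even if [S] has no unit; spectral
    projections are formed there and still carry [S] into itself. *)
Definition mult S := [set a | forall s, S s -> S (a * s) /\ S (s * a)].

Lemma mult_vna S : nvna S -> vna (mult S).
Proof.
move=> hS; split.
- by move=> s Ss; rewrite mul1r mulr1.
- move=> c x y hx hy s Ss; have [h1 h2] := hx s Ss; have [h3 h4] := hy s Ss.
  rewrite mulrDl mulrDr -bscaleAl -bscaleAr.
  by split; apply: (nv_lin hS).
- move=> x y hx hy s Ss; have [h1 h2] := hx s Ss; have [h3 h4] := hy s Ss.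
  split; first by rewrite -mulrA; apply: (hx _ h3).1.
  by rewrite mulrA; apply: (hy _ h2).2.
- move=> x hx s Ss; have [h1 h2] := hx _ (nv_star hS Ss).
  by split; rewrite -[s]starK -starM; apply: (nv_star hS).
- move=> x_ x hx cx s Ss; split.
    by apply: (nv_lim hS _ (sconvMr s cx)) => n; apply: (hx n s Ss).1.
  by apply: (nv_lim hS _ (sconvMl s cx)) => n; apply: (hx n s Ss).2.
Qed.

(** The approximants come without a common norm bound. They are close to [x] in 2-norm on a corner
    with small complement; [F] preserves this along with the trace. On the other side a projection
    that multiplies [S] truncates them, and bounded convergence in 2-norm is strong. *)
Lemma emb_normal A t B tB F S x : vna A -> trace A t -> vna B -> trace B tB ->
  emb A t B tB F -> nvna S -> A x ->
  (forall (l : seq H) r, 0 < r -> exists y, [/\ A y, S (F y) &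
     forall u, u \in l -> nrm ((y - x) u) < r]) -> S (F x).
Proof.
move=> hA ht hB htB hF hS.
wlog px : x / pos (1 - x^'* * x).
  move=> wl Ax h; have [k k0 pk] := pos_scale (sa_mulstar x).
  set j := Num.sqrt k; have j0 : 0 < j by rewrite sqrtr_gt0.
  have : S (F (j%:C *: x)).
    apply: wl.
    - rewrite starZr -bscaleAl -bscaleAr scalerA -rmorphM /= -expr2 sqr_sqrtr //.
      exact: ltW.
    - exact: (vnaZ hA).
    - move=> l r r0; have [y [Ay Sy hy]] := h l _ (divr_gt0 r0 j0).
      exists (j%:C *: y); split; first exact: (vnaZ hA).
        by rewrite (emZ hA hF) //; have := nv_lin hS j%:C Sy (nv0 hS); rewrite addr0.
      move=> u ul; rewrite -scalerBr bopZ nrmZr gtr0_norm // mulrC -ltr_pdivlMr //.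
      exact: hy.
  rewrite (emZ hA hF) // => Sj.
  have := nv_lin hS (j^-1)%:C Sj (nv0 hS).
  by rewrite addr0 scalerA -rmorphM /= mulVf ?gt_eqF // scale1r.
move=> Ax h; have BX := em_into hF Ax.
have pX : pos (1 - (F x)^'* * F x).
  have As := vna_star hA Ax.
  rewrite -(em_star hF) // -(em_mul hF) // -(em_1 hF) -(emB hA hF) //.
  - by apply: (em_pos hA hF) => //; vna_tac hA.
  - exact: (vna1 hA).
  - exact: (vnaM hA).
have step n : exists Y, [/\ B Y, S Y, forall u, nrm (Y u) <= 2 * nrm u
    & n2 tB (Y - F x) <= n.+1%:R^-1].
  pose r : R := (62 * n.+1%:R)^-1; have r0 : 0 < r by rewrite invr_gt0 mulr_gt0 // ltr0n.
  have [e [l [pe Ae he hl]]] := trace_vectors hA ht r0.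
  pose d := Num.sqrt (r / (size l).+1%:R).
  have d0 : 0 < d by rewrite sqrtr_gt0 divr_gt0 // ltr0n.
  have [y [Ay Sy hy]] := h l d d0.
  have hn : n2 t ((y - x) * e) <= r.
    apply: le_trans (hl _ (vnaB hA Ay Ax)) _.
    apply: le_trans (_ : (size l)%:R * (r / (size l).+1%:R) <= _).
      apply: sum_le_const => u ul.
      rewrite -[leRHS]sqr_sqrtr; last by rewrite divr_ge0 ?ltW // ltr0n.
      by rewrite ler_pXn2r ?nnegrE ?nrm_ge0 ?ltW // hy.
    rewrite mulrCA -[leRHS]mulr1; apply: (ler_wpM2l (ltW r0)).
    by rewrite ler_pdivrMr ?ltr0n // mul1r ler_nat.
  have tr2 z : A z -> n2 tB (F z) = n2 t z.
    move=> Az; have Azs := vna_star hA Az.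
    by rewrite /n2 -(em_star hF) // -(em_mul hF) // (em_tr hF) //; exact: (vnaM hA).
  have hS0 := vnaI (mult_vna hS) hB.
  have S0B : mult S `&` B `<=` B by move=> z [].
  have Sy0 : (mult S `&` B) (F y).
    by split; [move=> s Ss; split; apply: (nvM hS)|exact: (em_into hF)].
  have Be := em_into hF Ae.
  have [||g [pg [Sg Bg] pYg hg]] := truncate hB htB (y := F y) (x := F x) (e := F e) (r := r)
    hS0 S0B Sy0 BX Be (em_proj hF Ae pe) r0 pX.
  - by rewrite -(emB hA hF) // -(em_mul hF) ?tr2 //; vna_tac hA.
  - by rewrite -(em_1 hF) -(emB hA hF) ?(em_tr hF) //; vna_tac hA.
  exists (F y * g); split.
  - by apply: (vnaM hB) => //; exact: (em_into hF).
  - exact: (Sg _ Sy).2.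
  - move=> u; rewrite -(@ler_pXn2r _ 2) ?nnegrE ?mulr_ge0 ?nrm_ge0 // exprMn nrm_star.
    by have := pYg.2 u; rewrite bopB ripBl bopZ bop1 ripZl ripE; lra.
  - by apply: le_trans hg _; rewrite /r invfM mulrA divff // mul1r.
have [Y hY] := choice step.
apply: (nv_lim hS (x_ := Y)); first by move=> n; case: (hY n).
apply: (n2_sconv hB htB BX (k := 2)) => [n|n u|r r0]; try by case: (hY n).
have [N Nh] := ltr_add_invr r0; rewrite add0r in Nh; exists N => n Nn.
have [_ _ _ h1] := hY n; apply: le_lt_trans h1 _; apply: le_lt_trans Nh.
by rewrite lef_pV2 ?posrE ?ltr0n // ler_nat.
Qed.

End emb.

Section embedding.
Context {R : realType} {H K : hilbertType R}.
Variables (M : set (op H)) (tau : op H -> R[i]) (N : set (op K)) (tauN : op K -> R[i]).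
Variable (f : op H -> op K).
Hypotheses (hM : tracial_vN M tau) (hN : tracial_vN N tauN)
  (hf : trace_embedding M tau N tauN f).

(** Only the values of [f] on [M] are controlled; where [f x] is not bounded, the default 0 is
    taken. *)
Definition bmap (x : bop H) : bop K := insubd 0 (f x).

Lemma bmapE x : M (bval x) -> bval (bmap x) = f x.
Proof.
move=> Mx; rewrite [LHS]val_insubd ifT //.
by apply/asboolP/(ssa_bounded hN.1.1.1)/(te_into hf).
Qed.

Lemma bmap_emb : emb (lift M) (retr tau) (lift N) (retr tauN) bmap.
Proof.
have hA := lift_vna hM.1.
split.
- by move=> x Mx; rewrite /lift /= bmapE //; apply: (te_into hf).
- move=> c x y Mx My; apply: val_inj.
  rewrite [LHS]bmapE; last exact: (vna_lin hA).
  rewrite [LHS](te_linear hf) // -[RHS]/(c *: bval (bmap x) + bval (bmap y)).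
  by rewrite !bmapE.
- move=> x y Mx My; apply: val_inj.
  rewrite [LHS]bmapE; last exact: (vnaM hA).
  by rewrite [LHS](te_mul hf) // -!bmapE.
- move=> x Mx; apply: val_inj.
  rewrite [LHS]bmapE; last exact: (vna_star hA).
  by rewrite -adj_star (te_adj hf) // -bmapE // adj_star.
- by apply: val_inj; rewrite [LHS]bmapE ?bval1 ?(te_one hf) //; exact: hM.1.2.
- by move=> x Mx; rewrite /retr bmapE // (te_trace hf).
Qed.

(** The elements of [M] that [f] sends into [S] form a von Neumann subalgebra; its strong closedness
    is where [emb_normal] is used. *)
Lemma Wstar_emb (X : set (op H)) (S : set (op K)) : vn_subalgebra S -> X `<=` M ->
  (forall x, X x -> S (f x)) -> forall x, Wstar X x -> M x -> S (f x).
Proof.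
move=> hS XM XS x Wx.
pose T := [set x | M x /\ S (f x)].
have hA := lift_vna hM.1; have hB := lift_vna hN.1.
have hM1 := hM.1.1.1; have hS1 := hS.1.
suff hT : vn_subalgebra T.
  by have [] : T x by apply: Wx; split => // y Xy; split; [exact: XM|exact: XS].
split; first split.
- by move=> y [My _]; apply: (ssa_bounded hM1).
- split; first exact: (ssa_zero hM1).
  have -> : f 0 = 0.
    have M0 := ssa_zero hM1.
    have := te_linear hf 1 M0 M0; rewrite !scale1r addr0 => /eqP.
    by rewrite -subr_eq0 opprD addrA subrr add0r oppr_eq0 => /eqP.
  exact: (ssa_zero hS1).
- move=> c y z [My Sy] [Mz Sz]; split; first exact: (ssa_linear hM1).
  by rewrite (te_linear hf) //; apply: (ssa_linear hS1).
- move=> y z [My Sy] [Mz Sz]; split; first exact: (ssa_mul hM1).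
  by rewrite (te_mul hf) //; apply: (ssa_mul hS1).
- move=> y [My Sy]; split; first exact: (ssa_adj hM1).
  by rewrite (te_adj hf) //; apply: (ssa_adj hS1).
- move=> y yb cy; have TM : T `<=` M by move=> z [].
  have My : M y.
    by apply: hM.1.1.2 => // B /cy[z [[Mz _] Bz]]; exists z.
  split=> //; have -> : f y = bval (bmap (mkbop yb)) by rewrite bmapE.
  apply: (emb_normal (S := lift S) hA (trace_lift hM) hB (trace_lift hN) bmap_emb) => //.
    exact: lift_nvna.
  move=> l r r0; have [z [Mz Sz] hz] := closure_approx cy l r0.
  exists (mkbop (ssa_bounded hM1 Mz)); split=> //.
  by rewrite /lift /= bmapE.
Qed.

End embedding.

Lemma nat_below (R : realType) (x : R) : 0 <= x -> exists k : nat, k%:R <= x < k.+1%:R.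
Proof. by move=> x0; exists (Num.truncn x); apply: truncn_itv. Qed.

Lemma le0_inv (R : realType) (x c : R) : (forall n : nat, x <= c / n.+1%:R) -> x <= 0.
Proof.
move=> h; rewrite leNgt; apply/negP => x0.
have c0 : 0 < c by have := h 0%N; rewrite divr1; apply: lt_le_trans.
have [n nh] := ltr_add_invr (divr_gt0 x0 c0); rewrite add0r in nh.
move: nh; rewrite ltr_pdivlMr // mulrC => nh.
by have := lt_le_trans nh (h n); rewrite ltxx.
Qed.

(** * II_1 factors *)

Section factor.
Context {R : realType} {H : hilbertType R}.
Local Notation C := R[i].
Implicit Types (x y z p q a b c d e f g v w h : bop H) (u : H) (r s : R) (A S : set (bop H)).

Record II1 A (t : bop H -> R) : Prop := MkII1 {
  ii_vna : vna A;
  ii_tr : trace A t;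
  ii_fac : forall z, A z -> isproj z -> (forall x, A x -> z * x = x * z) -> z = 0 \/ z = 1;
  ii_diff : forall p, A p -> isproj p -> p <> 0 ->
     exists q, [/\ A q, isproj q, q <> 0, q <> p & ple q p]
}.

Lemma II1_lift (M : set (op H)) (tau : op H -> C) : II1_factor M tau ->
  II1 (lift M) (retr tau).
Proof.
move=> [[vM cM] dM tM]; have hA := lift_vna vM.
split=> //; first exact: (trace_lift (conj vM tM)).
- move=> z Mz pz zc.
  have : center M (bval z).
    split=> // y My; have yb := ssa_bounded vM.1.1 My.
    by have /(congr1 (@bval _ _)) := zc (mkbop yb) My.
  rewrite cM => -[a _ az].
  have {}az : z = a *: (1 : bop H) by apply: val_inj; rewrite -[LHS]az.
  have [a0|a0] := eqVneq (a * a - a) 0.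
    have /eqP : a * (a - 1) = 0 by rewrite mulrBr mulr1.
    rewrite mulf_eq0 subr_eq0 => /orP[]/eqP e; rewrite az e; first by left; rewrite scale0r.
    by right; rewrite scale1r.
  have : (a * a - a) *: (1 : bop H) = 0.
    by rewrite scalerBl -az -[z in LHS]pz.2 {1 2}az -bscaleAl -bscaleAr mul1r scalerA subrr.
  move=> /(congr1 (fun x => (a * a - a)^-1 *: x)); rewrite scalerA mulVf // scale1r scaler0.
  by move=> one0; left; rewrite -[z]mul1r one0 mul0r.
- move=> p Mp [sp pp] p0.
  have pb : is_proj (bval p).
    by split; [exact: bvalB|rewrite adj_star sp|rewrite -bvalM pp].
  have p0' : bval p <> 0 by move=> h; apply: p0; apply: val_inj.
  have [q [Mq [qb sq qq] q0 qp pq]] := dM _ Mp pb p0'.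
  pose q' := mkbop qb.
  have sq' : sa q' by apply: val_inj; rewrite -[RHS]sq -[LHS]adj_star.
  exists q'; split=> //.
  + by split=> //; apply: val_inj.
  + by move=> h; apply: q0; rewrite -[q]/(bval q') h.
  + by move=> h; apply: qp; rewrite -[q]/(bval q') h.
  + have h : p * q' = q' by apply: val_inj.
    by rewrite /ple; apply: star_inj; rewrite starM sp sq'.
Qed.

Section II1_theory.
Variables (A : set (bop H)) (t : bop H -> R) (hII : II1 A t).
Let hA := ii_vna hII.
Let ht := ii_tr hII.
Let nt := tr_nfun ht.

Lemma fac_mvn p q : A p -> A q -> isproj p -> isproj q -> t p = t q -> mvn A p q.
Proof.
move=> Ap Aq pp pq e; apply: (comparison hA ht) => // z Az pz cz.
by have [->|->] := ii_fac hII Az pz cz; rewrite ?mul0r // !mul1r.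
Qed.

(** Of a proper subprojection and its complement, one has at most half of the trace. *)
Lemma small_proj p r : A p -> isproj p -> p <> 0 -> 0 < r ->
  exists f, [/\ A f, isproj f, f <> 0, ple f p & t f <= r].
Proof.
move=> Ap pp p0 r0.
suff ind n : exists f, [/\ A f, isproj f, f <> 0, ple f p & t f <= 2^-1 ^+ n].
  have [m mh] := ltr_add_invr r0; rewrite add0r in mh.
  have [f [Af pf f0 lf tf]] := ind m; exists f; split=> //.
  apply: le_trans tf _; apply: le_trans (ltW mh).
  rewrite exprVn lef_pV2 ?posrE ?exprn_gt0 ?ltr0n //.
  by rewrite -natrX ler_nat ltn_expl.
elim: n => [|n [f [Af pf f0 lf tf]]].
  by exists p; split=> //; [exact: ple_refl|rewrite expr0; exact: (tr_le1 hA ht)].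
have [q [Aq pq q0 qf lq]] := ii_diff hII Af pf f0.
have fq := ple_sub pq pf lq; have lfq := ple_subl pq pf lq.
have Afq : A (f - q) by apply: (vnaB hA).
have e : t (f - q) = t f - t q by rewrite (nfB hA nt).
rewrite exprS; have [h|h] := leP (t q) (2^-1 * t f).
  exists q; split=> //; first by apply: ple_trans lq lf.
  by apply: le_trans h _; rewrite ler_pM2l ?invr_gt0.
exists (f - q); split=> //.
- by move=> fq0; apply: qf; rewrite -(subr0_eq' fq0).
- by apply: ple_trans lfq lf.
- rewrite e; move: h tf; move: (_ ^+ n) => K; lra.
Qed.

Lemma sub_trace p s : A p -> isproj p -> 0 <= s <= t p ->
  exists e, [/\ A e, isproj e, ple e p & t e = s].
Proof.
move=> Ap pp /andP[s0 sp].
pose F := [set e | [/\ isproj e, A e, ple e p & t e <= s]].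
have [|||e [[pe Ae le te] _ eM]] := max_proj hA ht (F := F) (e0 := 0).
- by move=> e [].
- by split; [exact: isproj0|exact: (vna0 hA)|rewrite /ple mul0r|rewrite (nf0 hA nt)].
- move=> e_ e Fe le pe Ae he; split=> //.
    apply: sconv_unique (sconvMr p he) _.
    by apply: sconv_ext he => n; case: (Fe n) => _ _ ->.
  by apply: (nf_norm nt (e_ := e_)) => // n; case: (Fe n).
exists e; split=> //; apply/eqP; rewrite eq_le te leNgt; apply/negP => lt.
have pd := ple_sub pe pp le; have ld := ple_subl pe pp le.
have Ad : A (p - e) by apply: (vnaB hA).
have d0 : p - e <> 0.
  by move=> h; move: sp; rewrite (subr0_eq' h) leNgt lt.
have [f [Af pf f0 lf tf]] := small_proj Ad pd d0 (ltac:(lra) : 0 < s - t e).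
have of1 : e * f = 0.
  by rewrite -(ple_r pf pd lf) mulrA mulrBr le pe.2 subrr mul0r.
apply: f0; suff : e + f = e by rewrite -[RHS]addr0 => /addrI.
apply: eM; last by rewrite /ple mulrDr pe.2 of1 addr0.
split; [exact: proj_add|exact: (vnaD hA)| |by rewrite (nfD nt) //; lra].
by rewrite /ple mulrDl le -{1}lf -mulrA ld lf.
Qed.

Lemma pieces k p s : A p -> isproj p -> 0 <= s -> t p = k%:R * s -> exists e : nat -> bop H,
  [/\ forall i, (i < k)%N -> [/\ A (e i), isproj (e i), ple (e i) p & t (e i) = s],
      forall i j, (i < k)%N -> (j < k)%N -> i != j -> e i * e j = 0
    & \sum_(i < k) e i = p].
Proof.
move=> + + s0; elim: k p => [|k IH] p Ap pp tp.
  exists (fun=> 0); split=> //; rewrite big_ord0.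
  by rewrite mul0r in tp; rewrite (tr_eq0 ht Ap pp tp).
have [|e0 [Ae pe le te]] := @sub_trace p s Ap pp.
  by rewrite s0 tp -[leLHS]mul1r ler_wpM2r // ler1n.
have pd := ple_sub pe pp le; have ld := ple_subl pe pp le.
have Ad : A (p - e0) by apply: (vnaB hA).
have [|e [h1 h2 h3]] := IH (p - e0) Ad pd.
  by rewrite (nfB hA nt) // tp te -natr1; ring.
have oe i : (i < k)%N -> e0 * e i = 0 /\ e i * e0 = 0.
  move=> ik; have [Ai pi li _] := h1 i ik.
  have o : e0 * e i = 0.
    by rewrite -(ple_r pi pd li) mulrA mulrBr le pe.2 subrr mul0r.
  by split=> //; apply: orth_sym o; [case: pe|case: pi].
exists (fun i => if i == k then e0 else e i); split.
- move=> i; rewrite ltnS leq_eqVlt; case: eqP => [->|] //= _ ik.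
  have [Ai pi li ti] := h1 i ik; split=> //; exact: ple_trans ld.
- move=> i j ik jk ij.
  have lk m : (m < k.+1)%N -> m != k -> (m < k)%N by rewrite ltnS ltn_neqAle => -> ->.
  have [ei|ni] := eqVneq i k; have [ej|nj] := eqVneq j k.
  + by move: ij; rewrite ei ej eqxx.
  + exact: (oe j (lk j jk nj)).1.
  + exact: (oe i (lk i ik ni)).2.
  + exact: h2 (lk i ik ni) (lk j jk nj) ij.
- rewrite big_ord_recr /= eqxx (eq_bigr (fun i : 'I_k => e i)).
    by rewrite h3 subrK.
  by move=> i _; rewrite ltn_eqF.
Qed.

(** Uniqueness of the trace from additivity and positivity. Cutting into n+1 equivalent pieces
    bounds [psi p] below by [psi 1 * t p], up to [psi 1] over n+1; the same bound for [1 - p] gives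
    the reverse inequality. *)
Lemma trace_additive (psi : bop H -> R) :
  (forall p q, A p -> A q -> isproj p -> isproj q -> mvn A p q -> psi p = psi q) ->
  (forall p q, A p -> A q -> isproj p -> isproj q -> p * q = 0 -> psi (p + q) = psi p + psi q) ->
  (forall p, A p -> isproj p -> 0 <= psi p) ->
  forall p, A p -> isproj p -> psi p = psi 1 * t p.
Proof.
move=> pm pa p0; have A1 := vna1 hA.
have psub p e : A p -> isproj p -> A e -> isproj e -> ple e p -> psi p = psi e + psi (p - e).
  move=> Ap pp Ae pe le; have [oo _] := ple_sub_orth pe pp le.
  have e1 : p = e + (p - e) by rewrite addrCA subrr addr0.
  by rewrite {1}e1 (pa e (p - e) Ae (vnaB hA Ap Ae) pe (ple_sub pe pp le) oo).
have psi1 := p0 1 A1 isproj1.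
have low n p : A p -> isproj p -> psi 1 * t p - psi 1 / n.+1%:R <= psi p.
  move=> Ap pp; pose s : R := n.+1%:R^-1.
  have s0 : 0 < s by rewrite invr_gt0 ltr0n.
  have s1 : n.+1%:R * s = 1 by rewrite /s mulfV // pnatr_eq0.
  have t1 : t 1 = 1 := tr1 ht.
  have [|e0 [Ae0 pe0 _ te0]] := @sub_trace 1 s A1 isproj1.
    by rewrite ltW //= t1 invf_le1 ?ltr0n // ler1n.
  have cst e : A e -> isproj e -> t e = s -> psi e = psi e0.
    by move=> Ae pe te; apply: pm => //; apply: fac_mvn => //; rewrite te te0.
  have eq k q : A q -> isproj q -> t q = k%:R * s -> psi q = k%:R * psi e0.
    elim: k q => [|k IH] q Aq pq tq.
      rewrite !mul0r in tq *; rewrite (tr_eq0 ht Aq pq tq).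
      have := pa 0 0 (vna0 hA) (vna0 hA) isproj0 isproj0 (mul0r _); rewrite addr0; lra.
    have [|e [Ae pe le te]] := @sub_trace q s Aq pq.
      by rewrite ltW //= tq -[leLHS]mul1r ler_wpM2r ?ler1n // ltW.
    rewrite (psub q e) // cst // (IH (q - e)); [|exact: (vnaB hA)|exact: ple_sub|].
      by rewrite -natr1; ring.
    by rewrite (nfB hA nt) // tq te -natr1; ring.
  have e1 : psi 1 = n.+1%:R * psi e0 by apply: eq => //; [exact: isproj1|rewrite s1 t1].
  have lo k q : A q -> isproj q -> k%:R * s <= t q -> k%:R * psi e0 <= psi q.
    elim: k q => [|k IH] q Aq pq tq; first by rewrite mul0r; exact: p0.
    have [|e [Ae pe le te]] := @sub_trace q s Aq pq.
      apply/andP; split; first exact: ltW.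
      apply: le_trans tq; rewrite -[leLHS]mul1r; apply: ler_wpM2r; first exact: ltW.
      by rewrite ler1n.
    rewrite (psub q e) // cst // -natr1 mulrDl mul1r addrC lerD2l.
    apply: IH; [exact: (vnaB hA)|exact: ple_sub|].
    by rewrite (nfB hA nt) // te; move: tq; rewrite -natr1 mulrDl mul1r; lra.
  have tp0 : 0 <= t p by apply: (nf_ge0 nt).
  have [k /andP[k1 k2]] := nat_below (mulr_ge0 (ler0n R n.+1) tp0).
  have k3 : k%:R * s <= t p.
    by rewrite /s ler_pdivrMr ?ltr0n // mulrC.
  have := lo k p Ap pp k3; apply: le_trans.
  have ep : psi e0 = psi 1 * s by rewrite e1 mulrAC s1 mul1r.
  have k4 : t p - s <= k%:R * s.
    rewrite -(ler_pM2l (ltr0Sn R n)) mulrBr mulrCA s1 mulr1.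
    by move: k2; rewrite -natr1; lra.
  rewrite ep -/s -mulrBr mulrCA; exact: ler_wpM2l.
have lowE p : A p -> isproj p -> psi 1 * t p <= psi p.
  move=> Ap pp; rewrite -subr_le0; apply: (@le0_inv _ _ (psi 1)) => n.
  by have := low n p Ap pp; move: (psi 1 / _) => c; lra.
move=> p Ap pp; apply/eqP; rewrite eq_le; apply/andP; split; last exact: lowE.
have AC : A (1 - p) by apply: (vnaB hA).
have := lowE _ AC (isprojC pp); rewrite (nfB hA nt) // (tr1 ht).
have := psub 1 p A1 isproj1 Ap pp (ple1 p); lra.
Qed.

End II1_theory.

Lemma trace_sub A B t : A `<=` B -> trace B t -> trace A t.
Proof.
move=> AB [[l p n] t1 tC tf]; split=> //.
- split.
  + by move=> r x y /AB Bx /AB By; apply: l.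
  + by move=> x /AB; apply: p.
  + by move=> e_ e pe le pe' /AB Be; apply: n => // m; have [? /AB] := pe m.
- by move=> x y /AB Bx /AB By; apply: tC.
- by move=> x /AB; apply: tf.
Qed.

Lemma trace_cs A t x y : vna A -> trace A t -> A x -> A y -> sa x -> sa y ->
  t (x * y) ^+ 2 <= t (x * x) * t (y * y).
Proof.
move=> hA ht Ax Ay sx sy; have nt := tr_nfun ht.
have Q r : 0 <= t (x * x) + 2 * r * t (x * y) + r ^+ 2 * t (y * y).
  have Az : A (x + r%:C *: y) by vna_tac hA.
  have := n2_ge0 hA ht Az; rewrite /n2 starD starZr sx sy.
  rewrite mulrDl !mulrDr -!bscaleAl -!bscaleAr !(nfD nt) ?(nfZ hA nt); try vna_tac hA.
  rewrite (trC ht Ay Ax); lra.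
have y0 : 0 <= t (y * y) by have := n2_ge0 hA ht Ay; rewrite /n2 sy.
have [e|e] := eqVneq (t (y * y)) 0.
  have : t (x * y) = 0.
    apply/eqP; apply/negP => /negP h.
    have := Q (- (t (x * x) + 1) / (2 * t (x * y))); rewrite e mulr0 addr0.
    have -> : 2 * (- (t (x * x) + 1) / (2 * t (x * y))) * t (x * y) = - (t (x * x) + 1).
      by field.
    lra.
  by move=> ->; rewrite e mulr0 expr0n.
have yp : 0 < t (y * y) by rewrite lt_neqAle eq_sym e.
have := Q (- t (x * y) / t (y * y)).
move=> /(mulr_ge0 (ltW yp)).
have -> : t (y * y) * (t (x * x) + 2 * (- t (x * y) / t (y * y)) * t (x * y) +
    (- t (x * y) / t (y * y)) ^+ 2 * t (y * y)) = t (x * x) * t (y * y) - t (x * y) ^+ 2.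
  by field.
lra.
Qed.

End factor.

(** * Freeness *)

Section freeness.
Context {R : realType} {H1 H2 K : hilbertType R}.
Local Notation C := R[i].
Variables (M : set (op H1)) (tau : op H1 -> C) (Q : set (op H2)) (phi : op H2 -> C)
  (N : set (op K)) (tauN : op K -> C) (f : op H1 -> op K) (g : op H2 -> op K).
Hypotheses (hM : II1_factor M tau) (hQ : tracial_vN Q phi) (hN : tracial_vN N tauN)
  (hf : trace_embedding M tau N tauN f) (hg : trace_embedding Q phi N tauN g)
  (hfree : free_pair tauN (fun b => if b then f @` M else g @` Q)).

Let A := lift M. Let D := lift Q. Let B := lift N.
Let t := retr tau. Let tB := retr tauN.
Let F := @bmap R H1 K f. Let G := @bmap R H2 K g.

Let hMt : tracial_vN M tau.
Proof. by case: hM => -[]. Qed.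
Let hA : vna A. Proof. exact: lift_vna hMt.1. Qed.
Let hD : vna D. Proof. exact: lift_vna hQ.1. Qed.
Let hB : vna B. Proof. exact: lift_vna hN.1. Qed.
Let hII : II1 A t. Proof. exact: II1_lift. Qed.
Let htB : trace B tB. Proof. exact: trace_lift. Qed.
Let hF : emb A t B tB F. Proof. exact: bmap_emb. Qed.
Let hG : emb D (retr phi) B tB G. Proof. exact: bmap_emb. Qed.
Let ntB := tr_nfun htB.

Let FE a : A a -> bval (F a) = f a.
Proof. exact: (bmapE hN hf). Qed.
Let GE d : D d -> bval (G d) = g d.
Proof. exact: (bmapE hN hg). Qed.

Let tc (x : bop K) : C := tauN x.

Let tcP (c : C) x y : B x -> B y -> tc (c *: x + y) = c * tc x + tc y.
Proof. by move=> Bx By; apply: (tr_linear hN.2). Qed.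
Let tc0 : tc 0 = 0.
Proof.
have B0 := vna0 hB; have := tcP 1 B0 B0; rewrite scale1r mul1r addr0 => /eqP.
by rewrite -subr_eq0 opprD addrA subrr add0r oppr_eq0 => /eqP.
Qed.
Let tcD x y : B x -> B y -> tc (x + y) = tc x + tc y.
Proof. by move=> Bx By; have := tcP 1 Bx By; rewrite scale1r mul1r. Qed.
Let tcZ (c : C) x : B x -> tc (c *: x) = c * tc x.
Proof. by move=> Bx; have := tcP c Bx (vna0 hB); rewrite tc0 !addr0. Qed.
Let tc1 : tc 1 = 1. Proof. exact: (tr_one hN.2). Qed.
Let tcC x y : B x -> B y -> tc (x * y) = tc (y * x).
Proof. by move=> Bx By; apply: (tr_commute hN.2). Qed.
Let tc_proj p : B p -> isproj p -> tc p = (tB p)%:C.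
Proof.
move=> Bp [sp pp]; rewrite [RHS]RRe_real // ger0_real //.
by have := tr_positive hN.2 Bp; rewrite adj_star -[X in tauN X]/(bval (p^'* * p)) sp pp.
Qed.

Lemma free2 a d : A a -> D d -> tc (F a) = 0 -> tc (G d) = 0 -> tc (F a * G d) = 0.
Proof.
move=> Aa Dd ta td.
have := @hfree 1%N (fun i => ~~ odd i) (nth (bval (F a)) [:: bval (F a); bval (G d)]).
rewrite !big_ord_recl big_ord0 /=; apply.
- move=> [|[|i]] //= _; split=> //.
    by exists (bval a) => //; rewrite FE.
  by exists (bval d) => //; rewrite GE.
- by move=> [|[|i]].
Qed.

Lemma free4 a d a' d' : A a -> D d -> A a' -> D d' -> tc (F a) = 0 -> tc (G d) = 0 ->
  tc (F a') = 0 -> tc (G d') = 0 -> tc (F a * (G d * (F a' * G d'))) = 0.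
Proof.
move=> Aa Dd Aa' Dd' ta td ta' td'.
have := @hfree 3%N (fun i => ~~ odd i)
  (nth (bval (F a)) [:: bval (F a); bval (G d); bval (F a'); bval (G d')]).
rewrite !big_ord_recl big_ord0 /=; apply.
- move=> [|[|[|[|i]]]] //= _; split=> //.
  + by exists (bval a) => //; rewrite FE.
  + by exists (bval d) => //; rewrite GE.
  + by exists (bval a') => //; rewrite FE.
  + by exists (bval d') => //; rewrite GE.
- by move=> [|[|[|[|i]]]].
Qed.

(** Expand with [F p] equal to [P0] plus the scalar [s], where [P0] is centred. The alternating
    product of four centred factors has trace 0 by freeness. The terms with a single [P0] have the
    trace of [P0 * (X * X)], which vanishes after splitting [X * X] into a scalar and a centred
    part. *)
Lemma free_corner p d (s : R) : A p -> isproj p -> t p = s -> D d -> tc (G d) = 0 ->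
  tB (F p * G d * (F p * G d)) = s ^+ 2 * tB (G d * G d).
Proof.
move=> Ap pp tp Dd td; set X := G d; set P := F p.
have BX : B X := em_into hG Dd; have BP : B P := em_into hF Ap.
have A1 := vna1 hA; have D1 := vna1 hD.
set P0 := F (p - s%:C *: (1 : bop H1)).
have P0E : P0 = P - s%:C *: (1 : bop K).
  by rewrite /P0 (emB hA hF) // ?(emZ hA hF) ?(em_1 hF) //; exact: (vnaZ hA).
have BP0 : B P0 by rewrite P0E; vna_tac hB.
have Ap0 : A (p - s%:C *: (1 : bop H1)) by vna_tac hA.
have t0 : tc P0 = 0.
  rewrite P0E -scaleNr addrC tcP //; last exact: (vna1 hB).
  rewrite tc1 mulr1 (tc_proj BP (em_proj hF Ap pp)) (em_tr hF) // tp.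
  by rewrite -rmorphN -rmorphD addNr.
have tPXX : tc (P0 * (X * X)) = 0.
  set k := tc (X * X).
  have e : X * X = k *: (1 : bop K) + G (d * d - k *: (1 : bop H2)).
    rewrite (emB hD hG) ?(emZ hD hG) ?(em_1 hG) ?(em_mul hG) //; try vna_tac hD.
    by rewrite addrCA subrr addr0.
  have BG : B (G (d * d - k *: (1 : bop H2))) by apply: (em_into hG); vna_tac hD.
  have tG : tc (G (d * d - k *: (1 : bop H2))) = 0.
    have : tc (X * X) = k by [].
    rewrite e tcP //; last exact: (vna1 hB).
    by rewrite tc1 mulr1 -[RHS]addr0 => /addrI.
  rewrite e mulrDr -bscaleAr mulr1 tcP //; last exact: (vnaM hB).
  rewrite t0 mulr0 add0r; apply: free2 => //.
  by vna_tac hD.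
have eP : P = P0 + s%:C *: (1 : bop K) by rewrite P0E subrK.
have e : P * X * (P * X) = P0 * (X * (P0 * X)) + s%:C *: (P0 * (X * X) + X * (P0 * X))
    + (s%:C * s%:C) *: (X * X).
  rewrite eP !(mulrDl, mulrDr) -!(bscaleAl, bscaleAr) !mul1r !scalerA scalerDr !mulrA.
  by rewrite -!addrA; congr (_ + _); rewrite addrCA; congr (_ + _); rewrite -?scalerAl ?mulrA.
rewrite /tB /retr -/(tc _) e.
have -> : tc (P0 * (X * (P0 * X)) + s%:C *: (P0 * (X * X) + X * (P0 * X)) +
   (s%:C * s%:C) *: (X * X)) = (s%:C * s%:C) * tc (X * X).
  rewrite !tcD ?tcZ ?tcD; try vna_tac hB.
  rewrite tPXX (free4 Ap0 Dd Ap0 Dd t0 td t0 td) (tcC BX); last by vna_tac hB.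
  by rewrite -mulrA tPXX !(addr0, mulr0, add0r).
by rewrite -rmorphM ReZ expr2.
Qed.

(* Averaging over [n] orthogonal projections of [M] makes the centred element [X] small in 2-norm. *)
Lemma free_commutant z q : B z -> sa z -> (forall x, A x -> z * F x = F x * z) ->
  D q -> isproj q -> tB (z * G q) = tB z * tB (G q).
Proof.
move=> Bz sz cz Dq pq.
have D1 := vna1 hD; have B1 := vna1 hB; have A1 := vna1 hA.
have Bq : B (G q) := em_into hG Dq.
set c := tB (G q).
have Dd : D (q - c%:C *: (1 : bop H2)) by vna_tac hD.
set X := G (q - c%:C *: (1 : bop H2)).
have XE : X = G q - c%:C *: (1 : bop K).
  by rewrite /X (emB hD hG) ?(emZ hD hG) ?(em_1 hG) //; vna_tac hD.
have BX : B X by rewrite XE; vna_tac hB.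
have sX : sa X by rewrite XE; apply: saB; [case: (em_proj hG Dq pq)|exact/saZ/sa1].
have tX : tc X = 0.
  rewrite XE -scaleNr addrC tcP // tc1 mulr1 (tc_proj Bq (em_proj hG Dq pq)).
  by rewrite -rmorphN -rmorphD addNr.
suff h : tB (z * X) = 0.
  have : tB (z * X) = tB (z * G q) - c * tB z.
    rewrite XE mulrBr -bscaleAr mulr1 (nfB hB ntB) ?(nfZ hB ntB) //; vna_tac hB.
  by rewrite h => /eqP; rewrite eq_sym subr_eq0 mulrC => /eqP.
apply/eqP; rewrite -sqrf_eq0 eq_le sqr_ge0 andbT.
apply: (@le0_inv _ _ (tB (z * z) * tB (X * X))) => n.
pose s : R := n.+1%:R^-1.
have s0 : 0 <= s by rewrite invr_ge0.
have s1 : n.+1%:R * s = 1 by rewrite /s mulfV // pnatr_eq0.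
have [|e [he oe se]] := pieces hII (k := n.+1) A1 isproj1 s0; first by rewrite s1 (tr1 (ii_tr hII)).
have Ae i : (i < n.+1)%N -> A (e i) by case/he.
have Be (i : 'I_n.+1) : B (F (e i)) by apply: (em_into hF); apply: Ae.
have pe (i : 'I_n.+1) : isproj (F (e i)) by apply: (em_proj hF); case: (he i (ltn_ord i)).
have seF : \sum_(i < n.+1) F (e i) = 1.
  by rewrite -(em_1 hF) -se (em_sum hA hF) // => i _; apply: Ae.
have oF (i j : 'I_n.+1) : i != j -> F (e i) * F (e j) = 0.
  by move=> ij; rewrite -(em_mul hF) ?oe ?(em0 hA hF) //; apply: Ae.
set W := \sum_(i < n.+1) F (e i) * X * F (e i).
have BW : B W by apply: (vna_sum hB) => i _; have := Be i => ?; vna_tac hB.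
have sW : sa W.
  rewrite /sa star_sum; apply: eq_bigr => i _.
  by rewrite !starM (pe i).1 sX mulrA.
have tW : tB (W * W) = s * tB (X * X).
  have -> : W * W = \sum_(i < n.+1) F (e i) * X * F (e i) * X * F (e i).
    rewrite /W mulr_suml; apply: eq_bigr => i _; rewrite mulr_sumr (bigD1 i) //= big1 ?addr0.
      by rewrite !mulrA -(mulrA _ (F (e i)) (F (e i))) (pe i).2.
    move=> j ji; rewrite !mulrA -(mulrA _ (F (e i)) (F (e j))) oF 1?eq_sym //.
    by rewrite mulr0 !mul0r.
  rewrite (nf_sum hB ntB); last by move=> i _; have := Be i => ?; vna_tac hB.
  rewrite (eq_bigr (fun=> s ^+ 2 * tB (X * X))).
    by rewrite sumr_const card_ord -mulr_natl expr2 !mulrA s1 mul1r.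
  move=> i _; have Bi := Be i.
  rewrite (trC htB) //; last by vna_tac hB.
  rewrite !mulrA (pe i).2 -!mulrA mulrA.
  have [Ai pi _ ti] := he i (ltn_ord i).
  by rewrite [RHS]mulrA -expr2; apply: free_corner.
(* Since [z] commutes with each [F (e i)], compressing [X] to its diagonal blocks does not change
   the pairing with [z]; Cauchy-Schwarz then bounds it by the small 2-norm of [W]. *)
have -> : tB (z * X) = tB (z * W).
  rewrite -{1}[X]mul1r -seF mulr_suml mulr_sumr /W mulr_sumr !(nf_sum hB ntB).
  - apply: eq_bigr => i _; have Bi := Be i.
    have e1 : z * (F (e i) * X) = F (e i) * (z * (F (e i) * X)).
      by rewrite [RHS]mulrA -cz; [rewrite -[RHS]mulrA (mulrA (F (e i))) (pe i).2|apply: Ae].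
    by rewrite e1 (trC htB) ?mulrA //; vna_tac hB.
  - by move=> i _; have := Be i => ?; vna_tac hB.
  - by move=> i _; have := Be i => ?; vna_tac hB.
apply: le_trans (trace_cs hB htB Bz BW sz sW) _.
by rewrite tW mulrCA mulrC.
Qed.

End freeness.

(** * Generation by elements of small corners *)

Section reach.
Context {R : realType} {H1 H2 K : hilbertType R}.
Variables (A : set (bop H1)) (t : bop H1 -> R) (D : set (bop H2)) (tD : bop H2 -> R)
  (B : set (bop K)) (tB : bop K -> R) (F : bop H1 -> bop K) (G : bop H2 -> bop K).
Hypotheses (hII : II1 A t) (hD : vna D) (htD : trace D tD) (hB : vna B) (htB : trace B tB)
  (hF : emb A t B tB F) (hG : emb D tD B tB G).
Hypothesis hfree : forall z q, B z -> sa z -> (forall x, A x -> z * F x = F x * z) ->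
  D q -> isproj q -> tB (z * G q) = tB z * tB (G q).
Let hA := ii_vna hII.
Let ht := ii_tr hII.
Let nt := tr_nfun ht.
Let ntB := tr_nfun htB.
Implicit Types (Y Z S : set (bop K)) (c s r : R).

Definition over Y S := [/\ vna S, S `<=` B, forall a, A a -> S (F a) & Y `<=` S].

Definition gen Y : set (bop K) := [set x | forall S, over Y S -> S x].

Lemma gen_over Y : Y `<=` B -> over Y (gen Y).
Proof.
move=> YB; split.
- split.
  + by move=> S [hS _ _ _]; apply: vna1.
  + by move=> c x y hx hy S oS; have [hS _ _ _] := oS; apply: vna_lin => //; [exact: hx|exact: hy].
  + by move=> x y hx hy S oS; have [hS _ _ _] := oS; apply: vnaM => //; [exact: hx|exact: hy].
  + by move=> x hx S oS; have [hS _ _ _] := oS; apply: vna_star => //; exact: hx.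
  + move=> x_ x hx cx S oS; have [hS _ _ _] := oS; apply: (vna_lim hS _ cx) => n; exact: hx.
- by move=> x; apply; split=> //; move=> a; exact: (em_into hF).
- by move=> a Aa S [_ _ h _]; apply: h.
- by move=> x Yx S [_ _ _ h]; apply: h.
Qed.

Lemma gen_min Y S : over Y S -> gen Y `<=` S.
Proof. by move=> oS x; apply. Qed.

Lemma over_trace Y S : over Y S -> trace S tB.
Proof. by move=> [_ SB _ _]; apply: trace_sub htB. Qed.

(** A central projection [z] of [S] commutes with the image of [A]. So [hfree] computes the trace of
    [z * G q], and uniqueness of the trace of [A] computes that of [z * F p]; both are the trace of
    [z] times the common trace, as [comparison] in [S] requires. *)
Lemma eqv Y S p q : over Y S -> A p -> isproj p -> D q -> isproj q -> S (G q) -> t p = tD q ->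
  mvn S (F p) (G q).
Proof.
move=> oS Ap pp Dq pq Sq e; have [hS SB MS _] := oS; have htS := over_trace oS.
have nS := tr_nfun htS.
apply: (comparison hS htS) => //; [exact: MS|exact: (em_proj hF)|exact: (em_proj hG)|].
move=> z Sz pz cz; have czF a : A a -> z * F a = F a * z by move=> Aa; apply/cz/MS.
rewrite (hfree (SB _ Sz) pz.1) // (em_tr hG) // -e.
have -> : tB z = tB (z * F 1) by rewrite (em_1 hF) mulr1.
apply: (trace_additive hII (psi := fun p => tB (z * F p))) => //.
- move=> p1 p2 _ _ _ _ h; apply: (mvn_trz hS htS) => //.
  exact: (em_mvn hA hF MS h).
- move=> p1 p2 A1 A2 _ _ _; rewrite (emD hF) // mulrDr (nfD nS) //;
    apply: (vnaM hS) => //; exact: MS.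
- move=> p1 A1 pp1; apply: (nf_pos nS); first by apply: (vnaM hS) => //; exact: MS.
  apply: pos_comm_mul; [exact: proj_pos|apply: proj_pos; exact: (em_proj hF)|exact: czF].
Qed.

(* [Reach Y Z c]: over [M] and [Y], the set [Z] is generated by finitely many elements
   of [e N e], where [e] in [M] is any small projection, of total area [c]. *)
Definition Reach Y Z c := forall eps, 0 < eps -> exists2 del, 0 < del &
  forall e, A e -> isproj e -> 0 < t e < del -> exists L : seq (bop K),
  [/\ forall y, y \in L -> [/\ B y, F e * y = y & y * F e = y],
      (size L)%:R * t e ^+ 2 <= c + eps
    & forall S, over Y S -> (forall y, y \in L -> S y) -> Z `<=` S].

Lemma reach_refl Y Z c : 0 <= c -> (forall S, over Y S -> Z `<=` S) -> Reach Y Z c.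
Proof.
move=> c0 h eps e0; exists 1 => // e Ae pe te; exists [::]; split=> //.
  by rewrite mul0r addr_ge0 // ltW.
by move=> S oS _; apply: h.
Qed.

Lemma reach_alg Y Z Z' c : Reach Y Z c -> (forall S, over Y S -> Z `<=` S -> Z' `<=` S) ->
  Reach Y Z' c.
Proof.
move=> h h' eps e0; have [d d0 hd] := h eps e0; exists d => // e Ae pe te.
have [L [h1 h2 h3]] := hd e Ae pe te; exists L; split=> // S oS LS.
by apply: h' => //; apply: h3.
Qed.

Lemma reach_mono Y Y' Z c : Y `<=` Y' -> Reach Y Z c -> Reach Y' Z c.
Proof.
move=> YY h eps e0; have [d d0 hd] := h eps e0; exists d => // e Ae pe te.
have [L [h1 h2 h3]] := hd e Ae pe te; exists L; split=> // S [hS SB MS YS] LS.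
by apply: h3 => //; split=> //; apply: subset_trans YY YS.
Qed.

Lemma reach_lim Y Z c : (forall r, 0 < r -> Reach Y Z (c + r)) -> Reach Y Z c.
Proof.
move=> h eps e0; have e2 : 0 < eps / 2 by rewrite divr_gt0.
have [d d0 hd] := h _ e2 _ e2; exists d => // e Ae pe te.
by have [L [h1 h2 h3]] := hd e Ae pe te; exists L; split=> //; lra.
Qed.

Lemma reach_add Y Z Z' c c' : Reach Y Z c -> Reach (Y `|` Z) Z' c' ->
  Reach Y (Z `|` Z') (c + c').
Proof.
move=> h h' eps e0; have e2 : 0 < eps / 2 by rewrite divr_gt0.
have [d d0 hd] := h _ e2; have [d' d'0 hd'] := h' _ e2.
exists (Num.min d d'); first by rewrite lt_min d0.
move=> e Ae pe /andP[te]; rewrite lt_min => /andP[td td'].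
have [|L [h1 h2 h3]] := hd e Ae pe; first by rewrite te.
have [|L' [h1' h2' h3']] := hd' e Ae pe; first by rewrite te.
exists (L ++ L'); split.
- by move=> y; rewrite mem_cat => /orP[/h1|/h1'].
- by rewrite size_cat natrD mulrDl; lra.
- move=> S oS LS; have [hS SB MS YS] := oS.
  have ZS : Z `<=` S by apply: h3 => // y yL; apply: LS; rewrite mem_cat yL.
  move=> z [/ZS//|]; apply: h3'; last by move=> y yL; apply: LS; rewrite mem_cat yL orbT.
  by split=> // y [/YS|/ZS].
Qed.

Lemma reach_trans Y Z Z' c c' : Reach Y Z c -> Reach (Y `|` Z) Z' c' -> Reach Y Z' (c + c').
Proof. by move=> h h'; apply: reach_alg (reach_add h h') _ => S _ h1 z z'; apply: h1; right. Qed.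

(** [p] is cut into as many pieces of trace [t e] as fit and a smaller remainder, and each piece is
    moved below [e]. The remainder accounts for the extra [t e] in the bound. *)
Lemma cover p e : A p -> isproj p -> A e -> isproj e -> 0 < t e -> exists (k : nat) (v : nat -> bop H1),
  [/\ forall i, (i < k)%N -> A (v i) /\ e * v i = v i, \sum_(i < k) (v i)^'* * v i = p
    & k%:R * t e <= t p + t e].
Proof.
move=> Ap pp Ae pe te.
have tp0 : 0 <= t p by apply: (nf_ge0 nt).
have [k /andP[k1 k2]] := nat_below (divr_ge0 tp0 (ltW te)).
rewrite ler_pdivlMr // in k1; rewrite ltr_pdivrMr // in k2.
have [|p1 [Ap1 pp1 lp1 tp1]] := sub_trace hII (s := k%:R * t e) Ap pp.
  by rewrite k1 mulr_ge0 // ltW.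
have [e_ [h1 h2 h3]] := pieces hII Ap1 pp1 (ltW te) tp1.
have pd := ple_sub pp1 pp lp1; have Ad : A (p - p1) by apply: (vnaB hA).
have td : t (p - p1) = t p - k%:R * t e by rewrite (nfB hA nt) // tp1.
have [|e' [Ae' pe' le' te']] := sub_trace hII (s := t (p - p1)) Ae pe.
  by rewrite (nf_ge0 nt) //= td; move: k2; rewrite -natr1 mulrDl mul1r; lra.
have [w [Aw w1 w2]] : mvn A (p - p1) e' by apply: (fac_mvn hII).
have ex i : exists v, (i < k)%N -> [/\ A v, v^'* * v = e_ i & v * v^'* = e].
  have [ik|ik] := boolP (i < k)%N; last by exists 0.
  have [Ai pi _ ti] := h1 i ik.
  by have [v hv] := fac_mvn hII Ai Ae pi pe ti; exists v.
have [v hv] := choice ex.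
exists k.+1, (fun i => if i == k then w else v i); split.
- move=> i; rewrite ltnS leq_eqVlt; have [->|ik] := eqVneq i k => /= [_|ik'].
    by split=> //; rewrite -(pi_l pe' w2) mulrA (ple_r pe' pe le').
  by have [Av _ v2] := hv i ik'; split=> //; apply: pi_l.
- rewrite big_ord_recr /= eqxx w1 (eq_bigr (fun i : 'I_k => e_ i)).
    by rewrite h3 addrCA subrr addr0.
  by move=> i _; rewrite ltn_eqF //; have [_ ->] := hv i (ltn_ord i).
- by rewrite -natr1 mulrDl mul1r; lra.
Qed.

Lemma cover_over Y S p q e : over Y S -> A p -> isproj p -> isproj q -> mvn S (F p) q ->
  A e -> isproj e -> 0 < t e -> exists (k : nat) (v : nat -> bop K),
  [/\ forall i, (i < k)%N -> S (v i) /\ F e * v i = v i, \sum_(i < k) (v i)^'* * v i = q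
    & k%:R * t e <= t p + t e].
Proof.
move=> [hS SB MS _] Ap pp pq [w [Sw w1 w2]] Ae pe te.
have [k [v [h1 h2 h3]]] := cover Ap pp Ae pe te.
exists k, (fun i => F (v i) * w^'*); split=> //.
- move=> i /h1[Av ev]; split; first by apply: (vnaM hS); [exact: MS|exact: (vna_star hS)].
  by rewrite mulrA -(em_mul hF) // ev.
- have Fp : isproj (F p) by exact: (em_proj hF).
  have qE : q = w * F p * w^'* by rewrite (pi_r Fp w1) w2.
  rewrite qE -h2 (em_sum hA hF); last first.
    move=> i _; have [Av _] := h1 i (ltn_ord i).
    by apply: (vnaM hA) => //; apply: (vna_star hA).
  rewrite !(mulr_suml, mulr_sumr); apply: eq_bigr => i _.
  have [Av _] := h1 i (ltn_ord i).
  rewrite (em_mul hF) ?(em_star hF) //; last exact: (vna_star hA).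
  by rewrite starM starK !mulrA.
Qed.

Lemma cell Y p p' q q' y : Y `<=` B -> A p -> isproj p -> A p' -> isproj p' ->
  isproj q -> isproj q' -> mvn (gen Y) (F p) q -> mvn (gen Y) (F p') q' ->
  B y -> q * y = y -> y * q' = y -> Reach Y [set y] (t p * t p').
Proof.
move=> YB Ap pp Ap' pp' pq pq' h h' By qy yq eps e0.
(* Each cover overshoots by at most x = [t e], and (a + x)(b + x) <= a b + 3 x for a, b, x between 0
   and 1. *)
exists (Num.min 1 (eps / 3)); first by rewrite lt_min ltr01 divr_gt0.
move=> e Ae pe /andP[te]; rewrite lt_min => /andP[te1 te3].
have oG := gen_over YB; have [_ GB _ _] := oG.
have [k [v [v1 v2 v3]]] := cover_over oG Ap pp pq h Ae pe te.
have [k' [v' [v1' v2' v3']]] := cover_over oG Ap' pp' pq' h' Ae pe te.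
exists [seq v i * y * (v' j)^'* | i <- iota 0 k, j <- iota 0 k']; split.
- move=> z /allpairsP[[i j] /= [+ + ->]]; rewrite !mem_iota !add0n => /v1[Gi ei] /v1'[Gj ej].
  have Bi := GB _ Gi; have Bj := GB _ Gj; split.
  + by vna_tac hB.
  + by rewrite !mulrA ei.
  + rewrite -mulrA; congr (_ * _); apply: star_inj.
    by rewrite starM starK (em_proj hF Ae pe).1.
- rewrite size_allpairs !size_iota natrM.
  have -> : k%:R * k'%:R * t e ^+ 2 = (k%:R * t e) * (k'%:R * t e) by ring.
  apply: le_trans (ler_pM _ _ v3 v3') _; try by rewrite mulr_ge0 // ltW.
  have := tr_le1 hA ht Ap pp; have := tr_le1 hA ht Ap' pp'.
  have := nf_ge0 nt Ap pp; have := nf_ge0 nt Ap' pp'.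
  move: (t p) (t p') (t e) te te1 te3 => a b d *; nra.
- move=> S oS LS _ ->; have [hS SB MS YS] := oS.
  have GS := gen_min oS.
  have -> : y = \sum_(i < k) \sum_(j < k') (v i)^'* * (v i * y * (v' j)^'*) * v' j.
    rewrite -[LHS]qy -{1}yq -v2 -v2' !mulr_suml; apply: eq_bigr => i _.
    by rewrite !mulr_sumr; apply: eq_bigr => j _; rewrite !mulrA.
  apply: (vna_sum hS) => i _; apply: (vna_sum hS) => j _.
  have [/GS Si _] := v1 i (ltn_ord i); have [/GS Sj _] := v1' j (ltn_ord j).
  have : S (v i * y * (v' j)^'*).
    apply: LS; apply/allpairsP; exists (nat_of_ord i, nat_of_ord j).
    by rewrite /= !mem_iota !add0n !ltn_ord.
  move=> Sij; apply: (vnaM hS) => //; apply: (vnaM hS) => //; exact: (vna_star hS).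
Qed.

(* Only the off-diagonal corner [g y] of [y] has to be paid for. *)
Lemma reach_rot Y p p' q g y : Y `<=` B -> A p -> isproj p -> A p' -> isproj p' ->
  isproj q -> isproj g -> q * g = 0 -> mvn (gen Y) (F p) q -> mvn (gen Y) (F p') g ->
  B y -> (q + g) * y = y -> y^'* * y = q -> pos (q * y) -> Reach Y [set y] (t p * t p').
Proof.
move=> YB Ap pp Ap' pp' pq pg og h h' By qgy yy pc.
have oG := gen_over YB; have [hG' GB _ _] := oG.
have Gq : gen Y q by have [w [Gw _ <-]] := h; apply: (vnaM hG') => //; apply: (vna_star hG').
have Gg : gen Y g by have [w [Gw _ <-]] := h'; apply: (vnaM hG') => //; apply: (vna_star hG').
have hx : Reach Y [set g * y] (t p' * t p).
  apply: (cell YB Ap' pp' Ap pp pg pq h' h).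
  - by apply: (vnaM hB) => //; apply: GB.
  - by rewrite mulrA pg.2.
  - by rewrite -mulrA (pi_r pq yy).
rewrite mulrC; apply: reach_alg hx _ => S oS xS _ ->; have [hS SB MS YS] := oS.
apply: (recover hS pq qgy pg og yy pc); last by apply: xS.
exact: (gen_min oS).
Qed.

(** [M] and [G q] already generate a projection [r] below [G q] with the trace of [q']. A partial
    isometry from [r] onto [G q'], corrected so that its [r] corner is positive, is paid for only in
    the corner from [r] to [G q - r], and its range projection is [G q']. *)
Lemma reach_split q q' : D q -> D q' -> isproj q -> isproj q' -> ple q' q ->
  Reach [set G q] [set G q'] (tD q' * tD (q - q')).
Proof.
move=> Dq Dq' pq pq' le; have ntD := tr_nfun htD.
have tq : tD (q - q') = tD q - tD q' by rewrite (nfB hD ntD).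
have [|p [Ap pp _ tp]] := sub_trace hII (s := tD q) (vna1 hA) isproj1.
  by rewrite (nf_ge0 ntD) //= (tr1 ht) (tr_le1 hD htD).
have [|p' [Ap' pp' lp tp']] := sub_trace hII (s := tD q') Ap pp.
  by rewrite (nf_ge0 ntD) //= tp (nf_ple hD ntD).
have YB : [set G q] `<=` B by move=> _ ->; exact: (em_into hG).
set Y := [set G q] in YB *; have oG := gen_over YB; have [hgen GB MG YG] := oG.
have Fp := em_proj hF Ap pp; have Fp' := em_proj hF Ap' pp'.
have Gq := em_proj hG Dq pq; have Gq' := em_proj hG Dq' pq'.
have m1 : mvn (gen Y) (F p) (G q) by apply: (eqv oG) => //; apply: YG.
have [r [pr gr lr m2 m3]] :=
  mvn_sub hgen Fp Gq Fp' (MG _ Ap') (em_ple hF Ap' Ap lp) m1.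
have m4 : mvn B r (G q').
  apply: (mvn_trans hB pr Fp').
    by apply: mvn_sym => //; apply: mvn_mono m2.
  by apply: (@eqv set0) => //; [split=> // a; exact: (em_into hF)|exact: (em_into hG)].
have [y0 [By0 y01 y02]] := m4.
have [y [w [Bw yE w1 w2 [By y1 y2 pc]]]] := pos_corner hB htB pr Gq' By0 y01 y02.
have [oo1 _] := ple_sub_orth pr Gq lr.
have pg := ple_sub pr Gq lr.
have tpp : t (p - p') = tD (q - q') by rewrite (nfB hA nt) // tp tp' tq.
have hy : Reach Y [set y] (t p' * t (p - p')).
  apply: (reach_rot YB Ap' pp' (vnaB hA Ap Ap') (ple_sub pp' pp lp) pr pg oo1 m2) => //.
  - by rewrite (emB hA hF) //; apply: m3; apply: MG.
  - rewrite addrCA subrr addr0 -(pi_l Gq' y2) mulrA.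
    by rewrite (ple_r Gq' Gq (em_ple hG Dq' Dq le)).
rewrite tp' tpp in hy; apply: reach_alg hy _ => S [hS _ _ _] yS _ ->.
by rewrite -y2; have Sy := yS y erefl; apply: (vnaM hS) => //; apply: (vna_star hS).
Qed.

(* Peel off a piece of trace [s]; the remainder is a unitary of a smaller corner. *)
Lemma reach_unitary_nat k : forall Y p q u s, 0 <= s -> Y `<=` B -> A p -> isproj p ->
  t p = k%:R * s -> isproj q -> mvn (gen Y) (F p) q -> B u -> u^'* * u = q -> u * u^'* = q ->
  Reach Y [set u] (s ^+ 2 * (k%:R * k.+1%:R / 2)).
Proof.
elim: k => [|k IH] Y p q u s s0 YB Ap pp tp pq h Bu u1 u2.
  have p0 : p = 0 by apply: (tr_eq0 ht) => //; rewrite tp mul0r.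
  have q0 : q = 0.
    have [w [_ w1 <-]] := h; move: w1; rewrite p0 (em0 hA hF) => /star_mul0 ->.
    by rewrite mul0r.
  have uz : u = 0 by apply: star_mul0; rewrite u1.
  apply: reach_refl; first by rewrite !mul0r mulr0.
  by move=> S [hS _ _ _] _ ->; rewrite uz; exact: (vna0 hS).
have oG := gen_over YB; have [hgen GB MG YG] := oG.
have [|e0 [Ae pe le te]] := sub_trace hII (s := s) Ap pp.
  by rewrite s0 tp -[leLHS]mul1r ler_wpM2r // ler1n.
have Fp := em_proj hF Ap pp; have Fe := em_proj hF Ae pe.
have [q1 [pq1 gq1 lq1 m2 m3]] := mvn_sub hgen Fp pq Fe (MG _ Ae) (em_ple hF Ae Ap le) h.
have {}m3 : mvn (gen Y) (F (p - e0)) (q - q1) by rewrite (emB hA hF) //; apply: m3; apply: MG.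
have Bq1 := GB _ gq1; have gq : gen Y q.
  by have [w [Gw _ <-]] := h; apply: (vnaM hgen) => //; apply: (vna_star hgen).
have pd := ple_sub pe pp le; have Ad : A (p - e0) by apply: (vnaB hA).
have td : t (p - e0) = k%:R * s by rewrite (nfB hA nt) // tp te -natr1; ring.
have uq : u * q = u := pi_r pq u1.
have qu : q * u = u := pi_l pq u2.
have Us : u^'* * u = q := u1.
(* The piece [x1] of [u] will be written [y * w^'*]: the rotated [y] costs [t e0 * t (p - e0)] and
   the unitary [w] of the corner of [q1] costs [t e0 * t e0]. *)
pose x1 := u * q1; pose r1 := x1 * x1^'*.
have x11 : x1^'* * x1 = q1.
  by rewrite /x1 starM pq1.1 -mulrA (mulrA (u^'*)) u1 (ple_r pq1 pq lq1) pq1.2.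
have pr1 : isproj r1 := pi_star pq1 x11.
have Bx1 : B x1 by apply: (vnaM hB).
have [y [w [Bw yE w1 w2 [By y1 y2 pc]]]] := pos_corner hB htB pq1 pr1 Bx1 x11 erefl.
have [og _] := ple_sub_orth pq1 pq lq1; have pg := ple_sub pq1 pq lq1.
have hy : Reach Y [set y] (t e0 * t (p - e0)).
  apply: (reach_rot YB Ae pe Ad pd pq1 pg og m2 m3 By) => //.
  by rewrite addrCA subrr addr0 yE /x1 !mulrA qu.
set Y1 := Y `|` [set y].
have Y1B : Y1 `<=` B by move=> z [/YB//|->].
have oG1 := gen_over Y1B; have [hgen1 GB1 MG1 YG1] := oG1.
have G01 : gen Y `<=` gen Y1.
  by apply: gen_min; split=> // z Yz; apply: YG1; left.
have hw : Reach Y1 [set w] (t e0 * t e0).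
  apply: (cell Y1B Ae pe Ae pe pq1 pq1) => //; try exact: mvn_mono m2.
  - exact: pi_l w2.
  - exact: pi_r w1.
set Y2 := Y1 `|` [set w].
have Y2B : Y2 `<=` B by move=> z [/Y1B//|->].
have oG2 := gen_over Y2B; have [hgen2 GB2 MG2 YG2] := oG2.
have G02 : gen Y `<=` gen Y2.
  by apply: gen_min; split=> // z Yz; apply: YG2; left; left.
have x1E : x1 = y * w^'*.
  by rewrite yE -mulrA w2 /x1 -mulrA pq1.2.
have gx1 : gen Y2 x1.
  rewrite x1E; apply: (vnaM hgen2); first by apply: YG2; left; right.
  by apply: (vna_star hgen2); apply: YG2; right.
have gr1 : gen Y2 r1 by apply: (vnaM hgen2) => //; apply: (vna_star hgen2).
have lr1 : ple r1 q.
  rewrite /ple; apply: star_inj; rewrite starM pr1.1 pq.1 /r1 /x1 !mulrA qu //.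
have [b [gb b1 b2]] : mvn (gen Y2) (q - r1) (q - q1).
  apply: (mvn_cancel hgen2 (over_trace oG2)) => //; try exact: G02.
  - by apply: mvn_refl => //; apply: G02.
  - by apply: mvn_sym => //; exists x1.
have ug : u * (q - q1) = (q - r1) * u.
  rewrite mulrBr mulrBl uq qu; congr (_ - _).
  by rewrite /r1 /x1 starM pq1.1 -!mulrA u1 lq1 pq1.2.
have pgr := ple_sub pr1 pq lr1.
(* The rest of [u] carries [q - q1] onto [q - r1]. The partial isometry [b], already generated,
   brings it back, so [u'] is a unitary of the corner of [q - q1], to which the induction hypothesis
   applies. *)
set u' := b * (u * (q - q1)).
have u'1 : u'^'* * u' = q - q1.
  rewrite /u' starM -mulrA (mulrA (b^'*)) b1 ug (mulrA (q - r1)) pgr.2 -ug.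
  by rewrite starM pg.1 -mulrA (mulrA (u^'*)) u1 (ple_r pg pq (ple_subl pq1 pq lq1)) pg.2.
have hu2 : ((q - r1) * u) * ((q - r1) * u)^'* = q - r1.
  by rewrite starM pgr.1 mulrA -(mulrA (q - r1)) u2 (ple_subl pr1 pq lr1) pgr.2.
have u'2 : u' * u'^'* = q - q1.
  by rewrite /u' ug starM mulrA -(mulrA b) hu2 (pi_r pgr b1).
have Bb := GB2 _ gb.
have Bu' : B u'.
  by apply: (vnaM hB) => //; apply: (vnaM hB) => //; apply: (vnaB hB) => //; exact: GB.
have hu' := IH Y2 (p - e0) (q - q1) u' s s0 Y2B Ad pd td pg (mvn_mono G02 m3) Bu' u'1 u'2.
have YE : Y2 = Y `|` ([set y] `|` [set w]) by rewrite classical_sets.setUA.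
rewrite YE in hu'; have h3 := reach_add (reach_add hy hw) hu'.
have -> : s ^+ 2 * (k.+1%:R * k.+2%:R / 2) = t e0 * t (p - e0) + t e0 * t e0
     + s ^+ 2 * (k%:R * k.+1%:R / 2).
  by rewrite td te -!natr1; field.
apply: reach_alg h3 _ => S oS ZS _ ->; have [hS SB MS YS] := oS.
have oS2 : over Y2 S.
  split=> // z [[/YS//|->]|->]; apply: ZS; [by left; left|by left; right].
have Sb := gen_min oS2 gb; have Sx1 := gen_min oS2 gx1.
have Su' : S u' by apply: ZS; right.
have -> : u = x1 + b^'* * u'.
  rewrite /u' mulrA b1 ug mulrA pgr.2 -ug /x1 -mulrDr addrCA subrr addr0 uq //.
by apply: (vnaD hS) => //; apply: (vnaM hS) => //; apply: (vna_star hS).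
Qed.

(** With n+1 pieces the cost is t(p)^2 / 2 times 1 + 1/(n+1); [reach_lim] lets n tend to
    infinity. *)
Lemma reach_unitary Y p q u : Y `<=` B -> A p -> isproj p ->
  isproj q -> mvn (gen Y) (F p) q -> B u -> u^'* * u = q -> u * u^'* = q ->
  Reach Y [set u] (t p ^+ 2 / 2).
Proof.
move=> YB Ap pp pq h Bu u1 u2; apply: reach_lim => r r0.
have tp0 : 0 <= t p by apply: (nf_ge0 nt).
have tp1 : t p <= 1 by apply: (tr_le1 hA ht).
have [n nh] := ltr_add_invr r0; rewrite add0r in nh.
have n0 : 0 < n.+1%:R :> R by rewrite ltr0n.
have := @reach_unitary_nat n.+1 Y p q u (t p / n.+1%:R) (divr_ge0 tp0 (ltW n0)) YB Ap pp.
move=> /(_ ltac:(by rewrite mulrCA divff ?mulr1 // gt_eqF) pq h Bu u1 u2) hr eps e0.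
have [d d0 hd] := hr eps e0; exists d => // e Ae pe te.
have [L [h1 h2 h3]] := hd e Ae pe te; exists L; split=> //.
apply: le_trans h2 _; rewrite lerD2r.
have -> : (t p / n.+1%:R) ^+ 2 * (n.+1%:R * n.+2%:R / 2) =
   t p ^+ 2 / 2 + n.+1%:R^-1 * (t p ^+ 2 / 2).
  by rewrite -[n.+2%:R]natr1; field; rewrite gt_eqF.
rewrite lerD2l; apply: le_trans (ltW nh); rewrite -[leRHS]mulr1.
apply: ler_wpM2l; first by rewrite invr_ge0 ltW.
by have := sqr_ge0 (t p); nra.
Qed.

(** Over [M] the projections [G q] and [G q'] are already equivalent, through some [v]. Then
    [v * G e] is a unitary of the corner of [G q], from which [G e] is recovered. *)
Lemma reach_merge q q' e : D q -> D q' -> D e -> isproj q -> isproj q' ->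
  e^'* * e = q -> e * e^'* = q' -> Reach [set G q; G q'] [set G e] (tD q ^+ 2 / 2).
Proof.
move=> Dq Dq' De pq pq' e1 e2; have ntD := tr_nfun htD.
have [|p [Ap pp _ tp]] := sub_trace hII (s := tD q) (vna1 hA) isproj1.
  by rewrite (nf_ge0 ntD) //= (tr1 ht) (tr_le1 hD htD).
set Y := [set G q; G q'].
have YB : Y `<=` B by move=> _ [->|->]; exact: (em_into hG).
have oG := gen_over YB; have [hgen GB MG YG] := oG.
have Fp := em_proj hF Ap pp.
have Gq := em_proj hG Dq pq; have Gq' := em_proj hG Dq' pq'.
have m1 : mvn (gen Y) (F p) (G q) by apply: (eqv oG) => //; apply: YG; left.
have m2 : mvn (gen Y) (F p) (G q').
  apply: (eqv oG) => //; first by apply: YG; right.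
  by rewrite tp; apply: (mvn_tr hD htD); exists e.
have [v [gv v1 v2]] := mvn_trans hgen Gq' Fp (mvn_sym hgen m2) m1.
have Des := vna_star hD De.
have E1 : (G e)^'* * G e = G q by rewrite -(em_star hG) // -(em_mul hG) // e1.
have E2 : G e * (G e)^'* = G q' by rewrite -(em_star hG) // -(em_mul hG) // e2.
have u1 : (v * G e)^'* * (v * G e) = G q.
  by rewrite starM -mulrA (mulrA (v^'*)) v1 (pi_l Gq' E2) E1.
have u2 : (v * G e) * (v * G e)^'* = G q.
  by rewrite starM mulrA -(mulrA v) E2 (pi_r Gq' v1) v2.
have Bu : B (v * G e) by apply: (vnaM hB); [exact: GB|exact: (em_into hG)].
have := reach_unitary YB Ap pp Gq m1 Bu u1 u2; rewrite tp => hr.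
apply: reach_alg hr _ => S oS uS _ ->; have [hS SB MS YS] := oS.
have -> : G e = v^'* * (v * G e) by rewrite mulrA v1 (pi_l Gq' E2).
apply: (vnaM hS); last exact: uS.
by apply: (vna_star hS); apply: (gen_min oS).
Qed.

End reach.

Lemma dependent (F : fieldType) (V : lmodType F) n (e : 'I_n -> V) (x : 'I_n.+1 -> V) :
  (forall i, exists c : 'I_n -> F, x i = \sum_(j < n) c j *: e j) ->
  exists2 c : 'I_n.+1 -> F, (exists i, c i != 0) & \sum_(i < n.+1) c i *: x i = 0.
Proof.
move=> /choice[a xa]; pose P := (\matrix_(i < n.+1, j < n) a i j)%R.
have : kermx P != 0.
  rewrite kermx_eq0 /row_free; apply: contraTneq (rank_leq_col P) => ->.
  by rewrite -ltnNge.
case/rowV0Pn => v /sub_kermxP vP v0.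
exists (fun i => v 0 i).
  exact/rV0Pn.
rewrite (eq_bigr (fun i => \sum_(j < n) (v 0 i * a i j) *: e j)).
  rewrite exchange_big /= big1 // => j _; rewrite -scaler_suml.
  have := congr1 (fun m : 'rV_n => m 0 j) vP; rewrite !mxE.
  rewrite (eq_bigr (fun i => v 0 i * a i j)) => [->|i _]; first by rewrite scale0r.
  by rewrite mxE.
by move=> i _; rewrite xa scaler_sumr; apply: eq_bigr => j _; rewrite scalerA.
Qed.

(** * Finite-dimensional algebras *)

Section fd.
Context {R : realType} {H : hilbertType R}.
Local Notation C := R[i].
Implicit Types (x y p q a b d e f g v w h : bop H) (u : H) (r : R) (s : seq C) (E T Y Z : set (bop H)) (l : seq (bop H)).

Record salg T : Prop := Salg {
  sg1 : T 1;
  sg_lin : forall (c : C) x y, T x -> T y -> T (c *: x + y);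
  sgM : forall x y, T x -> T y -> T (x * y);
  sg_star : forall x, T x -> T (x^'*)
}.

Section salg_theory.
Variables (T : set (bop H)) (hT : salg T).
Lemma sgD x y : T x -> T y -> T (x + y).
Proof. by move=> Ax Ay; have := sg_lin hT 1 Ax Ay; rewrite scale1r. Qed.
Lemma sg0 : T 0.
Proof. by have := sg_lin hT (-1) (sg1 hT) (sg1 hT); rewrite scaleN1r addNr. Qed.
Lemma sgZ (c : C) x : T x -> T (c *: x).
Proof. by move=> Ax; have := sg_lin hT c Ax sg0; rewrite addr0. Qed.
Lemma sgN x : T x -> T (- x).
Proof. by move=> /(sgZ (-1)); rewrite scaleN1r. Qed.
Lemma sgB x y : T x -> T y -> T (x - y).
Proof. by move=> Ax Ay; apply: sgD => //; apply: sgN. Qed.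
Lemma sg_sum (I : eqType) (s : seq I) (F : I -> bop H) :
  (forall i, i \in s -> T (F i)) -> T (\sum_(i <- s) F i).
Proof.
move=> h; rewrite big_seq; elim/big_rec: _ => [|i x Pi Ax]; first exact: sg0.
by apply: sgD => //; apply: h.
Qed.
End salg_theory.

Record fda E : Prop := Fda {
  fd_salg : salg E;
  fd_dim : exists (n : nat) (e : 'I_n -> op H),
    forall x, E x -> exists c : 'I_n -> C, bval x = \sum_(i < n) c i *: e i
}.

Lemma bval_sum (I : Type) (s : seq I) (P : pred I) (F : I -> bop H) :
  bval (\sum_(i <- s | P i) F i) = \sum_(i <- s | P i) bval (F i).
Proof. by elim/big_rec2: _ => // i x y _ <-. Qed.

Lemma fd_dep E : fda E -> exists n, forall x : 'I_n.+1 -> bop H, (forall i, E (x i)) ->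
  exists2 c : 'I_n.+1 -> C, (exists i, c i != 0) & \sum_(i < n.+1) c i *: x i = 0.
Proof.
move=> [_ [n [e he]]]; exists n => x Ex.
have [c c0 hc] := dependent (fun i => he _ (Ex i)).
by exists c => //; apply: val_inj; rewrite /= bval_sum.
Qed.

Lemma scaleC_eq0' (c : C) x : c *: x = 0 -> x <> 0 -> c = 0.
Proof.
move=> h x0; apply/eqP/negPn/negP => c0; apply: x0.
by rewrite -[x]scale1r -(mulVf c0) -scalerA h scaler0.
Qed.

Lemma normal_idem_sa p : p * p = p -> p^'* * p = p * p^'* -> isproj p.
Proof.
move=> pp n; suff h : p - p^'* * p = 0.
  have e : p = p^'* * p by apply: subr0_eq'.
  by split=> //; rewrite /sa {2}e {1}e; exact: sa_mulstar.
apply: star_mul0.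
have s2 : p^'* * p^'* = p^'* by rewrite -starM pp.
rewrite starB starM starK mulrBl !mulrBr.
have -> : p^'* * (p^'* * p) = p^'* * p by rewrite mulrA s2.
have -> : p^'* * p * p = p^'* * p by rewrite -mulrA pp.
have -> : p^'* * p * (p^'* * p) = p^'* * p.
  by rewrite -mulrA (mulrA p) -n -!mulrA pp mulrA s2.
by rewrite !subrr.
Qed.

(** [prodb] and [pev] evaluate a polynomial at [b] in the corner with unit [g], in factored and in
    expanded form. *)
Definition prodb b g (s : seq C) : bop H := foldr (fun z w => (b - z *: (1 : bop H)) * w) g s.

Lemma prodb_comm x b g s : x * b = b * x -> x * g = g * x ->
  x * prodb b g s = prodb b g s * x.
Proof.
move=> xb xg; elim: s => //= z s IH.
have e : x * (b - z *: (1 : bop H)) = (b - z *: (1 : bop H)) * x.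
  by rewrite mulrBr mulrBl xb -bscaleAr -bscaleAl mulr1 mul1r.
by rewrite mulrA e -mulrA IH mulrA.
Qed.

Definition pev b g (P : {poly C}) : bop H := \sum_(i < size P) P`_i *: (b ^+ i * g).

Lemma pevE b g (P : {poly C}) n : (size P <= n)%N ->
  pev b g P = \sum_(i < n) P`_i *: (b ^+ i * g).
Proof.
move=> sn; rewrite /pev (big_ord_widen n (fun i => P`_i *: (b ^+ i * g)) sn).
rewrite big_mkcond; apply: eq_bigr => i _; case: ltnP => // h.
by rewrite nth_default // scale0r.
Qed.

Lemma pev_mulX b g (P : {poly C}) z :
  pev b g (('X - z%:P) * P) = (b - z *: (1 : bop H)) * pev b g P.
Proof.
have s1 : (size (('X - z%:P) * P)%R <= (size P).+1)%N.
  by apply: leq_trans (size_polyMleq _ _) _; rewrite size_XsubC.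
rewrite (pevE b g s1) big_ord_recl [X in X + _](_ : _ = - (z * P`_0) *: g); last first.
  by rewrite expr0 mul1r mulrBl coefB coefXM coefCM sub0r.
rewrite (eq_bigr (fun i : 'I_(size P) => P`_i *: (b ^+ i.+1 * g) -
    (z * P`_i.+1) *: (b ^+ i.+1 * g))); last first.
  by move=> i _; rewrite /= mulrBl coefB coefXM coefCM /= scalerBl.
rewrite sumrB addrCA addrC.
have -> : (- (z * P`_0)) *: g - \sum_(i < size P) (z * P`_i.+1) *: (b ^+ i.+1 * g)
   = - (z *: pev b g P).
  have -> : pev b g P = \sum_(i < (size P).+1) P`_i *: (b ^+ i * g) by rewrite -pevE.
  rewrite big_ord_recl expr0 mul1r scalerDr opprD scalerA scaleNr; congr (_ - _).
  by rewrite scaler_sumr; apply: eq_bigr => i _; rewrite scalerA.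
rewrite mulrBl -bscaleAl mul1r addrC; congr (_ - _).
by rewrite /pev mulr_sumr; apply: eq_bigr => i _; rewrite -bscaleAr mulrA -exprS.
Qed.

Lemma pev_prod b g (c : C) (s : seq C) : pev b g (c *: \prod_(z <- s) ('X - z%:P)) = c *: prodb b g s.
Proof.
have pZ (P : {poly C}) : pev b g (c *: P) = c *: pev b g P.
  rewrite (pevE b g (size_scale_leq c P)) /pev scaler_sumr.
  by apply: eq_bigr => i _; rewrite coefZ scalerA.
rewrite pZ; congr (_ *: _); elim: s => [|z s IH].
  by rewrite big_nil /pev size_poly1 big_ord1 coefC /= expr0 mul1r scale1r.
by rewrite big_cons pev_mulX IH.
Qed.

Definition scalar_corner E g := forall x, E x -> exists c : C, g * x * g = c *: g.

(* A self-adjoint element of the corner is killed by a product of linear factors, and each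
   factor yields an eigenprojection. *)
Lemma minimal_corner E g : fda E -> E g -> isproj g ->
  (forall g', E g' -> isproj g' -> ple g' g -> g' = 0 \/ g' = g) -> scalar_corner E g.
Proof.
move=> fE Eg pg gmin; have hE := fd_salg fE.
have base b : E b -> sa b -> g * b = b -> b * g = b -> exists c : C, b = c *: g.
  move=> Eb sb gb bg.
  have [n hn] := fd_dep fE.
  have Ebk i : E (b ^+ i * g).
    elim: i => [|i IH]; first by rewrite expr0 mul1r.
    by rewrite exprS -mulrA; apply: (sgM hE).
  have [c [i0 ci0] hc] := hn (fun i => b ^+ i * g) (fun i => Ebk i).
  pose P := (\poly_(i < n.+1) (if insub i is Some j then c j else 0)).
  have Pc (i : 'I_n.+1) : P`_i = c i by rewrite coef_poly ltn_ord valK.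
  have P0 : P != 0.
    by apply: contraNneq ci0 => P0; rewrite -Pc P0 coef0.
  have pv : pev b g P = 0.
    rewrite (pevE b g (size_poly _ _)) -[RHS]hc; apply: eq_bigr => i _.
    by rewrite Pc.
  have [s Ps] := closed_field_poly_normal P.
  have {pv P0} : prodb b g s = 0.
    move: pv; rewrite Ps pev_prod => h; apply: contrapT => h0.
    have := scaleC_eq0' h h0; move/eqP; rewrite lead_coef_eq0; exact/negP.
  elim: s {Ps} => [|z s IH] /=.
    by move=> g0; exists 0; rewrite -bg g0 mulr0 scaler0.
  (* Linear factors are peeled off until the remaining product [w] is nonzero. Then
     [b * w = z *: w], and [w] is normal with [w * w] a multiple of [w]; so a multiple of [w] is a
     nonzero projection below [g], equal to [g] by minimality. *)
  set w := prodb b g s => zw.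
  have [/IH//|w0] := EM (w = 0).
  have Ew : E w.
    rewrite /w; elim: (s) => //= z' s' IH'; apply: (sgM hE) => //.
    by apply: (sgB hE) => //; apply/(sgZ hE)/(sg1 hE).
  have bw : b * w = z *: w.
    by apply: subr0_eq'; move: zw; rewrite mulrBl -bscaleAl mul1r.
  have cbw : b * w = w * b by apply: prodb_comm; rewrite ?gb ?bg.
  have cgw : g * w = w * g by apply: prodb_comm; rewrite ?gb ?bg.
  have gw : g * w = w.
    rewrite /w; elim: (s) => [|z' s' IH'] /=; first exact: pg.2.
    rewrite mulrA mulrBr gb -bscaleAr mulr1 mulrBl -bscaleAl IH'.
    by rewrite mulrBl -bscaleAl mul1r.
  have nw : w^'* * w = w * w^'*.
    apply: prodb_comm; apply: star_inj; rewrite !starM starK ?sb ?pg.1 //.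
  have [mu hmu] : exists mu : C, w * w = mu *: w.
    rewrite /w -/w; suff : exists mu : C, prodb b g s * w = mu *: w by [].
    elim: (s) => [|z' s' [mu hmu]] /=; first by exists 1; rewrite gw scale1r.
    exists ((z - z') * mu); rewrite -mulrA hmu -bscaleAr mulrBl -bscaleAl mul1r bw.
    by rewrite -scalerBl scalerA mulrC.
  have mu0 : mu != 0.
    apply/eqP => m0; apply: w0; apply: star_mul0; apply: sa_sqr0; first exact: sa_mulstar.
    by rewrite -mulrA (mulrA w) -nw -!mulrA hmu m0 scale0r !mulr0.
  pose p := mu^-1 *: w.
  have pp : isproj p.
    apply: normal_idem_sa.
      by rewrite /p -bscaleAl -bscaleAr hmu (scalerA mu^-1 mu) mulVf // scale1r.
    by rewrite /p starZ -!bscaleAl -!bscaleAr nw !scalerA mulrC.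
  have lp : ple p g by rewrite /ple /p -bscaleAl -cgw gw.
  have [p0|pg'] := gmin p ltac:(exact: (sgZ hE)) pp lp.
    have wE : w = mu *: p by rewrite /p scalerA divff // scale1r.
    by case: w0; rewrite wE p0 scaler0.
  exists z; rewrite -[LHS]bg -pg' /p -!bscaleAr bw !scalerA mulrC //.
move=> x Ex; set y := g * x * g.
have Ey : E y by apply: (sgM hE) => //; apply: (sgM hE).
have Eys : E (y^'*) by apply: (sg_star hE).
have gy : g * y = y by rewrite /y !mulrA pg.2.
have yg : y * g = y by rewrite /y -mulrA pg.2.
have gys : g * y^'* = y^'* by apply: star_inj; rewrite starM starK pg.1.
have ysg : y^'* * g = y^'* by apply: star_inj; rewrite starM starK pg.1.
have [||||c1 h1] := base (y + y^'*).
- exact: (sgD hE).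
- by rewrite /sa starD starK addrC.
- by rewrite mulrDr gy gys.
- by rewrite mulrDl yg ysg.
have [||||c2 h2] := base ('i%C *: (y - y^'*)).
- by apply: (sgZ hE); apply: (sgB hE).
- rewrite /sa starZ starB starK.
  have -> : Num.conj ('i%C : C) = - 'i%C by apply/eqP; rewrite eq_complex /= oppr0 !eqxx.
  by rewrite scaleNr -scalerN opprB.
- by rewrite -bscaleAr mulrBr gy gys.
- by rewrite -bscaleAl mulrBl yg ysg.
exists (2^-1 * (c1 - 'i%C * c2)).
have e2 : y - y^'* = (- 'i%C * c2) *: g.
  rewrite -scalerA -h2 scalerA mulNr -expr2 sqr_i opprK scale1r //.
have e3 : (c1 - 'i%C * c2) *: g = y + y by rewrite scalerDl -mulNr -e2 -h1; ncring.
rewrite -scalerA e3 scalerDr -scalerDl (_ : 2^-1 + 2^-1 = 1 :> C) ?scale1r //.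
by field.
Qed.

End fd.

(** * The splitting and merging algorithm *)

Section stage.
Context {R : realType} {H : hilbertType R}.
Local Notation C := R[i].
Implicit Types (x y p q a b d e f g v w h : bop H) (E T Y Z : set (bop H)) (l : seq (bop H)) (c r : R).
Variables (D : set (bop H)) (tD : bop H -> R) (hD : vna D) (htD : trace D tD).
Let ntD := tr_nfun htD.
(* [RR] abstracts the properties of [Reach] that the finite-dimensional algorithm uses. *)
Variable RR : set (bop H) -> set (bop H) -> R -> Prop.
Hypotheses
  (rr_refl : forall Y Z c, Z `<=` D -> 0 <= c ->
     (forall T, salg T -> T `<=` D -> Y `<=` T -> Z `<=` T) -> RR Y Z c)
  (rr_trans : forall Y Z Z' c c', RR Y Z c -> RR (Y `|` Z) Z' c' -> RR Y Z' (c + c'))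
  (rr_alg : forall Y Z Z' c, RR Y Z c -> Z' `<=` D ->
     (forall T, salg T -> T `<=` D -> Y `<=` T -> Z `<=` T -> Z' `<=` T) -> RR Y Z' c)
  (rr_split : forall Y q q', Y `<=` D -> Y q -> D q' -> isproj q -> isproj q' -> ple q' q ->
     RR Y [set q'] (tD q' * tD (q - q')))
  (rr_merge : forall Y q q' e, Y `<=` D -> Y q -> Y q' -> D e -> isproj q -> isproj q' ->
     e^'* * e = q -> e * e^'* = q' -> RR Y [set e] (tD q ^+ 2 / 2)).

Definition tot l := \sum_(x <- l) x.
Definition sumsq l : R := \sum_(x <- l) tD x ^+ 2.

(* Impredicatively: the ideal of [E] generated by [g] contains 1. *)
Definition full E g := forall J : set (bop H), (forall x y, J x -> J y -> J (x + y)) ->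
  (forall a b, E a -> E b -> J (a * g * b)) -> J 1.

Definition orthl l := forall x y, x \in l -> y \in l -> x <> y -> x * y = 0.

Record sys E l : Prop := Sys {
  sy_proj : forall x, x \in l -> [/\ E x, isproj x & x <> 0];
  sy_uniq : uniq l;
  sy_orth : orthl l;
  sy_full : full E (tot l)
}.

(** Invariant of the algorithm: [Y] is what has been generated so far, and all of [E] follows once
    the corner of [E] at [tot l] is generated. *)
Record state E Y l : Prop := State {
  st_sys : sys E l;
  st_Y : forall x, x \in l -> Y x;
  st_sub : Y `<=` E;
  st_gen : forall T, salg T -> Y `<=` T ->
    (forall x, E x -> T (tot l * x * tot l)) -> E `<=` T
}.

Lemma refine_orthl l g g' : uniq l -> orthl l -> (forall x, x \in l -> isproj x) -> g \in l ->
  isproj g' -> ple g' g -> g' <> 0 -> g' <> g ->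
  uniq [:: g', g - g' & rem g l] /\ orthl [:: g', g - g' & rem g l].
Proof.
move=> lu lo lp gl pg' lg' g'0 g'g; have pg := lp _ gl; set l0 := rem g l.
have pd := ple_sub pg' pg lg'; have ld := ple_subl pg' pg lg'.
have [od1 od2] := ple_sub_orth pg' pg lg'.
have d0 : g - g' <> 0 by move=> h; apply: g'g; rewrite (subr0_eq' h).
have l0l z : z \in l0 -> z \in l by apply: mem_rem.
have l0g z : z \in l0 -> z <> g by rewrite mem_rem_uniq // => /andP[/eqP].
have og z p : z \in l0 -> isproj p -> ple p g -> p * z = 0 /\ z * p = 0.
  move=> zl pp lpg; have pz := lp z (l0l z zl).
  have gz : g * z = 0 by apply: lo => //; [exact: l0l|move=> h; apply: (l0g z)].
  have o : p * z = 0 by rewrite -lpg -mulrA gz mulr0.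
  by split=> //; apply: orth_sym o; [case: pp|case: pz].
have self p : isproj p -> p <> 0 -> p * p <> 0 by move=> pp p0; rewrite pp.2.
split.
- rewrite /= !inE negb_or rem_uniq // andbT -andbA; apply/and3P; split.
  + by apply/eqP => h; apply: (self g') => //; rewrite {2}h.
  + apply/negP => zl; apply: (self g') => //; exact: (og g' g' zl pg' lg').1.
  + apply/negP => zl; apply: (self (g - g')) => //; exact: (og _ _ zl pd ld).1.
- move=> z z'; rewrite !inE.
      move=> /predU1P[->|/predU1P[->|zl]] /predU1P[->|/predU1P[->|zl']] // h.
  + exact: (og z' g' zl' pg' lg').1.
  + exact: (og z' _ zl' pd ld).1.
  + exact: (og z g' zl pg' lg').2.
  + exact: (og z _ zl pd ld).2.
  + by apply: lo => //; apply: l0l.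
Qed.

Lemma tot_rem x l : x \in l -> tot l = x + tot (rem x l).
Proof. by move=> xl; rewrite /tot (perm_big _ (perm_to_rem xl)) big_cons. Qed.
Lemma sumsq_rem x l : x \in l -> sumsq l = tD x ^+ 2 + sumsq (rem x l).
Proof. by move=> xl; rewrite /sumsq (perm_big _ (perm_to_rem xl)) big_cons. Qed.

Lemma orthl_size E l n : (forall x : 'I_n.+1 -> bop H, (forall i, E (x i)) ->
    exists2 c : 'I_n.+1 -> C, (exists i, c i != 0) & \sum_(i < n.+1) c i *: x i = 0) ->
  sys E l -> (size l <= n)%N.
Proof.
move=> dep [lP lu lo _]; rewrite leqNgt; apply/negP => ln.
have il (i : 'I_n.+1) : (i < size l)%N := leq_trans (ltn_ord i) ln.
have [i|c [j cj] hc] := dep (fun i => nth 0 l i).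
  by have [] := lP _ (mem_nth 0 (il i)).
move/negP: cj; apply; apply/eqP.
have [_ pj j0] := lP _ (mem_nth 0 (il j)).
apply: scaleC_eq0' j0; have := congr1 (fun y => l`_j * y) hc; rewrite mulr0.
rewrite mulr_sumr (bigD1 j) //= big1 ?addr0 => [|i ij]; first by rewrite -bscaleAr pj.2.
rewrite -bscaleAr lo ?scaler0 //; try exact: mem_nth.
by apply/eqP; rewrite nth_uniq // eq_sym.
Qed.

Lemma tot_mul l x : orthl l -> uniq l -> (forall y, y \in l -> isproj y) -> x \in l ->
  tot l * x = x /\ x * tot l = x.
Proof.
move=> lo lu lp xl; rewrite /tot (perm_big _ (perm_to_rem xl)) big_cons.
rewrite mulrDl mulrDr mulr_suml mulr_sumr !(lp x xl).2.
rewrite !big_seq !big1 ?addr0 // => y; rewrite mem_rem_uniq // => /andP[/eqP yx yl].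
  by apply: lo => // e; apply: yx.
by apply: lo.
Qed.

Lemma merge_phase n : forall E Y l, fda E -> E `<=` D -> (size l <= n)%N -> state E Y l ->
  (forall g, g \in l -> scalar_corner E g) ->
  exists2 l', sys E l' & RR Y E ((sumsq l - sumsq l') / 2).
Proof.
elim: n => [|n IH] E Y l fE ED ln [[lP lu lo lf] lY YE lg] lm.
  move: ln; rewrite leqn0 size_eq0 => /eqP l0; subst l.
  exists [::]; first by split.
  rewrite subrr mul0r; apply: rr_refl => // T hT _ YT; apply: lg => // x Ex.
  by rewrite /tot big_nil !mul0r; apply: (sg0 hT).
have hE := fd_salg fE.
have lp y : y \in l -> isproj y by case/lP.
have YD : Y `<=` D by move=> y /YE/ED.
have [[g1 [g2 [g1l g2l g12 [x [Ex x0]]]]]|nc] := EM (exists g1 g2, [/\ g1 \in l, g2 \in l, g1 <> g2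
    & exists x, E x /\ g2 * x * g1 <> 0]); last first.
  exists l; first by split.
  rewrite subrr mul0r; apply: rr_refl => // T hT _ YT; apply: lg => // x Ex.
  rewrite /tot mulr_suml mulr_suml; apply: (sg_sum hT) => g gl.
  rewrite mulr_sumr; apply: (sg_sum hT) => g' gl'.
  have [<-|gg] := EM (g = g').
    by have [c ->] := lm g gl x Ex; apply: (sgZ hT); apply/YT/lY.
  suff -> : g * x * g' = 0 by exact: (sg0 hT).
  apply: contrapT => h0; apply: nc; exists g', g; split=> //; last by exists x.
  by move=> e; apply: gg.
have [E1 p1 n1] := lP _ g1l; have [E2 p2 n2] := lP _ g2l.
set y := g2 * x * g1.
have Ey : E y by apply: (sgM hE) => //; apply: (sgM hE).
have y1 : y * g1 = y by rewrite /y -mulrA p1.2.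
have y2 : g2 * y = y by rewrite /y !mulrA p2.2.
have Eys := sg_star hE Ey.
have ys1 : g1 * y^'* = y^'* by apply: star_inj; rewrite starM starK p1.1.
have ys2 : y^'* * g2 = y^'* by apply: star_inj; rewrite starM starK p2.1.
have [la hla] := lm g1 g1l (y^'* * y) (sgM hE Eys Ey).
have {}hla : y^'* * y = la *: g1 by rewrite -hla mulrA ys1 -mulrA y1.
have [r r0 rE] : exists2 r : R, 0 < r & la = r%:C.
  have sl : (Num.conj la - la) *: g1 = 0.
    by rewrite scalerBl -hla -[in X in X - _]p1.1 -starZ -hla starM starK subrr.
  have laR : la = (complex.Re la)%:C.
    have := scaleC_eq0' sl n1; case: (la) => a b /eqP.
    rewrite eq_complex /= => /andP[_ /eqP h]; congr (_ +i* _); lra.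
  exists (complex.Re la) => //.
  have h1 : 0 < tD (y^'* * y).
    rewrite lt_neqAle (n2_ge0 hD htD (ED _ Ey)) andbT eq_sym; apply/eqP => h.
    exact: x0 (tr_faith htD (ED _ Ey) h).
  have h2 := tr_gt0 htD (ED _ E1) p1 n1.
  by move: h1; rewrite hla laR (nfZ hD ntD) ?pmulr_lgt0 //; apply: ED.
pose s := Num.sqrt r; have s0 : 0 < s by rewrite sqrtr_gt0.
pose e := s^-1%:C *: y.
have Ee : E e by apply: (sgZ hE).
have ee : e^'* * e = g1.
  rewrite /e starZr -bscaleAl -bscaleAr hla rE !scalerA -!rmorphM /=.
  rewrite [X in X%:C](_ : _ = 1) ?scale1r // -(sqr_sqrtr (ltW r0)) -/s.
  by field; rewrite gt_eqF.
have pe := pi_star p1 ee.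
have ege : g2 * e = e by rewrite /e -bscaleAr y2.
have ee' : e * e^'* = g2.
  have [mu hmu] := lm g2 g2l (e * e^'*) (sgM hE Ee (sg_star hE Ee)).
  have {}hmu : e * e^'* = mu *: g2.
    rewrite -hmu mulrA ege -mulrA; congr (_ * _).
    by apply: star_inj; rewrite starM starK p2.1 ege.
  have mm : (mu * mu - mu) *: g2 = 0.
    by rewrite scalerBl -hmu -[in X in _ - X]pe.2 hmu -bscaleAl -bscaleAr p2.2 scalerA subrr.
  have /eqP : mu * (mu - 1) = 0 by rewrite mulrBr mulr1; apply: scaleC_eq0' mm n2.
  rewrite mulf_eq0 subr_eq0 => /orP[]/eqP m; rewrite hmu m ?scale1r //.
  case: n1; rewrite -ee; have : e^'*^'* * e^'* = 0 by rewrite starK hmu m scale0r.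
  by move/star_mul0 => ->; rewrite mul0r.
set l' := rem g2 l; set Y' := Y `|` [set e].
have l'l z : z \in l' -> z \in l by apply: mem_rem.
have g1l' : g1 \in l' by rewrite mem_rem_uniq // inE g1l andbT; apply/eqP.
have l'u : uniq l' by apply: rem_uniq.
have l'o : orthl l' by move=> z z' /l'l h /l'l h'; apply: lo.
have [tg1 g1t] : tot l' * g1 = g1 /\ g1 * tot l' = g1.
  by apply: tot_mul => // z /l'l/lp.
(* With [e] at hand, [g2] is a conjugate of [g1], which is below [tot l']; fullness and the corner
   at [tot l] both reduce to the shorter list. *)
have ttE : tot l = e * g1 * e^'* + tot l'.
  by rewrite (tot_rem g2l) (pi_r p1 ee) ee'.
have st' : state E Y' l'.
  split.
  - split=> //; first by move=> z /l'l/lP.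
    move=> J JD Jab; apply: lf => // a b Ea Eb; rewrite ttE mulrDr mulrDl.
    apply: JD; last exact: Jab.
    have -> : a * (e * g1 * e^'*) * b = (a * e) * tot l' * (g1 * e^'* * b).
      by rewrite !mulrA -(mulrA (a * e) (tot l') g1) tg1.
    apply: Jab; first exact: (sgM hE).
    by apply: (sgM hE) => //; apply: (sgM hE) => //; apply: (sg_star hE).
  - by move=> z /l'l/lY; left.
  - by move=> z [/YE//|->].
  - move=> T hT Y'T hx; have YT : Y `<=` T by move=> z Yz; apply: Y'T; left.
    have Te : T e by apply: Y'T; right.
    have Tes := sg_star hT Te; have Es := sg_star hE Ee.
    have Tg1 : T g1 by apply/YT/lY.
    apply: lg => // z Ez; rewrite ttE.
    have -> : (e * g1 * e^'* + tot l') * z * (e * g1 * e^'* + tot l') =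
        e * g1 * (tot l' * (e^'* * z * e) * tot l') * g1 * e^'* +
        e * g1 * (tot l' * (e^'* * z) * tot l') +
        (tot l' * (z * e) * tot l') * g1 * e^'* + tot l' * z * tot l'.
      rewrite !mulrA -(mulrA e g1 (tot l')) g1t.
      rewrite -(mulrA _ (tot l') g1) tg1 -[tot l' * z * e * tot l' * g1]mulrA tg1.
      ncring.
    have MT a b : T a -> T b -> T (a * b) by apply: (sgM hT).
    apply: (sgD hT); last exact: hx.
    apply: (sgD hT); last by do 2!apply: (MT) => //; apply: hx; apply: (sgM hE).
    apply: (sgD hT); last by apply: (MT); [exact: MT|apply: hx; apply: (sgM hE)].
    do 2!apply: (MT) => //; apply: (MT); first exact: MT.
    by apply: hx; do 2!apply: (sgM hE) => //.
have c1 : RR Y [set e] (tD g1 ^+ 2 / 2).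
  by apply: (rr_merge YD (lY _ g1l) (lY _ g2l)) => //; apply: ED.
have sl' : (size l' <= n)%N by rewrite size_rem // -ltnS prednK //; case: (l) g2l.
have [l'' sl'' hl''] := IH E Y' l' fE ED sl' st' (fun g gl => lm g (l'l g gl)).
exists l'' => //; have tg : tD g1 = tD g2.
  by apply: (mvn_tr hD htD); exists e; split=> //; apply: ED.
have -> : (sumsq l - sumsq l'') / 2 = tD g1 ^+ 2 / 2 + (sumsq l' - sumsq l'') / 2.
  by rewrite (sumsq_rem g2l) -/l' tg; field.
exact: rr_trans c1 hl''.
Qed.

(** [m] is fuel: nonzero orthogonal projections are linearly independent, so the list never has more
    than [n] entries. Replacing the trace a + b by a and b lowers the sum of squares by 2ab, twice
    the cost. *)
Lemma split_phase n m : forall E Y l, fda E -> E `<=` D ->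
  (forall x : 'I_n.+1 -> bop H, (forall i, E (x i)) ->
    exists2 c : 'I_n.+1 -> C, (exists i, c i != 0) & \sum_(i < n.+1) c i *: x i = 0) ->
  (n.+1 <= size l + m)%N -> state E Y l ->
  exists2 l', sys E l' & RR Y E ((sumsq l - sumsq l') / 2).
Proof.
elim: m => [|m IH] E Y l fE ED dep nl st.
  by have := orthl_size dep (st_sys st); rewrite leqNgt -(addn0 (size l)) nl.
have [[lP lu lo lf] lY YE lg] := st.
have [[g [g' [gl [Eg' pg' lg' [g'0 g'g]]]]]|nm] := EM (exists g g', g \in l /\
   [/\ E g', isproj g', ple g' g & g' <> 0 /\ g' <> g]); last first.
  apply: merge_phase (leqnn _) st _ => // g gl; have [Eg pg g0] := lP g gl.
  apply: minimal_corner => // g' Eg' pg' lg'.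
  have [->|g'0] := EM (g' = 0); first by left.
  have [->|g'g] := EM (g' = g); first by right.
  by case: nm; exists g, g'.
have hE := fd_salg fE; have [Eg pg g0] := lP g gl.
have YD : Y `<=` D by move=> y /YE/ED.
have pd := ple_sub pg' pg lg'; have ld := ple_subl pg' pg lg'.
have [od1 od2] := ple_sub_orth pg' pg lg'.
have Ed : E (g - g') by apply: (sgB hE).
have d0 : g - g' <> 0 by move=> h; apply: g'g; rewrite (subr0_eq' h).
set Y' := Y `|` [set g'; g - g']; set l0 := rem g l.
set l' := [:: g', g - g' & l0].
have l0l z : z \in l0 -> z \in l by apply: mem_rem.
have lp z : z \in l -> isproj z by case/lP.
have tl : tot l' = tot l.
  by rewrite (tot_rem gl) /l' /tot !big_cons addrA [g' + _]addrC subrK.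
have st' : state E Y' l'.
  split.
  - split.
    + move=> z; rewrite !inE => /predU1P[->//|/predU1P[->//|/l0l/lP//]].
    + exact: (refine_orthl lu lo lp gl pg' lg' g'0 g'g).1.
    + exact: (refine_orthl lu lo lp gl pg' lg' g'0 g'g).2.
    + by rewrite tl.
  - move=> z; rewrite !inE => /predU1P[->|/predU1P[->|/l0l/lY]].
    + by right; left.
    + by right; right.
    + by left.
  - by move=> z [/YE//|[->|->]].
  - move=> T hT Y'T; rewrite tl; apply: lg => // z Yz; apply: Y'T; by left.
have c1 : RR Y [set g'; g - g'] (tD g' * tD (g - g')).
  apply: rr_alg (rr_split YD (lY _ gl) (ED _ Eg') pg pg' lg') _ _.
    by move=> z [->|->]; apply: ED.
  move=> T hT TD YT g'T z [->|->]; first exact: g'T.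
  by apply: (sgB hT); [apply/YT/lY|exact: g'T].
have sl' : (n.+1 <= size l' + m)%N.
  have : (0 < size l)%N by case: (l) gl.
  by rewrite /l' /= size_rem //; case: (size l) nl => // k; rewrite addnS.
have [l'' sl'' hl''] := IH E Y' l' fE ED dep sl' st'.
exists l'' => //.
have -> : (sumsq l - sumsq l'') / 2 = tD g' * tD (g - g') + (sumsq l' - sumsq l'') / 2.
  rewrite (sumsq_rem gl) -/l0 /l' /sumsq !big_cons (nfB hD ntD) => [||]; [by field|exact: ED|exact: ED].

exact: (rr_trans c1 hl'').
Qed.

Lemma full_mono E E' g : E `<=` E' -> full E g -> full E' g.
Proof. by move=> EE f J JD Jab; apply: f => // a b /EE Ea /EE; apply: Jab. Qed.

(** The list for [E] is kept when passing to [E']. By fullness, 1 is a sum of products of [tot l]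
    with elements of [E] on both sides; inserting this to the left and to the right of an element of
    [E'] shows that [E] and the corner of [E'] at [tot l] generate [E']. *)
Lemma stage E E' l : fda E -> fda E' -> E `<=` E' -> E' `<=` D -> sys E l ->
  exists2 l', sys E' l' & RR E E' ((sumsq l - sumsq l') / 2).
Proof.
move=> fE fE' EE ED sl; have [n dep] := fd_dep fE'.
apply: (@split_phase n n.+1 E' E l fE' ED dep); first by rewrite leq_addl.
have [lP lu lo lf] := sl; have hE' := fd_salg fE'.
split=> //.
- split=> //; first by move=> x /lP[/EE].
  exact: full_mono lf.
- by move=> x /lP[].
- move=> T hT ET hx.
  have h1 x : E' x -> T (tot l * x).
    move=> Ex; rewrite -[_ * x]mulr1; move: x Ex.
    apply: (lf (fun y => forall x, E' x -> T (tot l * x * y))) => [y y' hy hy' x Ex|a b Ea Eb x Ex].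
      by rewrite mulrDr; apply: (sgD hT); [exact: hy|exact: hy'].
    rewrite !mulrA; apply: (sgM hT); last exact: ET.
    by rewrite -(mulrA (tot l)); apply: hx; apply: (sgM hE') => //; apply: EE.
  move=> x Ex; rewrite -[x]mul1r; move: x Ex.
  apply: (lf (fun y => forall x, E' x -> T (y * x))) => [y y' hy hy' x Ex|a b Ea Eb x Ex].
    by rewrite mulrDl; apply: (sgD hT); [exact: hy|exact: hy'].
  rewrite -!mulrA; apply: (sgM hT); first exact: ET.
  by apply: h1; apply: (sgM hE') => //; apply: EE.
Qed.

End stage.

(** * The lower bound for the sum of squares *)

Lemma idem_mxtrace (F : fieldType) n (a : 'M[F]_n) : a *m a = a -> \tr a = (\rank a)%:R.
Proof.
move=> aa; have h : row_base a *m col_base a = 1%:M.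
  apply: (row_free_inj (row_base_free a)); apply: (row_full_inj (col_base_full a)).
  by rewrite /= mul1mx mulmxA (mulmxA (col_base a) (row_base a)) mulmx_base -(mulmxA a) mulmx_base.
by rewrite -{1}(mulmx_base a) mxtrace_mulC h mxtrace1.
Qed.

Section lower.
Context {R : realType} {H : hilbertType R}.
Local Notation C := R[i].
Implicit Types (x y p q z g : bop H) (l : seq (bop H)).
Variables (Q : set (op H)) (phi : op H -> C) (hQ : tracial_vN Q phi).
Variables (I : set nat) (k : nat -> nat) (alpha : nat -> R) (z0 : op H)
  (rho : forall i, 'M[C]_(k i) -> op H).
Arguments rho : clear implicits.
Hypothesis had : atomic_decomposition Q phi I alpha z0 rho.
Local Notation D := (lift Q).
Local Notation tD := (retr phi).
Let hD : vna D := lift_vna hQ.1.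
Let htD : trace D tD := trace_lift hQ.
Let ntD := tr_nfun htD.

Definition zc i : bop H :=
  match pselect (bounded_ops (rho i 1%:M)) with left h => mkbop h | right _ => 0 end.

Lemma zcE i : I i -> bval (zc i) = rho i 1%:M.
Proof.
move=> Ii; rewrite /zc; case: pselect => // h; case: h.
by apply: (ssa_bounded hQ.1.1.1); case: (ad_rho_central had Ii).
Qed.

Lemma zc_in i : I i -> D (zc i).
Proof. by move=> Ii; rewrite /lift /= zcE //; case: (ad_rho_central had Ii). Qed.

Lemma zc_comm i x : I i -> D x -> zc i * x = x * zc i.
Proof.
move=> Ii Dx; apply: val_inj; rewrite /= zcE //.
by case: (ad_rho_central had Ii) => _; apply.
Qed.

Lemma zc_proj i : I i -> isproj (zc i).
Proof.
move=> Ii; split; apply: val_inj.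
  by rewrite /= -adj_star zcE // -(ad_rho_adj had Ii) trmx1 map_mx1.
by rewrite /= zcE // -(ad_rho_mul had Ii) mul1mx.
Qed.

Lemma zc_orth i j : I i -> I j -> i <> j -> zc i * zc j = 0.
Proof.
by move=> Ii Ij ij; apply: val_inj; rewrite /= !zcE //; apply: (ad_orth had).
Qed.

Lemma zc_sum (s : seq nat) : uniq s -> (forall i, i \in s -> I i) ->
  [/\ D (\sum_(i <- s) zc i), isproj (\sum_(i <- s) zc i) &
    forall x, D x -> (\sum_(i <- s) zc i) * x = x * \sum_(i <- s) zc i].
Proof.
move=> us sI; split.
- by rewrite big_seq; apply: (vna_sum hD) => i /sI/zc_in.
- split; first by rewrite /sa star_sum !big_seq; apply: eq_bigr => i /sI/zc_proj[].
  rewrite mulr_suml [RHS]big_seq [LHS]big_seq; apply: eq_bigr => i is_.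
  rewrite mulr_sumr (bigD1_seq i) //= (zc_proj (sI _ is_)).2 big_seq_cond big1 ?addr0 //.
  by move=> j /andP[js /eqP ji]; apply: zc_orth; [exact: sI|exact: sI|move=> e; apply: ji].
- move=> x Dx; rewrite mulr_suml mulr_sumr !big_seq; apply: eq_bigr => i /sI Ii.
  exact: zc_comm.
Qed.

Lemma proj_comm_mul p q : isproj p -> isproj q -> p * q = q * p -> isproj (p * q) /\ ple (p * q) q.
Proof.
move=> [sp pp] [sq qq] pq; split; last by rewrite /ple -mulrA qq.
by split; [rewrite /sa starM sp sq pq|rewrite mulrA -(mulrA p) -pq mulrA pp -mulrA qq].
Qed.

Lemma rho0 i : I i -> rho i 0 = 0.
Proof.
by move=> Ii; have := ad_rho_linear had Ii (-1) 0 0; rewrite scaleN1r addNr scaleN1r addNr.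
Qed.

(** [zc i * g] is the image of an idempotent matrix, whose trace is its rank, and the rank of a
    nonzero matrix is at least 1. *)
Lemma corner_trace i g : I i -> D g -> isproj g -> zc i * g <> 0 ->
  alpha i / (k i)%:R <= tD (zc i * g).
Proof.
move=> Ii Dg pg zg0.
have [[pzg _] _] : isproj (zc i * g) /\ ple (zc i * g) g.
  by apply: proj_comm_mul => //; [exact: zc_proj|exact: zc_comm].
have pzg2 : zc i * g * (zc i * g) = zc i * g.
  by case: (proj_comm_mul (zc_proj Ii) pg (zc_comm Ii Dg)) => -[].
have : [set rho i 1%:M \o x | x in Q] (bval (zc i * g)).
  by exists (bval g) => //; rewrite bvalM zcE.
rewrite -(ad_rho_range had Ii) => -[a _ ha].
have aa : a *m a = a.
  by apply: (ad_rho_inj had Ii); rewrite (ad_rho_mul had Ii) ha -bvalM pzg2.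
have k0 := ad_size had Ii; have al := ad_weight had Ii.
rewrite /retr -ha (ad_trace had Ii) (idem_mxtrace aa).
have -> : (alpha i)%:C * ((\rank a)%:R / (k i)%:R) = (alpha i * ((\rank a)%:R / (k i)%:R))%:C.
  by rewrite !rmorphM /= fmorphV !rmorph_nat.
rewrite /= ler_pM2l // -[X in X <= _]mul1r ler_wpM2r ?invr_ge0 ?ler0n //.
rewrite ler1n lt0n mxrank_eq0; apply/eqP => a0; apply: zg0; apply: val_inj.
by rewrite -[LHS]ha a0 rho0.
Qed.

(** By fullness every matrix summand meets some [g] of the list, in a projection of trace at least
    [alpha i / (k i)%:R]. After exchanging sums, the squares of the traces of [zc i * g] over i add
    up to at most [tD g ^+ 2], since the [zc i] are orthogonal. *)
Lemma sumsq_ge l : sys D l ->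
  (\esum_(i in I) (alpha i ^+ 2 / (k i)%:R ^+ 2)%:E <= (sumsq tD l)%:E)%E.
Proof.
move=> [lP lu lo lf]; rewrite /esum; apply: ge_ereal_sup => _ [J [Jf JI] <-].
rewrite fsbig_finite // sumEFin lee_fin.
set s : seq nat := fset_set J.
have us : uniq s := fset_uniq _.
have sI i : i \in s -> I i by rewrite in_fset_set // inE => /JI.
apply: (@le_trans _ _ (\sum_(i <- s) \sum_(g <- l) tD (zc i * g) ^+ 2)).
  rewrite big_seq [X in _ <= X]big_seq; apply: ler_sum => i /sI Ii.
  have [g [gl hg]] : exists g, g \in l /\ zc i * g <> 0.
    apply: contrapT => h.
    have : zc i * 1 = 0; last first.
      rewrite mulr1 => /(congr1 (@bval _ _)); rewrite zcE // => z0'.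
      have := ad_rho_inj had Ii (etrans z0' (esym (rho0 Ii))).
      move/matrixP => /(_ (Ordinal (ad_size had Ii)) (Ordinal (ad_size had Ii))).
      by rewrite !mxE eqxx => /eqP; rewrite oner_eq0.
    apply: (lf (fun y => zc i * y = 0)) => [x y hx hy|a b Da Db].
      by rewrite mulrDr hx hy addr0.
    rewrite !mulrA zc_comm // -(mulrA a).
    suff -> : zc i * tot l = 0 by rewrite mulr0 mul0r.
    rewrite /tot mulr_sumr big_seq big1 // => g gl; apply: contrapT => hg.
    by apply: h; exists g.
  rewrite (bigD1_seq g) //= -[X in X <= _]addr0 lerD //.
    have [Dg pg _] := lP g gl; have h := corner_trace Ii Dg pg hg.
    by rewrite -expr_div_n ler_sqr ?nnegrE // ?divr_ge0 ?ler0n // ?(ltW (ad_weight had Ii)) //;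
      apply: le_trans h; rewrite divr_ge0 ?ler0n // ltW // (ad_weight had Ii).
  by apply: sumr_ge0 => *; apply: sqr_ge0.
rewrite exchange_big /= /sumsq big_seq [X in _ <= X]big_seq; apply: ler_sum => g /lP[Dg pg _].
have [Dz pz cz] := zc_sum us sI.
have zg0 i : i \in s -> 0 <= tD (zc i * g).
  move=> /sI Ii; have [pzg _] := proj_comm_mul (zc_proj Ii) pg (zc_comm Ii Dg).
  by apply: (nf_ge0 ntD) => //; apply: (vnaM hD) => //; exact: zc_in.
apply: (@le_trans _ _ ((\sum_(i <- s) tD (zc i * g)) ^+ 2)).
  rewrite expr2 mulr_suml big_seq [X in _ <= X]big_seq; apply: ler_sum => i is_.
  rewrite expr2 ler_wpM2l ?zg0 // (bigD1_seq i) //= lerDl big_seq_cond.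
  by apply: sumr_ge0 => j /andP[js _]; apply: zg0.
have e : \sum_(i <- s) tD (zc i * g) = tD ((\sum_(i <- s) zc i) * g).
  rewrite mulr_suml (nf_sum hD ntD) // => i /sI Ii.
  by apply: (vnaM hD) => //; exact: zc_in.
have [pzg lzg] := proj_comm_mul pz pg (cz g Dg).
have Dzg := vnaM hD Dz Dg.
have := nf_ple hD ntD Dzg Dg pzg pg lzg; rewrite -e => h.
rewrite ler_sqr ?nnegrE //; last by apply: le_trans h; rewrite e; apply: (nf_ge0 ntD).
by rewrite e; apply: (nf_ge0 ntD).
Qed.

End lower.

(** * Hyperfinite algebras *)

Section chain.
Context {R : realType} {H1 H2 K : hilbertType R}.
Local Notation C := R[i].
Variables (A : set (bop H1)) (t : bop H1 -> R) (D : set (bop H2)) (tD : bop H2 -> R)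
  (B : set (bop K)) (tB : bop K -> R) (F : bop H1 -> bop K) (G : bop H2 -> bop K).
Hypotheses (hII : II1 A t) (hD : vna D) (htD : trace D tD) (hB : vna B) (htB : trace B tB)
  (hF : emb A t B tB F) (hG : emb D tD B tB G).
Hypothesis hfree : forall z q, B z -> sa z -> (forall x, A x -> z * F x = F x * z) ->
  D q -> isproj q -> tB (z * G q) = tB z * tB (G q).
Let hA := ii_vna hII.
Let ht := ii_tr hII.
Let nt := tr_nfun ht.
Implicit Types (Y Z S : set (bop K)) (E : set (bop H2)) (c s r : R).
Local Notation Reach := (Reach A t B F).
Local Notation over := (over A B F).

Lemma reach_ge0 Y Z c : Reach Y Z c -> 0 <= c.
Proof.
move=> h; rewrite leNgt; apply/negP => c0.
have [|d d0 hd] := h (- c / 2); first by lra.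
have [e [Ae pe e0 _ te]] : exists e, [/\ A e, isproj e, e <> 0, ple e 1 & t e <= d / 2].
  apply: (small_proj hII (vna1 hA) isproj1); last by rewrite divr_gt0.
  by move=> h1; have := tr1 ht; rewrite h1 (nf0 hA nt) => /eqP; rewrite eq_sym oner_eq0.
have te0 := tr_gt0 ht Ae pe e0.
have [|L [_ hL _]] := hd e Ae pe; first by apply/andP; split=> //; lra.
have : 0 <= (size L)%:R * t e ^+ 2 by rewrite mulr_ge0 ?ler0n ?sqr_ge0.
by lra.
Qed.

(** Translates generation inside [B] into generation by star subalgebras of [D], the form in which
    [stage] takes its hypotheses. *)
Lemma pull_salg S : over set0 S -> salg [set x | D x /\ S (G x)].
Proof.
move=> [hS _ _ _]; split.
- by split; [exact: (vna1 hD)|rewrite (em_1 hG); exact: (vna1 hS)].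
- move=> c x y [Dx Sx] [Dy Sy]; split; first exact: (vna_lin hD).
  by rewrite (em_lin hG) //; apply: (vna_lin hS).
- move=> x y [Dx Sx] [Dy Sy]; split; first exact: (vnaM hD).
  by rewrite (em_mul hG) //; apply: (vnaM hS).
- move=> x [Dx Sx]; split; first exact: (vna_star hD).
  by rewrite (em_star hG) //; apply: (vna_star hS).
Qed.

Lemma over0 Y S : over Y S -> over set0 S.
Proof. by case=> h1 h2 h3 _; split. Qed.

Lemma reach_stage E E' l : fda E -> fda E' -> E `<=` E' -> E' `<=` D -> sys E l ->
  exists2 l', sys E' l' & Reach (G @` E) (G @` E') ((sumsq tD l - sumsq tD l') / 2).
Proof.
pose RR (Y Z : set (bop H2)) c := Z `<=` D /\ (Y `<=` D -> Reach (G @` Y) (G @` Z) c).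
move=> fE fE' EE ED sl.
suff [l' sl' [_ h]] : exists2 l', sys E' l' & RR E E' ((sumsq tD l - sumsq tD l') / 2).
  by exists l' => //; apply: h; apply: subset_trans ED.
have sub (Y : set (bop H2)) S : over (G @` Y) S -> Y `<=` D -> Y `<=` [set x | D x /\ S (G x)].
  by move=> [_ _ _ YS] YD y Yy; split; [exact: YD|apply: YS; exists y].
have TD S : [set x | D x /\ S (G x)] `<=` D by move=> x [].
have img S (Z : set (bop H2)) : Z `<=` [set x | D x /\ S (G x)] -> G @` Z `<=` S.
  by move=> h _ [z /h[_ ?] <-].
apply: (stage hD htD (RR := RR)) => //.
- move=> Y Z c ZD c0 h; split=> // YD; apply: reach_refl => // S oS.
  by apply: img; apply: (h _ (pull_salg (over0 oS)) (@TD S) (sub _ _ oS YD)).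
- move=> Y Z Z' c c' [ZD h] [Z'D h']; split=> // YD; apply: (reach_trans (h YD)).
  by rewrite -image_setU; apply: h'; rewrite subUset.
- move=> Y Z Z' c [ZD h] Z'D hh; split=> // YD; apply: reach_alg (h YD) _ => S oS ZS.
  apply: img; apply: (hh _ (pull_salg (over0 oS)) (@TD S) (sub _ _ oS YD)).
  by move=> z Zz; split; [exact: ZD|apply: ZS; exists z].
- move=> Y q q' YD Yq Dq' pq pq' le; split=> [_ ->//|_].
  have := reach_split hII hD htD hB htB hF hG hfree (YD _ Yq) Dq' pq pq' le.
  by rewrite image_set1; apply: reach_mono => _ ->; exists q.
- move=> Y q q' e YD Yq Yq' De pq pq' e1 e2; split=> [_ ->//|_].
  have := reach_merge hII hD htD hB htB hF hG hfree (YD _ Yq) (YD _ Yq') De pq pq' e1 e2.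
  by rewrite image_set1; apply: reach_mono => _ [->|->]; [exists q|exists q'].
Qed.

Lemma scalar_sys : sys [set x : bop H2 | exists c : C, x = c *: (1 : bop H2)] [:: 1].
Proof.
split.
- move=> x; rewrite mem_seq1 => /eqP ->; split; [by exists 1; rewrite scale1r|exact: isproj1|].
  by move=> h1; have := tr1 htD; rewrite h1 (nf0 hD (tr_nfun htD)) => /eqP; rewrite eq_sym oner_eq0.
- by [].
- by move=> x y; rewrite !mem_seq1 => /eqP -> /eqP ->.
- move=> J JD Jab; rewrite -[1]mulr1 -[X in X * _]mulr1; have e : tot [:: (1 : bop H2)] = 1 by rewrite /tot big_seq1.
  by rewrite -[X in _ * X * _]e; apply: Jab; exists 1; rewrite scale1r.
Qed.

Lemma scalar_fda : fda [set x : bop H2 | exists c : C, x = c *: (1 : bop H2)].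
Proof.
split; first split.
- by exists 1; rewrite scale1r.
- by move=> c _ _ [a ->] [b ->]; exists (c * a + b); rewrite scalerDl scalerA.
- by move=> _ _ [a ->] [b ->]; exists (a * b); rewrite -bscaleAl mul1r scalerA.
- by move=> _ [a ->]; exists (Num.conj a); rewrite starZ star1.
- exists 1%N, (fun _ => idfun) => _ [c ->]; exists (fun _ => c).
  by rewrite big_ord_recl big_ord0 addr0.
Qed.

(** [v n] is the sum of squares for the list at stage n, starting from the list [[:: 1]] of the
    scalars. The costs telescope, and the lower bound [b] is what later makes the cost of the tail
    small. *)
Lemma reach_chain (E : nat -> set (bop H2)) (b : R) : (forall n, fda (E n)) -> (forall n, E n `<=` E n.+1) ->
  (forall n, E n `<=` D) -> (forall l, sys D l -> b <= sumsq tD l) ->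
  exists v : nat -> R, [/\ forall n, b <= v n, forall n, Reach set0 (G @` E n) ((1 - v n) / 2) &
    forall n m, (n <= m)%N -> Reach (G @` E n) (G @` E m) ((v n - v m) / 2)].
Proof.
move=> fE EE ED hb.
have sD n l : sys (E n) l -> sys D l.
  move=> [lP lu lo lf]; split=> //; first by move=> x /lP[/ED].
  exact: full_mono lf.
have [l0 s0 r0] : exists2 l, sys (E 0%N) l & Reach set0 (G @` E 0%N) ((1 - sumsq tD l) / 2).
  have [|l sl r] := reach_stage scalar_fda (fE 0%N) _ (@ED _) scalar_sys.
    by move=> _ [c ->]; apply: (sgZ (fd_salg (fE 0%N))); apply: (sg1 (fd_salg (fE 0%N))).
  exists l => //; rewrite -[_ / 2]add0r.
  apply: (reach_trans (Z := G @` [set x : bop H2 | exists c : C, x = c *: (1 : bop H2)])).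
    apply: reach_refl => // S [hS _ _ _] _ [_ [c ->] <-].
    by rewrite (emZ hD hG) ?(em_1 hG); [apply: (vnaZ hS); exact: (vna1 hS)|exact: (vna1 hD)].
  have e1 : sumsq tD [:: (1 : bop H2)] = 1 by rewrite /sumsq big_seq1 (tr1 htD) expr1n.
  by rewrite e1 in r; apply: reach_mono r => x; right.
have step (p : nat * seq (bop H2)) : exists l', sys (E p.1) p.2 ->
    sys (E p.1.+1) l' /\ Reach (G @` E p.1) (G @` E p.1.+1) ((sumsq tD p.2 - sumsq tD l') / 2).
  have [h|h] := EM (sys (E p.1) p.2); last by exists [::].
  by have [l' ? ?] := reach_stage (fE _) (fE _) (EE p.1) (@ED _) h; exists l'.
have [s hs] := choice step.
pose l_ := fix l_ n := if n is m.+1 then s (m, l_ m) else l0.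
have sl n : sys (E n) (l_ n) by elim: n => [//|n IH]; apply: (hs (n, l_ n) IH).1.
have rl n := (hs (n, l_ n) (sl n)).2.
exists (fun n => sumsq tD (l_ n)); split.
- by move=> n; apply: hb; apply: sD (sl n).
- elim=> [//|n IH]; have -> : (1 - sumsq tD (l_ n.+1)) / 2 =
    (1 - sumsq tD (l_ n)) / 2 + (sumsq tD (l_ n) - sumsq tD (l_ n.+1)) / 2 by field.
  by apply: reach_trans IH _; apply: reach_mono (rl n) => x; right.
- move=> n m /subnK <-; elim: (m - n)%N => [|j IH].
    by rewrite add0n subrr mul0r; apply: reach_refl => // S [].
  rewrite addSn; set k := (j + n)%N in IH *.
  have -> : (sumsq tD (l_ n) - sumsq tD (l_ k.+1)) / 2 =
    (sumsq tD (l_ n) - sumsq tD (l_ k)) / 2 + (sumsq tD (l_ k) - sumsq tD (l_ k.+1)) / 2 by field.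
  by apply: reach_trans IH _; apply: reach_mono (rl k) => x; right.
Qed.
End chain.

Section series.
Context {R : realType} {K : hilbertType R}.

Lemma series_ex (z : nat -> bop K) : (forall n u, nrm (z n u) <= 2^-1 ^+ n * nrm u) ->
  exists x, sconv (fun n => \sum_(i < n) z i) x.
Proof.
move=> hz.
have hd m j u : nrm ((\sum_(i < (j + m)%N) z i) u - (\sum_(i < m) z i) u) <=
    2 * (2^-1 ^+ m - 2^-1 ^+ (j + m)) * nrm u.
  elim: j => [|j IH]; first by rewrite !subrr nrm0 mulr0 mul0r.
  rewrite addSn big_ord_recr bopD addrAC; apply: le_trans (nrmD _ _) _.
  apply: le_trans (lerD IH (hz _ u)) _; rewrite -mulrDl ler_wpM2r ?nrm_ge0 //.
  by rewrite exprS; lra.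
have h0 n u : nrm ((\sum_(i < n) z i) u) <= 2 * nrm u.
  have := hd 0%N n u; rewrite addn0 big_ord0 bop0 subr0 => /le_trans; apply.
  rewrite ler_wpM2r ?nrm_ge0 // expr0; have : 0 <= (2^-1 : R) ^+ n by rewrite exprn_ge0.
  lra.
have [u|x hx _] := slim_ex h0; last by exists x.
move=> e e0; pose b := 2 * nrm u + 1.
have b0 : 0 < b by rewrite ltr_wpDl ?mulr_ge0 ?nrm_ge0.
have [N hN] : exists N, 2^-1 ^+ N * b < e.
  have : (fun n => 2^-1 ^+ n : R) @ \oo --> (0 : R) by apply: cvg_expr; rewrite gtr0_norm; lra.
  move/cvgrPdist_lt => /(_ (e / b) (divr_gt0 e0 b0)) [N _ /(_ N (leqnn N))].
  rewrite /= sub0r normrN ger0_norm ?exprn_ge0 // ltr_pdivlMr // => h.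
  by exists N.
exists N => m n Nm /subnK <-; apply: le_lt_trans (hd m (n - m)%N u) _.
apply: le_lt_trans hN; rewrite /b.
have mN : (2^-1 : R) ^+ m <= 2^-1 ^+ N by apply: ler_wiXn2l => //; lra.
have p0 : 0 <= (2^-1 : R) ^+ (n - m + m) by rewrite exprn_ge0.
have p1 : 0 <= (2^-1 : R) ^+ m by rewrite exprn_ge0.
have := nrm_ge0 u; move: (_ ^+ m) (_ ^+ (n - m + m)) (_ ^+ N) (nrm u) mN p0 p1 => x1 x2 x3 x4 *; nra.
Qed.
End series.

(** * Encoding the tail of the chain in one element *)

Section tail.
Context {R : realType} {H1 K : hilbertType R}.
Local Notation C := R[i].
Variables (A : set (bop H1)) (t : bop H1 -> R)
  (B : set (bop K)) (tB : bop K -> R) (F : bop H1 -> bop K).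
Hypotheses (hII : II1 A t) (hB : vna B) (hF : emb A t B tB F).
Let hA := ii_vna hII.
Let ht := ii_tr hII.
Let nt := tr_nfun ht.
Implicit Types (Y Z S : set (bop K)) (c s r : R).
Local Notation Reach := (Reach A t B F).
Local Notation over := (over A B F).

(* The corner [h B h] is an [n] x [n] matrix algebra over a small corner [e B e]: the [n^2] elements
   of [e B e] can be stored as the entries of one matrix. *)
Lemma slot Y Z c h : Reach Y Z c -> A h -> isproj h -> 0 < t h -> c < t h ^+ 2 ->
  exists z, [/\ B z, F h * z = z, z * F h = z & forall S, over Y S -> S z -> Z `<=` S].
Proof.
move=> hR Ah ph th ch; have [|d d0 hd] := hR (t h ^+ 2 - c); first by lra.
(* With tolerance [t h ^+ 2 - c] and pieces of trace [t h / n%:R], the area bound on [L] says that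
   [L] has at most [n * n] elements. *)
have [n n0 nd] : exists2 n, (0 < n)%N & t h / n%:R < d.
  exists (Num.truncn (t h / d)).+1 => //; rewrite ltr_pdivrMr ?ltr0n //.
  by rewrite mulrC -ltr_pdivrMr //; apply: truncnS_gt.
have nR : 0 < n%:R :> R by rewrite ltr0n.
pose s := t h / n%:R.
have s0 : 0 < s by rewrite divr_gt0.
have [|e [e1 e2 e3]] := pieces hII (k := n) (s := s) Ah ph (ltW s0).
  by rewrite /s mulrC divfK // gt_eqF.
have [Ae0 pe0 le0 te0] := e1 0%N n0.
have [|L [L1 L2 L3]] := hd _ Ae0 pe0; first by rewrite te0 s0.
have sL : (size L <= n * n)%N.
  move: L2; rewrite te0 -[c + _]addrC subrK /s expr_div_n => L2.
  rewrite -(ler_nat R) natrM -(ler_pM2r (x := t h ^+ 2 / n%:R ^+ 2)).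
    by apply: le_trans L2 _; rewrite -expr2 mulrC divfK // gt_eqF ?exprn_gt0.
  by rewrite divr_gt0 ?exprn_gt0.
have exv i : exists v, (i < n)%N -> [/\ A v, v^'* * v = e i & v * v^'* = e 0%N].
  have [ni|_] := ltnP i n; last by exists 0.
  have [Ai pi _ ti] := e1 i ni.
  by have [|v hv] := fac_mvn hII Ai Ae0 pi pe0; [rewrite ti te0|exists v].
have [v hv] := choice exv.
have F0 := em_proj hF Ae0 pe0.
have L0 i : F (e 0%N) * L`_i = L`_i /\ L`_i * F (e 0%N) = L`_i.
  have [iL|iL] := ltnP i (size L); first by have [] := L1 _ (mem_nth 0 iL).
  by rewrite nth_default // mulr0 mul0r.
have BL i : B (L`_i).
  have [iL|iL] := ltnP i (size L); first by have [] := L1 _ (mem_nth 0 iL).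
  by rewrite nth_default //; exact: (vna0 hB).
pose w i := F (v i).
have w1 i : (i < n)%N -> [/\ B (w i), w i * F h = w i & w i * (w i)^'* = F (e 0%N)].
  move=> ni; have [Av v1 v2] := hv i ni; have [Ai pi li _] := e1 i ni; split.
  - exact: (em_into hF).
  - rewrite /w -(em_mul hF) // -(pi_r pi v1) -mulrA; congr (F (_ * _)); exact: li.
  - by rewrite /w -(em_star hF) // -(em_mul hF) ?v2 //; exact: (vna_star hA).
have w2 i j : (i < n)%N -> (j < n)%N -> i <> j -> w i * (w j)^'* = 0.
  move=> ni nj ij; have [Av v1 v2] := hv i ni; have [Aj vj1 vj2] := hv j nj.
  have [Ai pi _ _] := e1 i ni; have [_ pj _ _] := e1 j nj.
  rewrite /w -(em_star hF) // -(em_mul hF) //; last exact: (vna_star hA).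
  rewrite -(pi_r pi v1) -(pi_r pj vj1) starM pj.1 mulrA -(mulrA (v i)) e2 //; last exact/eqP.
  by rewrite mulr0 mul0r (em0 hA hF).
(* Row-major storage, decoded below by quotient and remainder of the index; the slots past the end
   of [L] hold the default 0. *)
pose z := \sum_(a < n) \sum_(b < n) (w a)^'* * L`_(a * n + b) * w b.
have Sw S a : over Y S -> (a < n)%N -> S (w a).
  by move=> [_ _ FS _] /hv[Av _ _]; apply: FS.
exists z; split.
- apply: (vna_sum hB) => a _; apply: (vna_sum hB) => b _.
  have [Ba _ _] := w1 a (ltn_ord a); have [Bb _ _] := w1 b (ltn_ord b); have := BL (a * n + b)%N.
  by move=> *; vna_tac hB.
- rewrite mulr_sumr; apply: eq_bigr => a _; rewrite mulr_sumr; apply: eq_bigr => b _.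
  have [_ wa _] := w1 a (ltn_ord a); rewrite !mulrA; congr (_ * _ * _).
  by apply: star_inj; rewrite starM starK (em_proj hF Ah ph).1.
- rewrite mulr_suml; apply: eq_bigr => a _; rewrite mulr_suml; apply: eq_bigr => b _.
  by have [_ wb _] := w1 b (ltn_ord b); rewrite -mulrA wb.
- move=> S oS Sz; apply: L3 => // y yL; have [hS _ _ _] := oS.
  have iL := index_mem y L; rewrite yL in iL.
  have := nth_index 0 yL; set i := index y L in iL *; move=> yE.
  have ni : (i < n * n)%N by apply: leq_trans sL.
  have an : (i %/ n < n)%N by rewrite ltn_divLR.
  have bn : (i %% n < n)%N by rewrite ltn_mod.
  have -> : y = w (i %/ n)%N * z * (w (i %% n)%N)^'*.
    rewrite mulr_sumr mulr_suml (bigD1 (Ordinal an)) //= [X in _ + X]big1 ?addr0.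
      rewrite mulr_sumr mulr_suml (bigD1 (Ordinal bn)) //= [X in _ + X]big1 ?addr0.
        rewrite -divn_eq yE !mulrA; have [_ _ ->] := w1 _ an.
        rewrite -!mulrA; have [_ _ ->] := w1 _ bn.
        by rewrite -yE; case: (L0 i) => h1 h2; rewrite h2 h1.
      move=> b /eqP nb; rewrite -!mulrA w2 ?mulr0 // => bE; apply: nb; exact: val_inj.
    move=> a /eqP na; rewrite mulr_sumr mulr_suml big1 // => b _.
    rewrite !mulrA w2 ?mul0r // => aE; apply: na; exact: val_inj.
  apply: (vnaM hS); [apply: (vnaM hS) => //|apply: (vna_star hS)]; exact: Sw oS _.
Qed.

Lemma halving e : A e -> isproj e -> 0 < t e -> exists h : nat -> bop H1,
  [/\ forall n, [/\ A (h n), isproj (h n), ple (h n) e & 0 < t (h n)] &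
   forall n m, n <> m -> h n * h m = 0].
Proof.
move=> Ae pe te0.
have ex p : exists q, A p -> isproj p -> [/\ A q, isproj q, ple q p & t q = t p / 2].
  have [[Ap pp]|h] := EM (A p /\ isproj p); last by exists 0 => ? ?; case: h.
  have tp := nf_ge0 nt Ap pp.
  by have [|q hq] := sub_trace hII (s := t p / 2) Ap pp; [apply/andP; split; lra|exists q].
have [f hf] := choice ex; pose r n := iter n f e.
have hr n : [/\ A (r n), isproj (r n), ple (r n) e & 0 < t (r n)].
  elim: n => [|n [Ar pr lr tr]]; first by split=> //; exact: ple_refl.
  have [A' p' l' t'] := hf _ Ar pr; split=> //; first exact: ple_trans l' lr.
  by rewrite [t _]t' divr_gt0.
have hs n : ple (r n.+1) (r n) /\ t (r n.+1) = t (r n) / 2.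
  by have [Ar pr _ _] := hr n; have [] := hf _ Ar pr.
have le_r n m : (n <= m)%N -> ple (r m) (r n).
  move=> /subnK <-; elim: (m - n)%N => [|j IH]; first by have [_ ? _ _] := hr n; exact: ple_refl.
  by rewrite addSn; apply: ple_trans (hs _).1 IH.
pose h n := r n - r n.+1.
have hh n : [/\ A (h n), isproj (h n), ple (h n) (r n) & h n * r n.+1 = 0].
  have [Ar pr _ _] := hr n; have [Ar' pr' _ _] := hr n.+1; have [l _] := hs n.
  split; [exact: (vnaB hA)|exact: ple_sub|exact: ple_subl|].
  by have [] := ple_sub_orth pr' pr l.
have lt0 n m : (n < m)%N -> h n * h m = 0.
  move=> nm; have [_ ph lh _] := hh m; have [_ _ _ o] := hh n.
  have [_ pr _ _] := hr n.+1.
  have l := ple_trans lh (le_r _ _ nm).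
  by rewrite -(ple_r ph pr l) mulrA o mul0r.
exists h; split=> [n|n m /eqP].
  have [Ah ph lh _] := hh n; have [Ar _ lr tr] := hr n; have [Ar' _ _ _] := hr n.+1.
  split=> //; first exact: ple_trans lh lr.
  by rewrite (nfB hA nt) // (hs n).2; lra.
rewrite neq_ltn => /orP[/lt0//|/lt0 o].
by have [_ [ph _] _ _] := hh n; have [_ [pm _] _ _] := hh m; apply: orth_sym o.
Qed.

Lemma tail_ex (v : nat -> R) b : (forall n, b <= v n) -> (forall n m, (n <= m)%N -> v m <= v n) ->
  forall eps N, 0 < eps -> exists n, (N <= n)%N /\ forall m, (n <= m)%N -> v n - v m < eps.
Proof.
move=> vb vn eps N e0.
have hi : has_inf (range v) by split; [exists (v 0%N), 0%N|exists b => _ [n _ <-]].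
have [_ [n _ <-] hn] := inf_adherent e0 hi.
exists (maxn n N); split=> [|m hm]; first exact: leq_maxr.
have h1 := vn _ _ (leq_maxl n N).
have h2 : inf (range v) <= v m by apply: ge_inf; [exact: hi.2|exists m].
lra.
Qed.

(** Stages are chosen so that the n-th step costs less than the squared trace of [h n], one of
    infinitely many orthogonal subprojections of [e], and it is stored there as [z n]. A convergent
    series of multiples of the [z n] is a single element; [F (h n)] cuts each term out again, and
    the stages are regained by induction. *)
Lemma tail (Z : nat -> set (bop K)) (v : nat -> R) b e : (forall n, b <= v n) ->
  (forall n m, (n <= m)%N -> Z n `<=` Z m) ->
  (forall n m, (n <= m)%N -> Reach (Z n) (Z m) ((v n - v m) / 2)) ->
  A e -> isproj e -> 0 < t e ->
  exists n y, [/\ B y, F e * y = y, y * F e = y &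
    forall S, over (Z n) S -> S y -> forall m, Z m `<=` S].
Proof.
move=> vb Zm hZ Ae pe te.
have vn n m : (n <= m)%N -> v m <= v n.
  by move=> /hZ/(reach_ge0 hII) ; lra.
have [h [h1 h2]] := halving Ae pe te.
have ex (p : nat * nat) : exists n, (p.2 <= n)%N /\ forall m, (n <= m)%N -> v n - v m < t (h p.1) ^+ 2.
  by apply: (tail_ex vb vn); rewrite exprn_gt0 //; case: (h1 p.1).
have [g hg] := choice ex.
pose k_ := fix k_ n := if n is m.+1 then g (n, (k_ m).+1) else g (0%N, 0%N).
have k1 n : (k_ n < k_ n.+1)%N by have [] := hg (n.+1, (k_ n).+1).
have k2 n m : (k_ n <= m)%N -> v (k_ n) - v m < t (h n) ^+ 2.
  by case: n => [|n]; [apply: (hg (0%N, 0%N)).2|apply: (hg (n.+1, (k_ n).+1)).2].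
have exz n : exists z, [/\ B z, F (h n) * z = z, z * F (h n) = z &
    forall S, over (Z (k_ n)) S -> S z -> Z (k_ n.+1) `<=` S].
  have [Ah ph _ th] := h1 n; apply: (slot (hZ _ _ (ltnW (k1 n)))) => //.
  have := k2 n _ (ltnW (k1 n)); have := vn _ _ (ltnW (k1 n)); lra.
have [z hz] := choice exz.
(* Scaling by a nonzero real does not change what [z n] generates, and makes the series converge. *)
have exl n : exists l : R, 0 < l /\ forall u, nrm ((l%:C *: z n) u) <= 2^-1 ^+ n * nrm u.
  have [c c0 hc] := bop_bound (z n); exists (2^-1 ^+ n / (c + 1)); split.
    by rewrite divr_gt0 ?exprn_gt0 ?ltr_wpDl.
  move=> u; rewrite bopZ nrmZr ger0_norm ?divr_ge0 ?exprn_ge0 ?addr_ge0 // -mulrA ler_wpM2l ?exprn_ge0 //.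
  rewrite mulrC ler_pdivrMr ?ltr_wpDl //; apply: le_trans (hc u) _.
  by have := nrm_ge0 u; move: (nrm u) => r; nra.
have [la hla] := choice exl.
have [y hy] := series_ex (fun n => (hla n).2).
have Fh n := h1 n.
have orth n m : n <> m -> F (h n) * z m = 0.
  move=> nm; have [_ <- _ _] := hz m; have [An _ _ _] := h1 n; have [Am _ _ _] := h1 m.
  by rewrite mulrA -(em_mul hF) // h2 // (em0 hA hF) mul0r.
have cut n : F (h n) * y * F (h n) = (la n)%:C *: z n.
  apply: sconv_unique (sconv_shift n.+1 (sconvMr (F (h n)) (sconvMl (F (h n)) hy))) _.
  apply: sconv_ext (sconv_cst _) => m.
  have nm : (n < m + n.+1)%N by rewrite addnS ltnS leq_addl.
  rewrite mulr_sumr (bigD1 (Ordinal nm)) //= big1 ?addr0.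
    by have [_ zl zr _] := hz n; rewrite -bscaleAr zl -bscaleAl zr.
  by move=> i /eqP ni; rewrite -bscaleAr orth ?scaler0 // => e1; apply: ni; apply: val_inj.
exists (k_ 0%N), y; split.
- apply: (vna_lim hB _ hy) => n; apply: (vna_sum hB) => i _; apply: (vnaZ hB); by case: (hz i).
- apply: sconv_unique (sconvMl (F e) hy) _; apply: sconv_ext hy => n.
  rewrite mulr_sumr; apply: eq_bigr => i _; rewrite -bscaleAr.
  have [_ <- _ _] := hz i; have [Ai pi li _] := h1 i.
  by rewrite mulrA -(em_mul hF) // (ple_r pi pe li).
- apply: sconv_unique (sconvMr (F e) hy) _; apply: sconv_ext hy => n.
  rewrite mulr_suml; apply: eq_bigr => i _; rewrite -bscaleAl.
  have [_ _ <- _] := hz i; have [Ai pi li _] := h1 i.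
  by rewrite -mulrA -(em_mul hF) // li.
- move=> S oS Sy; have [hS SB FS ZS] := oS.
  have Zk n : Z (k_ n) `<=` S.
    elim: n => [//|n IH]; have [_ _ _ hz4] := hz n; have [An _ _ _] := h1 n.
    apply: hz4; first by split.
    have Sl : S ((la n)%:C *: z n).
      by rewrite -cut; apply: (vnaM hS); [apply: (vnaM hS) => //|]; apply: FS.
    have l0 : (la n)%:C != 0 :> C by apply/eqP => -[] l0; have := (hla n).1; rewrite l0 ltxx.
    by have := vnaZ hS (la n)%:C^-1 Sl; rewrite scalerA mulVf // scale1r.
  move=> m; apply: subset_trans (Zk m); apply: Zm.
  by elim: m => [//|m IH]; apply: leq_ltn_trans IH (k1 m).
Qed.

End tail.

(** * Cut weights *)

Section weight.
Context {R : realType} {H : hilbertType R}.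
Local Notation C := R[i].
Implicit Types (x y p q e : bop H) (l : seq (bop H)) (B : set (bop H)) (t : bop H -> R).

Definition part B l := [/\ forall p, p \in l -> B p /\ isproj p, uniq l, orthl l & tot l = 1].

Definition cost t x p q : R := if p * x * q == 0 then 0 else t p * t q.
Definition weight t x l := \sum_(p <- l) \sum_(q <- l) cost t x p q.

Lemma part_refine B p e l : vna B -> part B l -> p \in l -> B e -> isproj e -> ple e p ->
  e <> 0 -> e <> p -> part B [:: e, p - e & rem p l].
Proof.
move=> hB [lP lu lo l1] pl Be pe lep e0 ep.
have lp x : x \in l -> isproj x by case/lP.
have [u o] := refine_orthl lu lo lp pl pe lep e0 ep; split=> //.
  move=> x; rewrite !inE => /predU1P[->//|/predU1P[->|/mem_rem/lP//]].
  have [Bp pp] := lP _ pl; split; [exact: (vnaB hB)|exact: ple_sub].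
by rewrite -l1 (tot_rem pl) /tot !big_cons addrA [e + _]addrC subrK.
Qed.

(** A nonzero block of cost t(p) t(q) splits into blocks of the same total cost at most, and a zero
    block splits into zero blocks. *)
Lemma weight_refine B t x p e l : vna B -> trace B t -> part B l -> p \in l -> B e -> isproj e ->
  ple e p -> weight t x [:: e, p - e & rem p l] <= weight t x l.
Proof.
move=> hB ht [lP lu lo l1] pl Be pe lep; have nt := tr_nfun ht.
have [Bp pp] := lP _ pl.
have te := nf_ge0 nt Be pe.
have pd := ple_sub pe pp lep; have ld := ple_subl pe pp lep.
have td := nf_ge0 nt (vnaB hB Bp Be) pd.
have tp : t (p - e) = t p - t e by rewrite (nfB hB nt).
have posl q : q \in l -> 0 <= t q by move=> /lP[? ?]; apply: (nf_ge0 nt).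
have pos q : q \in [:: e, p - e & rem p l] -> 0 <= t q.
  by rewrite !inE => /predU1P[->//|/predU1P[->//|/mem_rem/posl]].
have cle a b : 0 <= t a -> 0 <= t b -> cost t x a b <= t a * t b.
  by rewrite /cost; case: ifP => // _ *; apply: mulr_ge0.
have subl q : 0 <= t q -> cost t x e q + cost t x (p - e) q <= cost t x p q.
  move=> tq; have [h|h] := eqVneq (p * x * q) 0.
    have eh : e * x * q = 0 by rewrite -lep -(mulrA e) -mulrA h mulr0.
    by rewrite /cost mulrBl mulrBl h eh subrr eqxx /= addr0.
  have -> : cost t x p q = t p * t q by rewrite /cost (negbTE h).
  by have := lerD (cle _ _ te tq) (cle _ _ td tq); rewrite tp; lra.
have subr q : 0 <= t q -> cost t x q e + cost t x q (p - e) <= cost t x q p.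
  move=> tq; have [h|h] := eqVneq (q * x * p) 0.
    have eh : q * x * e = 0 by rewrite -(ple_r pe pp lep) mulrA h mul0r.
    by rewrite /cost mulrBr h eh subrr eqxx /= addr0.
  have -> : cost t x q p = t q * t p by rewrite /cost (negbTE h).
  by have := lerD (cle _ _ tq te) (cle _ _ tq td); rewrite tp; lra.
have sum (h : bop H -> R) : h e + h (p - e) <= h p -> \sum_(q <- [:: e, p - e & rem p l]) h q <= \sum_(q <- l) h q.
  by move=> hh; rewrite !big_cons addrA (perm_big _ (perm_to_rem pl)) big_cons lerD2r.
rewrite /weight; apply: (@le_trans _ _ (\sum_(q <- [:: e, p - e & rem p l]) \sum_(r <- l) cost t x q r)).
  rewrite big_seq [X in _ <= X]big_seq; apply: ler_sum => q /pos tq; exact: sum (subr q tq).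
rewrite exchange_big [X in _ <= X]exchange_big /=.
rewrite big_seq [X in _ <= X]big_seq; apply: ler_sum => q /posl tq; exact: sum (subl q tq).
Qed.

Lemma weight_corner B t x e l : vna B -> trace B t -> part B l -> e \in l ->
  e * x = x -> x * e = x -> weight t x l <= t e ^+ 2.
Proof.
move=> hB ht [lP lu lo l1] el ex xe.
have z q : q \in l -> q != e -> q * x = 0 /\ x * q = 0.
  move=> ql /eqP qe; split; first by rewrite -ex mulrA (lo q e) ?mul0r.
  by rewrite -xe -mulrA (lo e q) ?mulr0 // => h; apply: qe.
rewrite /weight (bigD1_seq e) //= [X in _ + X]big_seq_cond [X in _ + X]big1 ?addr0; last first.
  by move=> q /andP[ql qe]; rewrite big1 // => r _; rewrite /cost (z q ql qe).1 mul0r eqxx.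
rewrite (bigD1_seq e) //= [X in _ + X]big_seq_cond [X in _ + X]big1 ?addr0; last first.
  by move=> q /andP[ql qe]; rewrite /cost -mulrA (z q ql qe).2 mulr0 eqxx.
by rewrite /cost; case: ifP => // _; apply: sqr_ge0.
Qed.

Lemma cut_weightE (tau : op H -> C) x (P : {fset (op H)}) l :
  perm_eq P [seq bval p | p <- l] -> cut_weight tau (bval x) P = weight (retr tau) x l.
Proof.
move=> Pl; rewrite /cut_weight (perm_big _ Pl) big_map /weight; apply: eq_bigr => p _.
rewrite (perm_big _ Pl) big_map [LHS]big_mkcond; apply: eq_bigr => q _.
rewrite /cost; have -> : (bval p \o bval x \o bval q != 0) = (p * x * q != 0) by [].
by rewrite if_neg.
Qed.

Lemma part_fset (M : set (op H)) (P : {fset (op H)}) : von_neumann_algebra M -> proj_partition M P ->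
  exists2 l, perm_eq P [seq bval p | p <- l] & part (lift M) l.
Proof.
move=> vM [PM Po P1]; pose l := [seq insubd (0 : bop H) w | w <- enum_fset P].
have bP (p : op H) : p \in P -> bval (insubd (0 : bop H) p) = p.
  move=> pP; rewrite [LHS]val_insubd ifT //; apply/asboolP/(ssa_bounded vM.1.1).
  by have [] := PM p pP.
have ml : [seq bval p | p <- l] = enum_fset P.
  rewrite -map_comp; apply: map_id_in => w wP; exact: bP.
exists l; first by rewrite ml.
have lP p : p \in l -> bval p \in P by move=> /(map_f (@bval _ _)); rewrite ml.
split.
- move=> p /lP /PM[Mp [_ ap pp]]; split=> //; split; apply: val_inj; last exact: pp.
  by rewrite /= -adj_star.
- by apply: (@map_uniq _ _ (@bval _ _)); rewrite ml fset_uniq.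
- move=> p q /lP hp /lP hq pq; apply: val_inj; apply: Po => //.
  by apply/eqP => h; apply: pq; apply: val_inj.
- apply: val_inj; rewrite -[RHS]P1 -[in RHS]ml big_map; exact: bval_sum.
Qed.

Lemma fset_part (M : set (op H)) l : part (lift M) l ->
  exists2 P : {fset (op H)}, proj_partition M P & perm_eq P [seq bval p | p <- l].
Proof.
move=> [lP lu lo l1]; pose P : {fset (op H)} := seq_fset tt [seq bval p | p <- l].
have um : uniq [seq bval p | p <- l] by rewrite map_inj_uniq //; exact: val_inj.
have Pl : perm_eq P [seq bval p | p <- l] by have := seq_fset_perm tt [seq bval p | p <- l]; rewrite undup_id.
exists P => //; split.
- move=> p; rewrite (perm_mem Pl) => /mapP[q /lP[Mq [sq qq]] ->]; split=> //; split; first exact: bvalB.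
    by rewrite adj_star sq.
  by rewrite -bvalM qq.
- move=> p q; rewrite !(perm_mem Pl) => /mapP[a al ->] /mapP[b bl ->] ab.
  rewrite -bvalM lo // => h; by rewrite h eqxx in ab.
- by rewrite (perm_big _ Pl) big_map -bval_sum [X in bval X]l1.
Qed.

End weight.

(** * Generators of the free product *)

Section hyperfinite.
Context {R : realType} {H : hilbertType R}.
Local Notation C := R[i].
Implicit Types (x y : bop H) (A : set (op H)).

(** The algebras in [hyperfinite] may miss the identity, which [fda] asks for; adding the scalars
    keeps the dimension finite. *)
Definition unitize A : set (bop H) := [set x | exists (c : C) y, A (bval y) /\ x = y + c *: (1 : bop H)].

Lemma unitize_fda A : star_subalgebra A -> finite_dim A -> fda (unitize A).
Proof.
move=> hA [n [e he]]; split; first split.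
- by exists 1, 0; split; [exact: (ssa_zero hA)|rewrite scale1r add0r].
- move=> c _ _ [a [x [Ax ->]]] [b [y [Ay ->]]]; exists (c * a + b), (c *: x + y).
  split; first exact: (ssa_linear hA).
  by rewrite scalerDr scalerDl scalerA addrACA.
- move=> _ _ [a [x [Ax ->]]] [b [y [Ay ->]]]; exists (a * b), (a *: y + (b *: x + x * y)); split.
    apply: (ssa_linear hA) => //; apply: (ssa_linear hA) => //; exact: (ssa_mul hA).
  rewrite mulrDl !mulrDr -!bscaleAl !mul1r -bscaleAr mulr1 scalerA.
  by move: (x * y) (b *: x) (a *: y) ((a * b) *: _) => p q r s; ncring.
- move=> _ [a [x [Ax ->]]]; exists (Num.conj a), (x^'*); split; last by rewrite starD starZ star1.
  by rewrite /= -adj_star; apply: (ssa_adj hA).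
- exists n.+1, (fun i => if unlift ord0 i is Some j then e j else idfun) => _ [a [x [/he[c xc] ->]]].
  exists (fun i => if unlift ord0 i is Some j then c j else a).
  rewrite big_ord_recl unlift_none addrC [LHS]/= xc; congr (_ + _).
  by apply: eq_bigr => i _; rewrite liftK.
Qed.

Lemma unitize_sub A x : A (bval x) -> unitize A x.
Proof. by move=> Ax; exists 0, x; rewrite scale0r addr0. Qed.

Lemma unitize_mono A A' : A `<=` A' -> unitize A `<=` unitize A'.
Proof. by move=> AA x [c [y [/AA Ay ->]]]; exists c, y. Qed.

Lemma unitize_in A (Q : set (op H)) : von_neumann_algebra Q -> A `<=` Q -> unitize A `<=` lift Q.
Proof.
move=> vQ AQ x [c [y [/AQ Qy ->]]]; have hD := lift_vna vQ.
by apply: (vnaD hD) => //; apply: (vnaZ hD); apply: (vna1 hD).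
Qed.
End hyperfinite.

Lemma emb_inj (R : realType) (H K : hilbertType R) (A : set (bop H)) t B tB (F : bop H -> bop K) :
  vna A -> trace A t -> trace B tB -> emb A t B tB F ->
  forall x y, A x -> A y -> F x = F y -> x = y.
Proof.
move=> hA ht htB hF x y Ax Ay xy; apply: subr0_eq'.
have Axy := vnaB hA Ax Ay; apply: (tr_faith ht Axy).
have As := vna_star hA Axy.
rewrite -(em_tr hF) ?(em_mul hF) ?(emB hA hF) // ?xy ?subrr ?mulr0; last exact: (vnaM hA).
by rewrite -[in LHS](em0 hA hF) (em_tr hF) ?(nf0 hA (tr_nfun ht)) //; exact: (vna0 hA).
Qed.

Lemma part_map (R : realType) (H K : hilbertType R) (A : set (bop H)) t B tB (F : bop H -> bop K) l :
  vna A -> trace A t -> trace B tB -> emb A t B tB F -> part A l ->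
  part B [seq F p | p <- l] /\ forall x, A x -> weight tB (F x) [seq F p | p <- l] <= weight t x l.
Proof.
move=> hA ht htB hF [lP lu lo l1]; have nt := tr_nfun ht; split.
- split.
  + by move=> _ /mapP[p /lP[Ap pp] ->]; split; [exact: (em_into hF)|exact: (em_proj hF)].
  + rewrite map_inj_in_uniq // => p q /lP[Ap _] /lP[Aq _]; exact: emb_inj hF _ _ Ap Aq.
  + move=> _ _ /mapP[p pl ->] /mapP[q ql ->] pq; have [Ap _] := lP _ pl; have [Aq _] := lP _ ql.
    rewrite -(em_mul hF) // lo ?(em0 hA hF) // => e; by apply: pq; rewrite e.
  + rewrite /tot big_map -(em_sum hA hF) ?[X in F X]l1 ?(em_1 hF) // => p /lP[] //.
- move=> x Ax; rewrite /weight big_map big_seq [X in _ <= X]big_seq; apply: ler_sum => p /lP[Ap pp].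
  rewrite big_map big_seq [X in _ <= X]big_seq; apply: ler_sum => q /lP[Aq pq].
  have tp := nf_ge0 nt Ap pp; have tq := nf_ge0 nt Aq pq.
  rewrite /cost !(em_tr hF) //; case: ifPn => h1; case: ifPn => h2 //.
    by rewrite mulr_ge0.
  case/negP: h1; rewrite -!(em_mul hF) //; last exact: (vnaM hA).
  by rewrite (eqP h2) (em0 hA hF).
Qed.

Lemma ler_sum_sub (R : numDomainType) (I : eqType) (h : I -> R) (s s' : seq I) : uniq s ->
  {subset s <= s'} -> (forall i, 0 <= h i) -> \sum_(i <- s) h i <= \sum_(i <- s') h i.
Proof.
move=> + + h0; elim: s s' => [|i s IH] s' /=; first by rewrite big_nil sumr_ge0.
move=> /andP[is_ us] ss; have is' : i \in s' by apply: ss; rewrite mem_head.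
rewrite big_cons (perm_big _ (perm_to_rem is')) big_cons lerD2l; apply: IH => // j js.
have : j \in s' by apply: ss; rewrite inE js orbT.
rewrite (perm_mem (perm_to_rem is')) inE => /predU1P[ji|//].
by move: is_; rewrite -ji js.
Qed.

Section main.
Context {R : realType} {H1 H2 K : hilbertType R}.
Local Notation C := R[i].
Variables (M : set (op H1)) (tau : op H1 -> C) (Q : set (op H2)) (phi : op H2 -> C)
  (N : set (op K)) (tauN : op K -> C) (f : op H1 -> op K) (g : op H2 -> op K).
Hypotheses (hM : II1_factor M tau) (hQ : tracial_vN Q phi) (hQh : hyperfinite Q)
  (hN : tracial_vN N tauN) (hf : trace_embedding M tau N tauN f)
  (hg : trace_embedding Q phi N tauN g)
  (hfree : free_pair tauN (fun b => if b then f @` M else g @` Q))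
  (hgen : Wstar (f @` M `|` g @` Q) = N).
Local Notation A := (lift M).
Local Notation B := (lift N).
Local Notation t := (retr tau).
Local Notation tB := (retr tauN).
Local Notation F := (bmap f).
Local Notation G := (bmap g).

Lemma II1_tracial : tracial_vN M tau.
Proof. by case: hM => -[]. Qed.
Let hMt := II1_tracial.
Let hA := lift_vna hMt.1.
Let hB := lift_vna hN.1.
Let hD := lift_vna hQ.1.
Let ht := trace_lift hMt.
Let htB := trace_lift hN.
Let htD := trace_lift hQ.
Let hII := II1_lift hM.
Let hF := bmap_emb hMt hN hf.
Let hG := bmap_emb hQ hN hg.
Let nt := tr_nfun ht.

(** The tail element [y] lives in the corner of [e'] and the list [L] in that of a smaller [e].
    Refining the given partition by [e'] and then [e] does not raise the weights of the old
    generators, and it bounds the weight of [y] by [t e' ^+ 2] and that of each element of [L] by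
    [t e ^+ 2]. *)
Lemma generate (X : {fset op H1}) (s : R) (P : {fset op H1}) eps : 0 < eps ->
  (forall l, sys (lift Q) l -> s <= sumsq (retr phi) l) ->
  [set` X] `<=` M -> Wstar [set` X] = M -> proj_partition M P ->
  exists (Y P' : {fset op K}), [/\ [set` Y] `<=` N, Wstar [set` Y] = N, proj_partition N P' &
   \sum_(y <- Y) cut_weight tauN y P' <= \sum_(x <- X) cut_weight tau x P + (1 - s) / 2 + eps].
Proof.
move=> e0 hs XM WX hP.
have [E0 [hE Emono WE]] := hQh.
have E0Q n : E0 n `<=` Q.
  by move=> x Ex; rewrite -WE; apply: sub_gen_smallest; exists n.
pose E n := unitize (E0 n).
have EE n : E n `<=` E n.+1 by apply/unitize_mono/Emono.
have EE' n m : (n <= m)%N -> E n `<=` E m.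
  by move=> /subnK <-; elim: (m - n)%N => [//|j IH]; rewrite addSn; apply: subset_trans IH (EE _).
have [v [vs r0 rn]] := reach_chain hII hD htD hB htB hF hG (free_commutant hM hQ hN hf hg hfree)
  (fun n => unitize_fda (hE n).1 (hE n).2) EE (fun n => unitize_in hQ.1 (@E0Q n)) hs.
have [l0 Pl0 pl0] := part_fset hMt.1 hP.
have [lP lu lo l1] := pl0.
have [p0 p0l p00] : exists2 p, p \in l0 & p <> 0.
  apply: contrapT => h; have := tr1 ht; rewrite -l1 /tot big_seq big1 ?(nf0 hA nt) => [|p pl].
    by move/eqP; rewrite eq_sym oner_eq0.
  by apply: contrapT => hp; apply: h; exists p.
have [Ap pp] := lP _ p0l.
have small p (r : R) : A p -> isproj p -> p <> 0 -> 0 < r ->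
    exists e, [/\ A e, isproj e, e <> 0 /\ e <> p, ple e p & t e < r].
  move=> Ap' pp' p0' r0'; have tp := tr_gt0 ht Ap' pp' p0'.
  have [|e [Ae pe en le te]] := small_proj hII (r := Num.min (r / 2) (t p / 2)) Ap' pp' p0'.
    by rewrite lt_min !divr_gt0.
  have : t e <= r / 2 /\ t e <= t p / 2 by apply/andP; rewrite -le_min.
  move=> [h1 h2]; exists e; split=> //; last by lra.
  by split=> // ep; move: h2; rewrite ep; lra.
have e3 : 0 < eps / 3 by rewrite divr_gt0.
have [|e' [Ae' pe' [e'0 e'p] le' te']] := small p0 (Num.min 1 (eps / 3)) Ap pp p00.
  by rewrite lt_min ltr01.
have te'0 := tr_gt0 ht Ae' pe' e'0.
(* The order of the choices matters: the tail in the corner of [e'] fixes the stage [n], and only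
   then is the bound [del] for [e] known. *)
have [n [y [By ey ye hy]]] := tail hII hB hF vs (fun n m nm => @image_subset _ _ G _ _ (EE' n m nm)) rn Ae' pe' te'0.
have [del d0 hdel] := r0 n _ e3.
have [e [Ae pe [en0 ee'] le te]] := small e' del Ae' pe' e'0 d0.
have [|L [L1 L2 L3]] := hdel e Ae pe; first by rewrite (tr_gt0 ht Ae pe en0).
have [pk hk] := part_map hA ht htB hF pl0.
set kl := [seq F p | p <- l0] in pk hk.
have finj := emb_inj hA ht htB hF.
have p0k : F p0 \in kl by apply: map_f.
have Fne a b : A a -> A b -> a <> b -> F a <> F b by move=> Aa Ab ab /(finj _ _ Aa Ab).
have Fn0 a : A a -> a <> 0 -> F a <> 0.
  by move=> Aa a0; rewrite -(em0 hA hF); apply: Fne => //; exact: (vna0 hA).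
have pk1 := part_refine hB pk p0k (em_into hF Ae') (em_proj hF Ae' pe') (em_ple hF Ae' Ap le')
  (Fn0 _ Ae' e'0) (Fne _ _ Ae' Ap e'p).
set kl1 := [:: F e', _ & _] in pk1.
have e1k : F e' \in kl1 by rewrite mem_head.
have pk2 := part_refine hB pk1 e1k (em_into hF Ae) (em_proj hF Ae pe) (em_ple hF Ae Ae' le)
  (Fn0 _ Ae en0) (Fne _ _ Ae Ae' ee').
set kl2 := [:: F e, _ & _] in pk2.
have w1 x : weight tB x kl1 <= weight tB x kl.
  exact: weight_refine hB htB pk p0k (em_into hF Ae') (em_proj hF Ae' pe') (em_ple hF Ae' Ap le').
have w2 x : weight tB x kl2 <= weight tB x kl1.
  exact: weight_refine hB htB pk1 e1k (em_into hF Ae) (em_proj hF Ae pe) (em_ple hF Ae Ae' le).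
have [P' hP' Pl'] := fset_part pk2.
pose Ys := [seq f x | x <- X] ++ bval y :: [seq bval z | z <- L].
pose Y : {fset op K} := seq_fset tt Ys.
have Yp := seq_fset_perm tt Ys.
have YE x : (x \in Y) = (x \in Ys) by rewrite (perm_mem Yp) mem_undup.
have YN : [set` Y] `<=` N.
  move=> x /=; rewrite YE mem_cat inE => /orP[/mapP[a aX ->]|/predU1P[->|/mapP[z zL ->]]].
  - by apply: (te_into hf); apply: XM.
  - exact: By.
  - by have [] := L1 z zL.
exists Y, P'; split=> //.
(* A von Neumann subalgebra containing [Y] regains the image of [M] by normality of [f], hence the
   identity; then stage [n] from [L], all stages from [y], and the image of [Q] by normality of
   [g]. *)
- apply/seteqP; split; first by apply: smallest_sub YN; exact: hN.1.1.
  rewrite -[X in X `<=` _]hgen => x Wx S [vS YS]; move: x Wx; apply: smallest_sub => //.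
  have SM x : M x -> S (f x).
    move=> Mx; apply: (Wstar_emb hMt hN hf vS XM) => //; last by rewrite WX.
    by move=> a aX; apply: YS; rewrite /= YE mem_cat map_f.
  pose S' := lift S `&` B.
  have hS' : vna S'.
    apply: vnaI hB; apply: nvna_vna; first exact: lift_nvna.
    by have := SM idfun hMt.1.2; rewrite (te_one hf).
  have oS' Z : Z `<=` S' -> over A B F Z S'.
    move=> ZS; split=> //; first by move=> ? [].
    move=> a Aa; split; last exact: (em_into hF).
    by rewrite /lift /= (bmapE hN hf) //; apply: SM.
  have Zn : G @` E n `<=` S'.
    apply: L3; first by apply: oS'.
    move=> z zL; split; last by have [] := L1 z zL.
    by apply: YS; rewrite /= YE mem_cat inE map_f // !orbT.
  have Sy : S' y by split=> //; apply: YS; rewrite /= YE mem_cat mem_head orbT.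
  have Zall := hy S' (oS' _ Zn) Sy.
  move=> _ [[x Mx <-]|[x Qx <-]]; first exact: SM.
  apply: (Wstar_emb hQ hN hg vS (X := \bigcup_n E0 n)) => //; last by rewrite WE.
    by move=> a [m _ /E0Q].
  move=> a [m _ Ea]; have Qa := E0Q m a Ea.
  pose ab := mkbop (ssa_bounded hQ.1.1.1 Qa).
  have [|h _] := Zall m (G ab); first by exists ab => //; apply: unitize_sub.
  by move: h; rewrite /lift /= (bmapE hN hg).
- rewrite (perm_big _ Yp) /=.
  (* The listed generators may coincide as elements of the finite set; since weights are
     nonnegative, removing duplicates can only lower the sum. *)
  have cw0 x : 0 <= cut_weight tauN x P'.
    have P0 p : p \in P' -> 0 <= complex.Re (tauN p).
      rewrite (perm_mem Pl') => /mapP[q qk ->]; have [kP _ _ _] := pk2.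
      by have [Bq pq] := kP q qk; apply: (nf_ge0 (tr_nfun htB) Bq pq).
    rewrite /cut_weight big_seq; apply: sumr_ge0 => p pP'; rewrite big_seq_cond.
    by apply: sumr_ge0 => q /andP[qP' _]; rewrite mulr_ge0 ?P0.
  have sub : {subset undup Ys <= Ys} by move=> x; rewrite mem_undup.
  apply: le_trans (ler_sum_sub (undup_uniq _) sub cw0) _.
  rewrite big_cat big_map big_cons big_map /=.
  have h1 : \sum_(x <- X) cut_weight tauN (f x) P' <= \sum_(x <- X) cut_weight tau x P.
    rewrite big_seq [X in _ <= X]big_seq; apply: ler_sum => x xX.
    have Mx : M x by apply: XM.
    pose xb := mkbop (ssa_bounded hMt.1.1.1 Mx).
    rewrite -[f x](bmapE hN hf (x := xb)) // (cut_weightE _ _ Pl') -[x]/(bval xb) (cut_weightE _ _ Pl0).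
    by apply: le_trans (w2 _) _; apply: le_trans (w1 _) _; apply: hk.
  have h2 : cut_weight tauN y P' <= eps / 3.
    rewrite (cut_weightE _ _ Pl'); apply: le_trans (w2 _) _.
    apply: le_trans (weight_corner hB htB pk1 e1k ey ye) _; rewrite (em_tr hF) //.
    move: te'; rewrite lt_min => /andP[]; nra.
  have h3 : \sum_(z <- L) cut_weight tauN z P' <= (size L)%:R * t e ^+ 2.
    apply: sum_le_const => z /L1[Bz ez ze].
    rewrite (cut_weightE _ _ Pl') -(em_tr hF Ae).
    by apply: weight_corner hB htB pk2 _ ez ze; rewrite mem_head.
  have := vs n; lra.
Qed.

End main.

Theorem theorem7p6 (R : realType) (H1 H2 K : hilbertType R)
    (M : set (op H1)) (tau : op H1 -> R[i])
    (Q : set (op H2)) (phi : op H2 -> R[i])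
    (N : set (op K)) (tauN : op K -> R[i]) (d : \bar R)
    (hM : II1_factor M tau)
    (hQ : tracial_vN Q phi)
    (hQh : hyperfinite Q)
    (hN : is_free_product M tau Q phi N tauN)
    (hd : is_delta0 Q phi d) :
  (generator_invariant N tauN
     <= generator_invariant M tau + (2^-1 : R)%:E * d)%E.
Proof.
have [f [g [hNt hf hg hfree hgen]]] := hN.
have [I [k [alpha [z0 [rho [had dE]]]]]] := hd.
have hD := lift_vna hQ.1; have htD := trace_lift hQ.
have s1 : sys (lift Q) [:: (1 : bop H2)].
  have [sP su so sf] := scalar_sys hD htD; split=> //.
    by move=> x /sP[[c ->] ? ?]; split=> //; apply: (vnaZ hD); exact: (vna1 hD).
  by apply: full_mono sf => _ [c ->]; apply: (vnaZ hD); exact: (vna1 hD).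
set e := (\esum_(i in I) _)%E in dE.
have e0 : (0 <= e)%E.
  by apply: esum_ge0 => i Ii; rewrite lee_fin divr_ge0 // ?sqr_ge0 ?exprn_ge0.
(* The lower bound applied to the list [[:: 1]] bounds the sum, so that [d] is a real number and can
   be moved across the inequality. *)
have efin : e \is a fin_num.
  rewrite ge0_fin_numE //; apply: le_lt_trans (sumsq_ge hQ had s1) _; exact: ltry.
have eE := fineK efin; set s := fine e in eE.
have hs l : sys (lift Q) l -> s <= sumsq (retr phi) l.
  by move=> sl; rewrite -lee_fin eE; apply: (sumsq_ge hQ had).
have -> : ((2^-1 : R)%:E * d = ((1 - s) / 2)%:E)%E.
  by rewrite dE -eE -EFinB -EFinM mulrC.
rewrite -leeBlDr // [X in (_ <= X)%E]/generator_invariant; apply/ereal_infP => _ [X [XM WX] <-].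
rewrite /cut_weight_set; apply/ereal_infP => _ [P hP <-].
rewrite leeBlDr //; apply/lee_addgt0Pr => eps eps0.
have [Y [P' [YN WY hP' le]]] := generate hM hQ hQh hNt hf hg hfree hgen eps0 hs XM WX hP.
apply: (@le_trans _ _ (cut_weight_set N tauN Y)); first by apply: ereal_inf_lbound; exists Y.
apply: (@le_trans _ _ (\sum_(y <- Y) cut_weight tauN y P')%:E); first by apply: ereal_inf_lbound; exists P'.
by rewrite -!EFinD lee_fin.
Qed.
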